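(* Under the assumptions in the context, the optimal values of the primal problem (P) and the dual problem (D) of the context are equal. Further, the dual problem (D) is solvable and strong duality holds between (P) and (D) (the optimal values are equal and both are attained).
   Context: **Setting.** $S$ and $A$ are Borel spaces (Borel subsets of complete separable metric spaces); $A(s)\in\mathcal B(A)$ for $s\in S$; $K=\{(s,a): a\in A(s)\}$ is closed in $S\times A$; $Q(\cdot\mid s,a)$ is a stochastic kernel on $S$ given $K$; $r:K\to\mathbb R$ and $z:K\to\mathbb R^n$ are measurable. $\Xi\subset\mathbb R^p$ is compact and $\{u(\cdot;\xi)\}_{\xi\in\Xi}$ is a family of increasing (componentwise order) concave functions $\mathbb R^n\to\mathbb R$ with $\xi\mapsto u(x;\xi)$ continuous on $\Xi$ for each $x$. $Y$ is a benchmark random vector in $\mathbb R^n$ such that $y(\xi)=\mathbb E[u(Y;\xi)]$ defines a function $y\in\mathcal C(\Xi)$. **Spaces and operators.** Let $w=1-r$ on $K$ and $\hat w(s)=1-\sup_{a\in A(s)}r(s,a)$ on $S$. $\mathcal M_w(K)$ is the space of signed Borel measures $\mu$ on $K$ with $\int_K w\,d|\mu|<\infty$; $\mathcal F_w(K)$ is the space of measurable $h:K\to\mathbb R$ with $\sup_K|h|/w<\infty$; $\langle\mu,h\rangle=\int_K h\,d\mu$. $\mathcal F_{\hat w}(S)$ is defined analogously. $\mathcal M(\Xi)$ is the space of finite signed Borel measures on $\Xi$ (dual of $\mathcal C(\Xi)$). $[L_0\mu](B)=\hat\mu(B)-\int_K Q(B\mid s,a)\mu(d(s,a))$ ($\hat\mu$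 = marginal on $S$); $[L_1\mu](\xi)=\int_K u(z(s,a);\xi)\mu(d(s,a))$, $\xi\in\Xi$. **Problems.** (P) maximize $\langle\mu,r\rangle$ subject to $L_0\mu=0$, $\langle\mu,1\rangle=1$, $L_1\mu\ge y$ on $\Xi$, $\mu\in\mathcal M_w(K)$, $\mu\ge0$. (D) minimize $\beta-\int_\Xi\mathbb E[u(Y;\xi)]\Lambda(d\xi)$ subject to $$r(s,a)+\int_\Xi u(z(s,a);\xi)\Lambda(d\xi)\le\beta+h(s)-\int_S h(\zeta)Q(d\zeta\mid s,a)\quad\forall(s,a)\in K,$$ $(h,\beta,\Lambda)\in\mathcal F_{\hat w}(S)\times\mathbb R\times\mathcal M(\Xi)$, $\Lambda\ge0$. **Assumptions.** (1) (P) is feasible. (2) $r\le0$ and for every $\epsilon\ge0$ the set $\{(s,a)\in K: r(s,a)\ge-\epsilon\}$ is compact. (3) $z$ is bounded and each component of $z$ is upper semicontinuous on $K$. (4) $Q$ is weakly continuous: $\int_S h(\xi)Q(d\xi\mid\cdot)$ is bounded continuous on $K$ for every bounded continuous $h$ on $S$. (5) $u(z(\cdot);\xi)\in\mathcal F_w(K)$ for all $\xi\in\Xi$. (6) $\int_S\hat w(\xi)Q(d\xi\mid\cdot)\in\mathcal F_w(K)$. (7) There is a minimizing sequence $(h^n,\beta^n,\Lambda^n)$ of feasible points for (D) with $\{\beta^n\}$ bounded in $\mathbb R$, $\{h^n\}$ bounded in $\mathcal F_{\hat w}(S)$, and $\{\Lambda^n\}$ bounded in the weak* topology on $\mathcal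 M(\Xi)$. *)

(* Defs.v *)
From HB Require Import structures.
From mathcomp Require Import all_boot all_order all_algebra.
From mathcomp Require Import all_classical all_reals all_analysis.
From mathcomp Require Import measurable_realfun metric_structure.

Set Implicit Arguments.
Unset Strict Implicit.
Unset Printing Implicit Defensive.

Import Order.TTheory GRing.Theory Num.Theory.
Import numFieldNormedType.Exports.

Local Open Scope classical_set_scope.
Local Open Scope ring_scope.

#[short(type="completeMetricType")]
HB.structure Definition CompleteMetric (R : realType) :=
  { M of Metric R M & Complete M }.

Definition separable (T : topologicalType) :=
  exists2 D : set T, countable D & dense D.

Notation borel T := (g_sigma_algebraType (@open T)).

(* Subsets S of a space X are kept as sets of the ambient type: functions on S
   are functions on X used only on S, and "continuous on S" refers to the
   relative topology ({within S, continuous _}). *)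

Definition closed_in (T : topologicalType) (B D : set T) :=
  exists2 C : set T, closed C & B = C `&` D.

Definition bounded_on (T : Type) (R : realType) (D : set T) (f : T -> R) :=
  exists M : R, forall x, D x -> `|f x| <= M.

(* In [subspace D] the points outside D are isolated, so only the behaviour of
   f on D, for the relative topology, is constrained. *)
Definition upper_semicontinuous_on (T : topologicalType) (R : realType)
    (D : set T) (f : T -> R) :=
  @lower_semicontinuous (subspace D) R (fun x => (- f x)%:E).

Definition nondecreasing_rV (R : realType) (n : nat) (f : 'rV[R]_n -> R) :=
  forall x y : 'rV[R]_n, (forall i, x ord0 i <= y ord0 i) -> f x <= f y.

Definition concave_rV (R : realType) (n : nat) (f : 'rV[R]_n -> R) :=
  convex_function [set: 'rV[R]_n] (fun x => - f x : R^o).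

Section signed_measures.
Context d (T : measurableType d) (R : realType).
Local Open Scope ereal_scope.
Implicit Types (mu : {charge set T -> \bar R}) (D : set T).

Lemma hahn_pair mu :
  {PN : set T * set T | hahn_decomposition mu PN.1 PN.2}.
Proof.
by apply: cid; have [P [N PN]] := Hahn_decomposition mu; exists (P, N).
Qed.

(* The Jordan decomposition does not depend on the chosen Hahn pair. *)
Definition charge_pos mu : {measure set T -> \bar R} :=
  jordan_pos (projT2 (hahn_pair mu)).

Definition charge_neg mu : {measure set T -> \bar R} :=
  jordan_neg (projT2 (hahn_pair mu)).

Definition charge_abs mu : {measure set T -> \bar R} :=
  charge_variation (projT2 (hahn_pair mu)).

Definition charge_integral mu D (f : T -> \bar R) : \bar R :=
  \int[charge_pos mu]_(x in D) f x - \int[charge_neg mu]_(x in D) f x.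

Definition charge_ge0 mu := forall B, measurable B -> 0 <= mu B.

(* A signed measure on a measurable subset D of T is identified with its
   extension by 0 to T. *)
Definition charge_on D mu :=
  forall B, measurable B -> B `&` D = set0 -> mu B = 0.

(* With x / +oo = 0, points where the weight is infinite impose no bound. *)
Definition weighted_norm D (w f : T -> \bar R) : \bar R :=
  ereal_sup [set `|f x| / w x | x in D].

Definition weighted_functions D (w : T -> \bar R) : set (T -> \bar R) :=
  [set f : T -> \bar R | measurable_fun D f /\ weighted_norm D w f < +oo].

Definition weighted_charges D (w : T -> \bar R) : set ({charge set T -> \bar R})%R :=
  [set mu | charge_on D mu /\ \int[charge_abs mu]_(x in D) w x < +oo].

End signed_measures.

(* Boundedness in the weak* topology of the dual of C(Xi), i.e. boundedness
   for each of the seminorms |<., f>|, f in C(Xi), defining that topology. *)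
Definition weak_star_bounded (R : realType) (p : nat) (Xi : set 'rV[R]_p)
    (Lambda : nat -> {charge set (borel 'rV[R]_p) -> \bar R}) :=
  forall f : 'rV[R]_p -> R, {within Xi, continuous f} ->
    exists M : R, forall n,
      (`|charge_integral (Lambda n) Xi (fun xi => (f xi)%:E)| <= M%:E)%E.

Section decision_process.
Context (R : realType) (ES EA : completeMetricType R).
Local Open Scope ereal_scope.

Variables (S : set ES) (Act : ES -> set EA).
Variable Q : ES * EA -> probability (borel ES) R.
Variable r : ES * EA -> R.

Definition graph_of : set (ES * EA) := [set k | S k.1 /\ Act k.1 k.2].

Local Notation K := graph_of.

Definition stochastic_kernel_on :=
  (forall k, K k -> Q k S = 1) /\
  (forall B : set (borel ES), measurable B ->
    measurable_fun (K : set (borel (ES * EA)%type)) (fun k => Q k B)).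

Definition weakly_continuous_on :=
  forall h : ES -> R, {within S, continuous h} -> bounded_on S h ->
    let Qh := fun k => (\int[Q k]_(s in S) h s)%R in
    {within K, continuous Qh} /\ bounded_on K Qh.

Definition weight (k : ES * EA) : \bar R := 1 - (r k)%:E.

(* The supremum is -oo, and the weight +oo, at a state with no action. *)
Definition state_weight (s : ES) : \bar R :=
  1 - ereal_sup [set (r (s, a))%:E | a in Act s].

Variables (n : nat) (z : ES * EA -> 'rV[R]_n).
Variables (p : nat) (Xi : set 'rV[R]_p) (u : 'rV[R]_n -> 'rV[R]_p -> R).
Variable y : 'rV[R]_p -> R.

Implicit Types (mu : {charge set (borel (ES * EA)%type) -> \bar R}).

Definition L0 mu (B : set ES) : \bar R :=
  pushforward mu (fst : borel (ES * EA)%type -> borel ES) B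
  - charge_integral mu K (fun k => Q k B).

Definition L1 mu (xi : 'rV[R]_p) : \bar R :=
  charge_integral mu K (fun k => (u (z k) xi)%:E).

Definition primal_feasible : set ({charge set (borel (ES * EA)%type) -> \bar R})%R :=
  [set mu |
    [/\ weighted_charges (K : set (borel (ES * EA)%type)) weight mu,
        charge_ge0 mu,
        forall B : set (borel ES), measurable B -> B `<=` S -> L0 mu B = 0,
        charge_integral mu K (cst 1) = 1 &
        forall xi, Xi xi -> (y xi)%:E <= L1 mu xi]].

Definition primal_objective mu : \bar R :=
  charge_integral mu K (fun k => (r k)%:E).

Definition primal_value : \bar R :=
  ereal_sup [set primal_objective mu | mu in primal_feasible].

Definition dual_variable : Type :=
  (ES -> R) * R * {charge set (borel 'rV[R]_p) -> \bar R}.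

Definition dual_feasible : set dual_variable :=
  [set x | let: (h, beta, Lambda) := x in
    [/\ weighted_functions (S : set (borel ES)) state_weight
          (fun s => (h s)%:E),
        charge_on (Xi : set (borel 'rV[R]_p)) Lambda,
        charge_ge0 Lambda &
        forall k, K k ->
          (r k)%:E + charge_integral Lambda Xi (fun xi => (u (z k) xi)%:E)
          <= beta%:E + (h k.1)%:E - \int[Q k]_(s in S) (h s)%:E]].

Definition dual_objective (x : dual_variable) : \bar R :=
  x.1.2%:E - charge_integral x.2 Xi (fun xi => (y xi)%:E).

Definition dual_value : \bar R :=
  ereal_inf [set dual_objective x | x in dual_feasible].

End decision_process.

Definition benchmark d (Omega : measurableType d) (R : realType)
    (P : probability Omega R) (n p : nat) (u : 'rV[R]_n -> 'rV[R]_p -> R)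
    (Y : Omega -> 'rV[R]_n) (xi : 'rV[R]_p) : R :=
  fine ('E_P[fun omega => u (Y omega) xi])%E.

(* Main.v *)
Require Import Defs.
From HB Require Import structures.
From mathcomp Require Import all_boot all_order all_algebra finmap.
From mathcomp Require Import all_classical all_reals all_analysis.
From mathcomp Require Import measurable_realfun metric_structure.
From mathcomp Require Import giry.
From mathcomp Require Import ring lra.

Set Implicit Arguments.
Unset Strict Implicit.
Unset Printing Implicit Defensive.

Import Order.TTheory GRing.Theory Num.Theory.
Import numFieldNormedType.Exports.

Local Open Scope classical_set_scope.
Local Open Scope ring_scope.

(* Weak duality: integrate the dual constraint against a primal feasible mu;
   stationarity cancels the terms in h, and int y dLambda is compared with the
   double integral of u through Riemann sums over Xi.

   Compactness: since {r >= -c} is compact, occupation measures of bounded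
   below reward are tight, and along an ultrafilter they converge weakly to an
   occupation measure. The reward and the functions u(z(.); xi) are upper
   semicontinuous, so the reward and the benchmark constraints pass to the
   limit, and stationarity need only be tested on bounded continuous h. Applied
   to a maximizing sequence, this gives primal attainment.

   No gap: let v exceed the primal value. A multiplier is a pair (h, Lambda)
   with h bounded continuous and Lambda >= 0. If none made r plus its penalty
   at most v on K, then, by induction on the length with a Lagrange multiplier
   for a single constraint at each step, every finite list of multipliers would
   be nearly satisfied by a measure of reward at least v, and an ultralimit
   along the finite lists would be feasible with reward at least v.

   Dual attainment: a subsequence of Lambda^n converges weakly and one of
   beta^n converges; h is the lower limit of h^n along it, and Fatou's lemma
   yields the dual constraint, the weight being Q-integrable by (6). *)

(** * Ultralimits of tight families of measures *)

(** The obstacle is that the limit of the masses of a set along an ultrafilter always exists but is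
    only finitely additive in the set. A Borel measure is rebuilt from it by inner approximation
    with compact sets and outer approximation with open sets. This keeps one relation to the family,
    [mu O <= lim (m i O)] for open [O], together with the total mass when the family is tight. Layer
    sums turn that relation into an inequality for integrals of nonnegative lower semicontinuous
    functions, so every limit passage has to be one-sided: equalities are recovered by testing both
    [h] and [- h], and bounded functions by adding a constant.

    The multipliers use bounded continuous [h] because their drift is then bounded and continuous,
    so it is integrable for every probability and survives the limit. The finite lists work with
    slack [1] instead of exact constraints: this makes the given feasible measure a strict Slater
    point at every step, and since multipliers may be rescaled by [1/e], slack [1] for all of them
    is slack [e] for each. *)

HB.instance Definition _ (T U : ptopologicalType) := Pointed.on (T * U)%type.

Lemma prod_hausdorff (T U : topologicalType) :
  hausdorff_space T -> hausdorff_space U -> hausdorff_space (T * U)%type.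
Proof.
move=> hT hU [p1 p2] [q1 q2] pq; congr pair.
- apply: hT => A B Ap Bq.
  have [||[x1 x2] []] := pq (fst @^-1` A) (fst @^-1` B).
  + exact: (@cvg_fst _ _ (nbhs p1) (nbhs p2)).
  + exact: (@cvg_fst _ _ (nbhs q1) (nbhs q2)).
  + by exists x1.
- apply: hU => A B Ap Bq.
  have [||[x1 x2] []] := pq (snd @^-1` A) (snd @^-1` B).
  + exact: (@cvg_snd _ _ (nbhs p1) (nbhs p2)).
  + exact: (@cvg_snd _ _ (nbhs q1) (nbhs q2)).
  + by exists x2.
Qed.

Lemma closed_borel (T : ptopologicalType) (C : set T) :
  closed C -> measurable (C : set (borel T)).
Proof.
move=> /closed_openC oC; rewrite -(setCK C); apply: measurableC.
exact: sub_sigma_algebra.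
Qed.

(** By regularity each point of [C] has an open neighbourhood whose closure stays in some [U i].
    Compactness keeps finitely many of them, and [D i] collects the closures assigned to the index
    [i]. The sets [D i] cut [C] into compact pieces, one inside each [U i], which gives the
    countable subadditivity below. *)
Lemma compact_split_cover (T : ptopologicalType) (C : set T)
    (U : (set T)^nat) : regular_space T -> compact C ->
  (forall i, open (U i)) -> C `<=` \bigcup_i U i ->
  exists N (D : (set T)^nat), (forall i, closed (D i) /\ D i `<=` U i) /\
    C `<=` \big[setU/set0]_(i < N) D i.
Proof.
move=> regT cC oU CU.
have /choice[g gP] x : exists iW : nat * set T, C x ->
    [/\ open iW.2, iW.2 x & closure iW.2 `<=` U iW.1].
  have [Cx|] := pselect (C x); last by exists (0%N, setT).
  have [i _ Uix] := CU _ Cx.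
  have [V Vx VU] : filter_from (nbhs x) closure (U i).
    by apply: regT; apply: open_nbhs_nbhs.
  exists (i, V°) => _; split => //=.
  - exact: open_interior.
  - exact: subset_trans (closureS (@interior_subset _ _)) VU.
move: cC; rewrite compact_cover => /(_ T C (fun x => (g x).2))[|x Cx|].
- by move=> x /gP[].
- by exists x => //; have [] := gP _ Cx.
move=> D' D'C CD'.
pose N := (\max_(x <- finmap.enum_fset D') (g x).1).+1.
pose D i := \bigcup_(x in [set x | [set` D'] x /\ (g x).1 = i]) closure (g x).2.
exists N, D; split=> [i|x /CD' [y /= yD' gyx]].
  split.
    apply: closed_bigcup => [|? _]; last exact: closed_closure.
    by apply: sub_finite_set (finite_fset D') => x [].
  move=> x [y /= [yD' <-]].
  have Cy : C y by apply: set_mem; exact: D'C.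
  by have [_ _] := gP _ Cy; apply.
rewrite -(bigcup_mkord N); exists (g y).1 => /=.
  by rewrite ltnS; apply: (@leq_bigmax_seq _ _ xpredT (fun x => (g x).1) y).
by exists y => //; exact: subset_closure.
Qed.

Lemma fmap_ultra (T U : Type) (f : T -> U) (F : set_system T) :
  UltraFilter F -> UltraFilter (f @ F).
Proof.
move=> FU; constructor => [|G GF fG]; first exact: fmap_proper_filter.
rewrite eqEsubset; split => [A GA|//].
have [//|FA] := in_ultra_setVsetC (f @^-1` A) FU.
have : G (A `&` ~` A) by apply: filterI => //; exact: fG.
by rewrite setICr => /filter_ex[].
Qed.

Lemma le_filter_lim (R : realType) (I : Type) (F : set_system I)
    (FF : ProperFilter F) (f g : I -> R) (a b : R) :
  f i @[i --> F] --> a -> g i @[i --> F] --> b ->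
  (\forall i \near F, f i <= g i) -> a <= b.
Proof.
move=> fa gb fg; rewrite -subr_ge0.
have gfab : g i - f i @[i --> F] --> b - a by exact: cvgB.
rewrite -(cvg_lim _ gfab)//; apply: limr_ge; first by apply/cvg_ex; exists (b - a).
by near=> i; rewrite subr_ge0; near: i.
Unshelve. all: by end_near. Qed.

Section ultralimit.
Context (R : realType) (T : ptopologicalType).
Context (I : Type) (F : set_system I) {FU : UltraFilter F}.
Variable m : I -> {measure set (borel T) -> \bar R}.
Variable M : R.
Hypothesis mM : forall i, (m i setT <= M%:E)%E.

(** The limit exists because the masses lie in the compact interval from [0] to [M]. It is finitely
    additive only, mass may escape along a decreasing sequence of sets, so it is not itself the
    limit measure. *)
Definition ultralim (B : set T) : R := lim (fine (m i B) @[i --> F]).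
Local Notation nu := ultralim.
Local Notation meas B := (measurable (B : set (borel T))).

Lemma ultra_mass_fin i B : meas B -> m i B \is a fin_num.
Proof.
move=> mB; rewrite ge0_fin_numE//; apply: le_lt_trans (ltry M).
by apply: (le_trans _ (mM i)); apply: le_measure; rewrite ?inE.
Qed.

Lemma ultralim_cvg B : meas B -> fine (m i B) @[i --> F] --> nu B.
Proof.
move=> mB; have := @segment_compact R 0 M; rewrite compact_ultra.
move=> /(_ (fine (m i B) @[i --> F]) (fmap_ultra _ _))[].
- apply: nearW => i /=; rewrite in_itv/= fine_ge0//=.
  rewrite -lee_fin fineK ?ultra_mass_fin//; apply: le_trans (mM i).
  by apply: le_measure; rewrite ?inE.
- by move=> l [_ /= ml]; apply/cvg_ex; exists l.
Qed.

Lemma ultralim_ge0 B : meas B -> 0 <= nu B.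
Proof.
move=> mB; apply: limr_ge; first by apply/cvg_ex; exists (nu B); exact: ultralim_cvg.
by apply: nearW => i; exact: fine_ge0.
Qed.

Lemma le_ultralim A B : meas A -> meas B -> A `<=` B -> nu A <= nu B.
Proof.
move=> mA mB AB.
apply: (le_filter_lim _ (ultralim_cvg mA) (ultralim_cvg mB)).
apply: nearW => i; rewrite fine_le ?ultra_mass_fin//.
by apply: le_measure; rewrite ?inE.
Qed.

Lemma ultralimU A B : meas A -> meas B -> A `&` B = set0 ->
  nu (A `|` B) = nu A + nu B.
Proof.
move=> mA mB AB0; apply/cvg_lim => //.
rewrite (_ : (fun i => _) = fun i => fine (m i A) + fine (m i B)).
  by apply: cvgD; exact: ultralim_cvg.
apply/funext => i; rewrite measureU//.
by rewrite fineD ?ultra_mass_fin.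
Qed.

Lemma ultralimU_le A B : meas A -> meas B -> nu (A `|` B) <= nu A + nu B.
Proof.
move=> mA mB; rewrite -(setDUK (@subsetUl _ A B)) ultralimU//; last 2 first.
  by apply: measurableD => //; exact: measurableU.
  by rewrite setDE setICA setICr setI0.
rewrite lerD2l; apply: le_ultralim => //.
  by apply: measurableD => //; exact: measurableU.
by move=> x [[]].
Qed.

Lemma ultralim_bigsetU N (A : nat -> set T) : (forall i, meas (A i)) ->
  nu (\big[setU/set0]_(i < N) A i) <= \sum_(i < N) nu (A i).
Proof.
move=> mA; elim: N => [|N ih].
  rewrite !big_ord0 /nu; under eq_fun do rewrite measure0.
  by rewrite lim_cst.
rewrite !big_ord_recr/=; apply: le_trans (ultralimU_le _ _) _ => //.
  exact: bigsetU_measurable.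
by rewrite lerD2r.
Qed.

Hypothesis hT : hausdorff_space T.
Hypothesis regT : regular_space T.

Let compact_meas C : compact C -> meas C.
Proof. by move=> /(compact_closed hT); exact: closed_borel. Qed.

Let open_meas U : open U -> meas U.
Proof. exact: sub_sigma_algebra. Qed.

(** The inner content of the usual construction of a Radon measure; [outer_ultralim] extends it from
    open sets to all sets, and Carathéodory's criterion then yields the measure. *)
Definition inner_ultralim (U : set T) : \bar R :=
  ereal_sup [set (nu C)%:E | C in [set C | compact C /\ C `<=` U]].
Local Notation lambda := inner_ultralim.

Lemma inner_ultralim_ge0 U : (0 <= lambda U)%E.
Proof.
apply: le_ereal_sup_tmp; exists (nu set0)%:E.
  by exists set0 => //; split => //; exact: compact0.
by rewrite lee_fin ultralim_ge0.
Qed.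

Lemma le_inner_ultralim U V : U `<=` V -> (lambda U <= lambda V)%E.
Proof.
move=> UV; apply: ereal_sup_le => _ [C [cC CU] <-]; exists C => //; split => //.
exact: subset_trans UV.
Qed.

Lemma inner_ultralim_le U : open U -> (lambda U <= (nu U)%:E)%E.
Proof.
move=> oU; apply: ge_ereal_sup => _ [C [cC CU] <-]; rewrite lee_fin.
by apply: le_ultralim => //; [exact: compact_meas|exact: open_meas].
Qed.

Lemma inner_ultralim_lty U : (lambda U < +oo)%E.
Proof.
apply: le_lt_trans (le_inner_ultralim (@subsetT _ U)) _.
exact: le_lt_trans (inner_ultralim_le openT) (ltry _).
Qed.

Lemma inner_ultralim_fin U : lambda U \is a fin_num.
Proof. by rewrite ge0_fin_numE ?inner_ultralim_ge0// inner_ultralim_lty. Qed.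

Lemma inner_ultralim_adherent U (e : R) : 0 < e ->
  exists C, [/\ compact C, C `<=` U & (lambda U - e%:E <= (nu C)%:E)%E].
Proof.
move=> e0; have [_ [C [cC CU] <-] /ltW lC] :=
  ub_ereal_sup_adherent e0 (inner_ultralim_fin U).
by exists C.
Qed.

(** A compact subset of the union splits into finitely many compact pieces, each in one [U i], so
    the finite subadditivity of [ultralim] is enough. *)
Lemma inner_ultralim_subadd (U : (set T)^nat) : (forall i, open (U i)) ->
  (lambda (\bigcup_i U i) <= \sum_(i <oo) lambda (U i))%E.
Proof.
move=> oU; apply: ge_ereal_sup => _ [C [cC CU] <-].
have [N [D [DP CD]]] := compact_split_cover regT cC oU CU.
have cCD i : compact (C `&` D i) by apply: compact_closedI => //; case: (DP i).
have -> : C = \big[setU/set0]_(i < N) (C `&` D i).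
  by rewrite -big_distrr/=; apply/esym/setIidPl.
apply: (@le_trans _ _ (\sum_(i < N) (nu (C `&` D i))%:E)%E).
  rewrite sumEFin lee_fin; apply: (@ultralim_bigsetU N (fun i => C `&` D i)).
  by move=> i; exact: compact_meas.
apply: (@le_trans _ _ (\sum_(i < N) lambda (U i))%E).
  apply: lee_sum => i _; apply: ereal_sup_ubound; exists (C `&` D i) => //.
  by split => //; case: (DP i) => _ DU x [_ /DU].
rewrite -(big_mkord xpredT (fun i => lambda (U i))).
by apply: nneseries_lim_ge => *; exact: inner_ultralim_ge0.
Qed.

Definition outer_ultralim (A : set T) : \bar R :=
  ereal_inf [set lambda U | U in [set U | open U /\ A `<=` U]].
Local Notation mustar := outer_ultralim.

Lemma outer_ultralim_open U : open U -> mustar U = lambda U.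
Proof.
move=> oU; apply/eqP; rewrite eq_le; apply/andP; split.
  by apply: ereal_inf_lbound; exists U => //; split.
by apply: le_ereal_inf_tmp => _ [V [oV UV] <-]; exact: le_inner_ultralim.
Qed.

Lemma outer_ultralim_ge0 A : (0 <= mustar A)%E.
Proof. by apply: le_ereal_inf_tmp => _ [V _ <-]; exact: inner_ultralim_ge0. Qed.

Lemma le_outer_ultralim : {homo mustar : A B / A `<=` B >-> (A <= B)%E}.
Proof.
move=> A B AB; apply: ereal_inf_le_tmp => _ [V [oV BV] <-]; exists V => //.
by split => //; exact: subset_trans BV.
Qed.

Lemma outer_ultralim_fin A : mustar A \is a fin_num.
Proof.
rewrite ge0_fin_numE ?outer_ultralim_ge0//.
apply: le_lt_trans (le_outer_ultralim (@subsetT _ A)) _.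
by rewrite outer_ultralim_open; [exact: inner_ultralim_lty|exact: openT].
Qed.

Lemma outer_ultralim_adherent A (e : R) : 0 < e ->
  exists U, [/\ open U, A `<=` U & (lambda U <= mustar A + e%:E)%E].
Proof.
move=> e0; have [_ [U [oU AU] <-] /ltW lU] :=
  lb_ereal_inf_adherent e0 (outer_ultralim_fin A).
by exists U.
Qed.

Lemma outer_ultralim0 : mustar set0 = 0%E.
Proof.
apply/eqP; rewrite eq_le outer_ultralim_ge0 andbT outer_ultralim_open; last exact: open0.
apply: le_trans (inner_ultralim_le open0) _; rewrite lee_fin /nu.
by under eq_fun do rewrite measure0; rewrite lim_cst.
Qed.

Lemma outer_ultralim_subadd : sigma_subadditive mustar.
Proof.
move=> A; apply/lee_addgt0Pr => e e0.
have e0' i : 0 < e / (2 ^ i.+1)%:R by rewrite divr_gt0// ltr0n expn_gt0.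
have /choice[U UP] i := @outer_ultralim_adherent (A i) _ (e0' i).
have oU : open (\bigcup_i U i) by apply: bigcup_open => i _; case: (UP i).
apply: (@le_trans _ _ (lambda (\bigcup_i U i))).
  rewrite -outer_ultralim_open//; apply: le_outer_ultralim.
  by apply: subset_bigcup => i _; case: (UP i).
apply: le_trans (inner_ultralim_subadd _) _; first by move=> i; case: (UP i).
apply: (le_trans _ (epsilon_trick _ _ _)) => //; last 2 first.
- by move=> *; exact: outer_ultralim_ge0.
- exact: ltW.
by apply: lee_nneseries => i _ *; [exact: inner_ultralim_ge0|case: (UP i)].
Qed.

HB.instance Definition _ := isOuterMeasure.Build R T outer_ultralim
  outer_ultralim0 outer_ultralim_ge0 le_outer_ultralim outer_ultralim_subadd.

(** Take [U] open around [A], [C] compact in [U] and [O], then [D] compact in the open set [U] minus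
    [C], each optimal up to [e / 3]. Since [C] and [D] are disjoint, [nu C + nu D] is at most the
    content of [U]; and as [C] lies in [O], the part of [A] outside [O] is covered by [U] minus
    [C]. *)
Lemma caratheodory_outer_ultralim (O : set T) : open O ->
  mustar.-caratheodory O.
Proof.
move=> oO; apply: le_caratheodory_measurable => A.
change (mustar (A `&` O) + mustar (A `&` ~` O) <= mustar A)%E.
apply/lee_addgt0Pr => e e0.
have e30 : 0 < e / 3 by rewrite divr_gt0.
have [U [oU AU lU]] := outer_ultralim_adherent A e30.
have [C [cC CUO lC]] := inner_ultralim_adherent (U `&` O) e30.
have oUC : open (U `\` C).
  by apply: openI => //; apply: closed_openC; exact: compact_closed.
have [D [cD DUC lD]] := inner_ultralim_adherent (U `\` C) e30.
have CD0 : C `&` D = set0 by apply/disjoints_subset => x Cx /DUC[].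
have CDU : (nu C + nu D <= fine (lambda U)).
  rewrite -lee_fin fineK ?inner_ultralim_fin//; apply: ereal_sup_ubound.
  exists (C `|` D); last by rewrite ultralimU//; exact: compact_meas.
  split; first exact: compactU.
  by move=> x [/CUO[]|/DUC[]].
have A1 : (mustar (A `&` O) <= lambda (U `&` O))%E.
  rewrite -outer_ultralim_open; last exact: openI.
  by apply: le_outer_ultralim; exact: setSI.
have A2 : (mustar (A `&` ~` O) <= lambda (U `\` C))%E.
  rewrite -outer_ultralim_open//; apply: le_outer_ultralim => x [/AU Ux nOx].
  by split => // /CUO[].
apply: (le_trans (leeD A1 A2)).
have finE (x : \bar R) : x \is a fin_num -> exists y : R, x = y%:E.
  by move=> fx; exists (fine x); rewrite fineK.
have [lamU EU] := finE _ (inner_ultralim_fin U).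
have [lamUO EUO] := finE _ (inner_ultralim_fin (U `&` O)).
have [lamUC EUC] := finE _ (inner_ultralim_fin (U `\` C)).
have [muA EA] := finE _ (outer_ultralim_fin A).
move: lU lC lD CDU; rewrite EU EUO EUC EA -!EFinB -!EFinD !lee_fin/=.
by clear => lU lC lD CDU; lra.
Qed.

Lemma caratheodory_outer_borel (B : set T) : meas B -> mustar.-caratheodory B.
Proof.
have sC : sigma_algebra setT mustar.-caratheodory.
  split.
  - exact: (caratheodory_measurable_set0 outer_ultralim).
  - move=> A mA; rewrite setTD.
    exact: (@caratheodory_measurable_setC _ _ outer_ultralim).
  - exact: (@caratheodory_measurable_bigcup _ _ outer_ultralim).
move: B; apply: smallest_sub => // O; exact: caratheodory_outer_ultralim.
Qed.

Definition ultralim_measure (B : set (borel T)) : \bar R := outer_ultralim B.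

Let ultralim_measure0 : ultralim_measure set0 = 0%E.
Proof. exact: outer_ultralim0. Qed.

Let ultralim_measure_ge0 B : (0 <= ultralim_measure B)%E.
Proof. exact: outer_ultralim_ge0. Qed.

Let ultralim_measure_sigma_additive : semi_sigma_additive ultralim_measure.
Proof.
move=> A mA tA mU.
apply: (@caratheodory_measure_sigma_additive _ _ outer_ultralim) => //.
- by move=> i; exact: caratheodory_outer_borel.
- exact: caratheodory_outer_borel.
Qed.

HB.instance Definition _ := isMeasure.Build _ (borel T) R ultralim_measure
  ultralim_measure0 ultralim_measure_ge0 ultralim_measure_sigma_additive.

Lemma ultralim_measure_fin B : ultralim_measure B \is a fin_num.
Proof. exact: outer_ultralim_fin. Qed.

Lemma ultralim_measure_open (U : set T) : open U ->
  fine (ultralim_measure U) <= nu U.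
Proof.
move=> oU; rewrite -lee_fin fineK ?ultralim_measure_fin//.
by rewrite /ultralim_measure outer_ultralim_open// inner_ultralim_le.
Qed.

(** Compact inner approximation could lose mass; tightness provides a compact set that carries all
    but [e] of it uniformly in [i]. *)
Lemma ultralim_measureT :
  (forall e : R, 0 < e ->
    exists2 C, compact C & forall i, (m i (~` C) <= e%:E)%E) ->
  ultralim_measure setT = (nu setT)%:E.
Proof.
move=> tight; apply/eqP; rewrite eq_le; apply/andP; split.
  rewrite -[leLHS](fineK (ultralim_measure_fin _)) lee_fin.
  exact: (ultralim_measure_open openT).
apply/lee_addgt0Pr => e e0; have [C cC mC] := tight e e0.
apply: (@le_trans _ _ ((nu C)%:E + e%:E)%E); last first.
  rewrite leeD2r// /ultralim_measure outer_ultralim_open; last exact: openT.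
  by apply: ereal_sup_ubound; exists C.
have mC' := compact_meas cC.
rewrite -EFinD lee_fin -(setUv C) ultralimU//; last 2 first.
- exact: measurableC.
- exact: setICr.
rewrite lerD2l.
apply: (le_filter_lim _ (ultralim_cvg (measurableC mC')) (cvg_cst e)).
apply: nearW => i.
by rewrite -lee_fin fineK ?ultra_mass_fin//; exact: measurableC.
Qed.

Lemma ultralim_measure_exists :
  (forall e : R, 0 < e ->
    exists2 C, compact C & forall i, (m i (~` C) <= e%:E)%E) ->
  exists mu : {measure set (borel T) -> \bar R}, mu setT = (nu setT)%:E /\
    forall U : set T, open U -> fine (mu U) <= nu U.
Proof.
move=> tight; exists ultralim_measure.
by split; [exact: ultralim_measureT|move=> U; exact: ultralim_measure_open].
Qed.

End ultralimit.

(** * Lower semicontinuous integrands *)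

(** Superlevel sets are required to be traces of open sets of the whole space, because the limit
    measure is compared with the family on such open sets. *)
Definition lsc_on (R : realType) (T : topologicalType) (D : set T)
    (f : T -> R) :=
  forall c, exists2 O, open O & D `&` [set x | c < f x] = D `&` O.

Lemma measurable_lsc_on (R : realType) (T : ptopologicalType) (D : set T)
    (f : T -> R) : measurable (D : set (borel T)) -> lsc_on D f ->
  measurable_fun (D : set (borel T)) f.
Proof.
move=> mD lf; apply: (@measurability _ _ _ _ _ _ (@RGenOInfty.G R)).
  exact: RGenOInfty.measurableE.
move=> _ [_ [c ->] <-]; have [ O oO DO] := lf c.
rewrite (_ : D `&` _ = D `&` O); first by apply: measurableI => //; exact: sub_sigma_algebra.
by rewrite -DO; congr (_ `&` _); apply/seteqP; split => x /=; rewrite in_itv/= andbT.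
Qed.

Lemma limn_einf_le (R : realType) (u : (\bar R)^nat) (c : \bar R) :
  (forall n, (u n <= c)%E) -> (limn_einf u <= c)%E.
Proof.
move=> uc; rewrite limn_einf_lim; apply: lime_le; first exact: is_cvg_einfs.
apply: nearW => n; apply: le_trans (uc n); apply: ereal_inf_lbound.
by exists n => //=.
Qed.

Section layers.
Context (R : realType) (T : Type).
Implicit Types (f : T -> R) (h : R).

(** A discrete layer-cake sum: it approximates a nonnegative [f] from below with error at most [h]
    up to the height [n * h], and its integral involves only masses of superlevel sets. *)
Definition layers h n f (x : T) : R :=
  \sum_(k < n) h * (k.+1%:R * h < f x)%R%:R.

Lemma layers_ge0 h n f x : 0 <= h -> 0 <= layers h n f x.
Proof. by move=> h0; apply: sumr_ge0 => k _; rewrite mulr_ge0. Qed.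

Lemma layers_le h n f x : 0 <= h -> 0 <= f x ->
  layers h n f x <= f x /\ layers h n f x <= n%:R * h.
Proof.
move=> h0 f0; elim: n => [|n [ih1 ih2]].
  by rewrite /layers big_ord0 mul0r.
rewrite /layers big_ord_recr/= -/(layers h n f x).
have E : n.+1%:R * h = n%:R * h + h by rewrite -natr1 mulrDl mul1r.
case: ltP => [nf|_]; rewrite ?mulr1 ?mulr0 ?addr0.
  by split; [apply: le_trans (ltW nf); rewrite E lerD2r|rewrite E lerD2r].
by split => //; rewrite E (le_trans ih2)// lerDl.
Qed.

Lemma layers_ge h n f x : 0 <= h ->
  (n%:R * h < f x -> n%:R * h <= layers h n f x) /\
  (f x <= n%:R * h -> f x - h <= layers h n f x).
Proof.
move=> h0; elim: n => [|n [ih1 ih2]].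
  rewrite /layers big_ord0 mul0r; split => // f0.
  by rewrite lerBlDr add0r (le_trans f0).
rewrite /layers big_ord_recr/= -/(layers h n f x).
have E : n.+1%:R * h = n%:R * h + h by rewrite -natr1 mulrDl mul1r.
split => nf.
  rewrite nf mulr1 E lerD2r; apply: ih1; apply: le_lt_trans nf.
  by rewrite E lerDl.
rewrite ltNge nf/= mulr0 addr0; have [/ih2//|nf'] := leP (f x) (n%:R * h).
by rewrite (le_trans _ (ih1 nf'))// lerBlDr -E.
Qed.

(** With step [1/(n+1)] and [(n+1)^2] layers the cap is [n+1]: the step tends to [0] while the cap
    tends to infinity. *)
Lemma cvg_layers f x : 0 <= f x ->
  layers n.+1%:R^-1 (n.+1 * n.+1)%N f x @[n --> \oo] --> f x.
Proof.
move=> f0; apply/cvgrPdist_le => e e0; near=> n.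
have n0 : 0 <= (n.+1%:R : R)^-1 by rewrite invr_ge0.
have fn : f x <= (n.+1 * n.+1)%:R * n.+1%:R^-1.
  rewrite natrM mulfK ?pnatr_eq0//; apply: (@le_trans _ _ n%:R).
    by near: n; exact: nbhs_infty_ger.
  by rewrite ler_nat.
have [h1 _] := layers_le (n.+1 * n.+1) n0 f0.
have [_ /(_ fn) h2] := layers_ge (n.+1 * n.+1) f x n0.
rewrite ger0_norm ?subr_ge0// lerBlDr (le_trans (y := n.+1%:R^-1 + layers n.+1%:R^-1 (n.+1 * n.+1) f x))//.
  by rewrite -lerBlDl.
by rewrite lerD2r; near: n; apply: filterS (near_infty_natSinv_lt (PosNum e0)) => k /ltW.
Unshelve. all: by end_near. Qed.

End layers.

(** * Portmanteau inequality along an ultrafilter *)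

Section portmanteau.
Context (R : realType) (T : ptopologicalType).
Context (I : Type) (F : set_system I) {FU : UltraFilter F}.
Variable m : I -> {measure set (borel T) -> \bar R}.
Variable M : R.
Hypothesis mM : forall i, (m i setT <= M%:E)%E.
Variable mu : {measure set (borel T) -> \bar R}.
Hypothesis mufin : (mu setT < +oo)%E.
Hypothesis muO : forall O : set T, open O -> fine (mu O) <= ultralim F m O.
Variable D : set T.
Hypothesis mD : measurable (D : set (borel T)).
Hypothesis muD : mu (~` D) = 0%E.
Hypothesis mmD : forall i, m i (~` D) = 0%E.

Let measO (O : set T) : open O -> measurable (O : set (borel T)).
Proof. exact: sub_sigma_algebra. Qed.

(** On [D] each superlevel set is the trace of an open [O k], and the rest of [O k] is null because
    [rho] does not charge the complement of [D]. *)
Lemma integral_layers (rho : {measure set (borel T) -> \bar R})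
    (h : R) n (f : T -> R) (O : nat -> set T) :
  (rho setT < +oo)%E -> rho (~` D) = 0%E -> 0 <= h ->
  (forall k, open (O k) /\ D `&` [set x | k.+1%:R * h < f x] = D `&` O k) ->
  (\int[rho]_(x in D) (layers h n f x)%:E =
   (\sum_(k < n) h * fine (rho (O k)))%:E)%E.
Proof.
move=> rhofin rhoD h0 OP.
have mO k : measurable (O k : set (borel T)) by apply: measO; case: (OP k).
transitivity (\int[rho]_(x in D) (\sum_(k < n) h%:E * (\1_(O k) x)%:E))%E.
  apply: eq_integral => x; rewrite inE => Dx.
  rewrite /layers -sumEFin; apply: eq_bigr => k _; rewrite -EFinM indicE.
  congr (_ * (nat_of_bool _)%:R)%:E; apply/idP/idP => [kf|].
    by rewrite inE; have [] : (D `&` O k) x by case: (OP k) => _ <-.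
  by rewrite inE => Okx; have [] : (D `&` [set x | k.+1%:R * h < f x]) x by case: (OP k) => _ ->.
rewrite ge0_integral_sum//; last 2 first.
- move=> k; apply: measurable_funeM; apply/measurable_EFinP.
  exact: measurable_indic.
- by move=> k x _; rewrite mule_ge0// lee_fin.
rewrite -sumEFin; apply: eq_bigr => k _.
rewrite ge0_integralZl//; last exact/measurable_EFinP/measurable_indic.
rewrite integral_indic// EFinM; congr (_ * _)%E.
rewrite -[LHS]adde0 -(_ : rho (O k `&` ~` D) = 0%E); last first.
  apply: subset_measure0 rhoD => //.
  - by apply: measurableI => //; exact: measurableC.
  - exact: measurableC.
rewrite -measureU//; last 3 first.
- exact: measurableI.
- by apply: measurableI => //; exact: measurableC.
- by rewrite setIACA setICr setI0.
rewrite -setIUr setUv setIT fineK// ge0_fin_numE//.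
by apply: le_lt_trans rhofin; apply: le_measure; rewrite ?inE.
Qed.

(** A layer sum is a finite combination of masses of open sets, where [muO] applies; for the family
    it is bounded by the integral of [f], hence by [c]. *)
Lemma portmanteau_lsc (f : T -> R) (c : R) :
  lsc_on D f -> (forall x, D x -> 0 <= f x) ->
  (\forall i \near F, \int[m i]_(x in D) (f x)%:E <= c%:E)%E ->
  (\int[mu]_(x in D) (f x)%:E <= c%:E)%E.
Proof.
move=> lf f0 mc.
have mf : measurable_fun (D : set (borel T)) f by exact: measurable_lsc_on.
pose h n : R := n.+1%:R^-1; pose S n := layers (h n) (n.+1 * n.+1) f.
have h0 n : 0 <= h n by rewrite invr_ge0.
have lS n x : D x -> 0 <= S n x /\ S n x <= f x.
  by move=> /f0 fx; split; [exact: layers_ge0|case: (layers_le (n.+1 * n.+1) (h0 n) fx)].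
have mS n : measurable_fun (D : set (borel T)) (S n).
  rewrite /S /layers; apply: measurable_sum => k; apply: measurable_funM => //.
  have [ O oO DO] := lf (k.+1%:R * h n).
  apply: (eq_measurable_fun (\1_O : borel T -> R)); last first.
    by apply: measurable_indic; exact: measO.
  move=> x; rewrite inE => Dx; rewrite indicE; congr ((nat_of_bool _)%:R).
  apply/idP/idP => [|kf]; rewrite inE.
    by move=> Ox; have [] : (D `&` [set x | k.+1%:R * h n < f x]) x by rewrite DO.
  by have [] : (D `&` O) x by rewrite -DO.
(* The grids of step [1/(n+1)] are not nested, so the layer sums need not be monotone in [n];
   Fatou's lemma asks only for their pointwise convergence. *)
have -> : (\int[mu]_(x in D) (f x)%:E = \int[mu]_(x in D) limn_einf (fun n => (S n x)%:E))%E.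
  apply: eq_integral => x; rewrite inE => Dx; apply/esym.
  have /cvg_limn_einf_sup[] // : (S n x)%:E @[n --> \oo] --> (f x)%:E.
  by apply: cvg_EFin; [exact: nearW|exact: cvg_layers (f0 _ Dx)].
apply: le_trans (fatou _ _ _ _) _ => //.
- by move=> n; exact/measurable_EFinP.
- by move=> n x /(lS n)[S0 _]; rewrite lee_fin.
apply: limn_einf_le => n.
have /choice [ O OP] k : exists V : set T, open V /\ D `&` [set x | k.+1%:R * h n < f x] = D `&` V.
  by have [W] := lf (k.+1%:R * h n); exists W.
rewrite (integral_layers _ _ _ (h0 n) OP)// lee_fin.
apply: (@le_trans _ _ (\sum_(k < (n.+1 * n.+1)%N) h n * ultralim F m (O k))).
  apply: ler_sum => k _; rewrite ler_wpM2l//; apply: muO; by case: (OP k).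
apply: (@le_filter_lim _ _ F _ (fun i => \sum_(k < (n.+1 * n.+1)%N) h n * fine (m i (O k))) (cst c)).
- apply: cvg_big => [|k _]; first exact: add_continuous.
  by apply: cvgMl_tmp; apply: (ultralim_cvg mM); apply: measO; case: (OP k).
- exact: cvg_cst.
- near=> i; rewrite -lee_fin -(integral_layers _ _ (mmD i) (h0 n) OP)//.
    apply: (@le_trans _ _ (\int[m i]_(x in D) (f x)%:E)%E); last by near: i.
    apply: ge0_le_integral => //.
    + by move=> x /(lS n)[S0 _]; rewrite lee_fin.
    + by apply/measurable_EFinP; exact: mS.
    + exact/measurable_EFinP.
    + by move=> x /(lS n)[_]; rewrite lee_fin.
  exact: le_lt_trans (mM i) (ltry _).
Unshelve. all: by end_near. Qed.

End portmanteau.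

Lemma lsc_onP (R : realType) (T : topologicalType) (D : set T) (f : T -> R) :
  (forall c x, D x -> c < f x -> \forall y \near within D (nbhs x), c < f y) ->
  lsc_on D f.
Proof.
move=> near_f c.
exists (\bigcup_(W in [set W | open W /\ D `&` W `<=` [set x | c < f x]]) W).
  by apply: bigcup_open => W [].
apply/seteqP; split => [x [Dx cx]|x [Dx [W [oW DW] Wx]]]; last first.
  by split => //; apply: DW.
split => //; have := near_f c x Dx cx.
rewrite /prop_near1/= nbhsE/= => -[W [oW Wx] WD].
by exists W => //; split => // y [Dy Wy]; exact: WD.
Qed.

Lemma continuous_lsc_on (R : realType) (T : topologicalType) (D : set T)
    (f : T -> R) : {within D, continuous f} -> lsc_on D f.
Proof.
move=> /subspace_continuousP cf; apply: lsc_onP => c x Dx cx.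
exact: (cvgr_gt (f x) (cf x Dx)).
Qed.

Section real_integral.
Context d (T : measurableType d) (R : realType).
Implicit Types (mu : {measure set T -> \bar R}) (D : set T) (f g : T -> R).

Lemma bounded_integrable mu D f (C : R) : measurable D -> (mu setT < +oo)%E ->
  measurable_fun D f -> (forall x, D x -> `|f x| <= C) ->
  mu.-integrable D (EFin \o f).
Proof.
move=> mD muT mf fC; apply: measurable_bounded_integrable => //.
  by apply: le_lt_trans muT; apply: le_measure; rewrite ?inE.
exists C; split; first exact: num_real.
by move=> x Cx y Dy /=; apply: le_trans (ltW Cx); exact: fC.
Qed.

Lemma Rintegral_sum mu D (I : Type) (s : seq I) (f : I -> T -> R) :
  measurable D -> (forall i, mu.-integrable D (EFin \o f i)) ->
  (\int[mu]_(x in D) (\sum_(i <- s) f i x) =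
   \sum_(i <- s) \int[mu]_(x in D) f i x)%R.
Proof.
move=> mD fi; elim: s => [|i s ih].
  under eq_Rintegral do rewrite big_nil.
  by rewrite Rintegral_cst// mul0r big_nil.
under eq_Rintegral do rewrite big_cons.
rewrite RintegralD// ?ih ?big_cons//.
rewrite (_ : EFin \o _ = fun x => \sum_(j <- s) (f j x)%:E)%E; last first.
  by apply/funext => x /=; rewrite sumEFin.
by apply: (@integrable_sum _ _ _ _ _ mD _ s xpredT (fun j x => (f j x)%:E)) => j _; exact: fi.
Qed.

Lemma Rintegral_bounded_cvg mu D (f_ : (T -> R)^nat) f (C : R) :
  measurable D -> (mu setT < +oo)%E ->
  (forall n, measurable_fun D (f_ n)) ->
  (forall x, D x -> f_ n x @[n --> \oo] --> f x) ->
  (forall n x, D x -> `|f_ n x| <= C) ->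
  (\int[mu]_(x in D) f_ n x)%R @[n --> \oo] --> (\int[mu]_(x in D) f x)%R.
Proof.
move=> mD muT mf cf fC.
have mF : measurable_fun D f by exact: measurable_fun_cvg cf.
have fC' x : D x -> `|f x| <= C.
  move=> Dx; have cn : `|f_ n x| @[n --> \oo] --> `|f x| by exact: cvg_norm (cf x Dx).
  have cc : (fun=> C) n @[n --> \oo] --> C by exact: cvg_cst.
  by apply: (le_filter_lim _ cn cc); apply: nearW => n; exact: fC.
have iF : mu.-integrable D (EFin \o f) by exact: bounded_integrable fC'.
apply: fine_cvg.
rewrite fineK; last exact: integrable_fin_num.
apply: (@dominated_cvg _ _ _ _ _ mD (fun n x => (f_ n x)%:E) _ (cst C%:E)) => //.
- by move=> n; exact/measurable_EFinP.
- by move=> x Dx; apply: cvg_EFin; [exact: nearW|exact: cf].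
- apply: (@bounded_integrable _ _ (cst C) `|C|) => //.
Qed.

End real_integral.

(** * One Lagrange multiplier *)

(* Lagrange multiplier for one constraint: the segment between a point below
   the axis [b = 0] and the Slater point crosses this axis at a value [<= v]. *)
Lemma one_constraint_multiplier (R : realType) (P : set (R * R)) (v : R) :
  (forall x y t, P x -> P y -> 0 <= t <= 1 ->
    P (t * x.1 + (1 - t) * y.1, t * x.2 + (1 - t) * y.2)) ->
  (forall x, P x -> 0 <= x.2 -> x.1 <= v) ->
  (exists2 x0, P x0 & 0 < x0.2) ->
  exists2 lam, 0 <= lam & forall x, P x -> x.1 + lam * x.2 <= v.
Proof.
move=> convP Pv [[a0 b0] P0 /= b00].
have a0v : a0 <= v by apply: (Pv (a0, b0)) => //=; exact: ltW.
(* The weight [b' / (b' - b)] is the one for which the convex combination has second coordinate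
   [0]. *)
have cross a b a' b' : P (a, b) -> P (a', b') -> b < 0 -> 0 < b' ->
    (a - v) * b' <= (v - a') * (- b).
  move=> Pab Pab' bl0 b'0; have db : 0 < b' - b by lra.
  have := convP (a, b) (a', b') (b' / (b' - b)) Pab Pab' _ => /=.
  have -> : 1 - b' / (b' - b) = (- b) / (b' - b) by field; rewrite gt_eqF.
  have t01 : 0 <= b' / (b' - b) <= 1.
    apply/andP; split; first by apply: divr_ge0; apply: ltW.
    by rewrite ler_pdivrMr// mul1r; lra.
  move=> /(_ t01)/Pv/=.
  have -> : b' / (b' - b) * b + - b / (b' - b) * b' = 0 by field; rewrite gt_eqF.
  move=> /(_ (lexx _)).
  have -> : b' / (b' - b) * a + - b / (b' - b) * a' = (b' * a - b * a') / (b' - b).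
    by field; rewrite gt_eqF.
  by rewrite ler_pdivrMr//; nra.
(* The multiplier is the supremum of the slopes forced by the points with [b < 0]. Adding [0] makes
   the set nonempty and the supremum nonnegative; any point with [b > 0], the Slater point in
   particular, bounds it above. *)
pose L := [set l | l = 0 \/ exists a b, [/\ P (a, b), b < 0 & l = (a - v) / (- b)]].
have ubL a' b' : P (a', b') -> 0 < b' -> ubound L ((v - a') / b').
  move=> Pab' b'0 l [->|[a [b [Pab bl0 ->]]]].
    by apply: divr_ge0; [rewrite subr_ge0; apply: (Pv (a', b')) => //=|]; exact: ltW.
  by rewrite ler_pdivrMr ?oppr_gt0// mulrAC ler_pdivlMr//; exact: cross.
have supL : has_sup L.
  by split; [exists 0; left|exists ((v - a0) / b0); exact: ubL].
exists (sup L); first by apply: ub_le_sup; [case: supL|left].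
move=> [a b] Pab /=.
have [bl0|] := ltP b 0.
  have : (a - v) / (- b) <= sup L.
    by apply: ub_le_sup; [case: supL|right; exists a, b].
  by rewrite ler_pdivrMr ?oppr_gt0//; lra.
rewrite le_eqVlt => /orP[/eqP b0'|b0'].
  by rewrite -b0' mulr0 addr0; apply: (Pv (a, b)) => //=; rewrite -b0'.
have : sup L <= (v - a) / b.
  by apply: ge_sup; [by exists 0; left|exact: ubL].
by rewrite ler_pdivlMr//; lra.
Qed.

(** * Riemann sums over the parameter set *)

Section compact_parameter.
Context (R : realType) (p : nat) (Xi : set 'rV[R]_p) (cXi : compact Xi).
Local Notation V := ('rV[R]_p).

Lemma compact_borel : measurable (Xi : set (borel V)).
Proof. by apply: closed_borel; apply: compact_closed. Qed.

Lemma compact_uniform_continuous (f : V -> R) (e : R) :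
  {within Xi, continuous f} -> 0 < e ->
  \forall n \near \oo, forall x y, Xi x -> Xi y ->
    ball x n.+1%:R^-1 y -> `|f x - f y| <= e.
Proof.
move=> /subspace_continuousP cf e0.
suff : \forall n \near \oo, Xi `<=` [set x | forall y, Xi x -> Xi y ->
    ball x n.+1%:R^-1 y -> `|f x - f y| <= e].
  by apply: filterS => n + x y Xx Xy bxy => /(_ x Xx y Xx Xy bxy).
move/compact_near_coveringP : cXi; apply => x Xx.
have e20 : 0 < e / 2 by rewrite divr_gt0.
have /nbhs_ballP[r /= r0 rP] : \forall y \near nbhs x, Xi y -> `|f x - f y| < e / 2.
  exact: (@cvgr_dist_lt _ _ _ _ _ _ _ (cf x Xx)).
have r20 : 0 < r / 2 by rewrite divr_gt0.
exists (ball x (r / 2), [set n | n.+1%:R^-1 < r / 2]).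
  split; first exact: nbhsx_ballx.
  exact: (near_infty_natSinv_lt (PosNum r20)).
move=> [x' n] [/= bx' nr] y Xx' Xy bxy.
have h1 : `|f x - f x'| < e / 2.
  by apply: rP => //; apply: le_ball bx'; lra.
have h2 : `|f x - f y| < e / 2.
  apply: rP => //; rewrite (splitr r); apply: ball_triangle bx' _.
  by apply: le_ball bxy; exact: ltW.
rewrite (_ : f x' - f y = (f x - f y) - (f x - f x')); last by ring.
by rewrite (le_trans (ler_normB _ _))//; lra.
Qed.

Definition tagged_partition (e : R) (N : nat) (B : nat -> set V) (c : nat -> V) :=
  [/\ forall i, measurable (B i : set (borel V)), trivIset setT B,
      Xi = \big[setU/set0]_(i < N) B i,
      forall i, (i < N)%N -> Xi (c i) &
      forall i x, (i < N)%N -> B i x -> ball (c i) e x].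

(** A finite subcover by interiors of [e]-balls centred in [Xi], made disjoint by removing from each
    ball the earlier ones. *)
Lemma tagged_partition_exists (e : R) : 0 < e ->
  exists (s : nat * (nat -> set V) * (nat -> V)), tagged_partition e s.1.1 s.1.2 s.2.
Proof.
move=> e0; move: (cXi); rewrite compact_cover.
move=> /(_ V Xi (fun x => (ball x e)°))[|x Xx|].
- by move=> x _; exact: open_interior.
- by exists x => //; exact: nbhsx_ballx.
move=> D' D'X XD'; pose s := enum_fset D'.
pose c i := nth 0 s i; pose A i := Xi `&` (ball (c i) e)°.
exists (size s, seqDU A, c); split => /=.
- move=> i; apply: seqDU_measurable => k; apply: measurableI; first exact: compact_borel.
  by apply: sub_sigma_algebra; exact: open_interior.
- exact: trivIset_seqDU.
- rewrite -bigsetU_seqDU -(bigcup_mkord _ A); apply/seteqP; split => [x Xx|x [i _ []//]].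
  have [y /= yD' xy] := XD' _ Xx.
  have ys : y \in s by [].
  exists (index y s); first by rewrite /= index_mem.
  by split => //; rewrite /c nth_index.
- move=> i si; apply: set_mem; apply: D'X.
  by have : c i \in s by exact: mem_nth.
- by move=> i x si Bx; have [_] := subset_seqDU Bx; exact: interior_subset.
Qed.

Definition tagsum (N : nat) (B : nat -> set V) (c : nat -> V)
    (L : {measure set (borel V) -> \bar R}) (f : V -> R) : R :=
  \sum_(i < N) f (c i) * fine (L (B i)).

(** The tag sum is exactly the integral of the step function [g], which differs from [f] by at most
    [eps] on [Xi]. *)
Lemma tagsum_approx (N : nat) (B : nat -> set V) (c : nat -> V) (e eps : R)
    (L : {measure set (borel V) -> \bar R}) (f : V -> R) :
  tagged_partition e N B c -> (L setT < +oo)%E ->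
  {within Xi, continuous f} ->
  (forall x y, Xi x -> Xi y -> ball x e y -> `|f x - f y| <= eps) ->
  `|(\int[L]_(x in Xi) f x)%R - tagsum N B c L f| <= eps * fine (L Xi).
Proof.
move=> [mB tB XB Xc Bc] LT cf feps.
have mX := compact_borel.
have mf : measurable_fun (Xi : set (borel V)) f.
  by apply: measurable_lsc_on => //; exact: continuous_lsc_on.
pose g x : R := \sum_(i < N) f (c i) * \1_(B i) x.
have gE i x : (i < N)%N -> B i x -> g x = f (c i).
  move=> iN Bix; rewrite /g (bigD1 (Ordinal iN))//= indicE mem_set// mulr1.
  rewrite big1 ?addr0// => j ji; rewrite indicE memNset ?mulr0// => Bjx.
  move/trivIsetP : tB => /(_ j i Logic.I Logic.I).
  have ji' : nat_of_ord j != i by apply: contra ji => /eqP ji; apply/eqP/val_inj.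
  by move=> /(_ ji')/seteqP[+ _] => /(_ x (conj Bjx Bix)).
have XBx x : Xi x -> exists2 i, (i < N)%N & B i x.
  by rewrite XB -bigcup_mkord => -[i /= iN Bix]; exists i.
have fg x : Xi x -> `|f x - g x| <= eps.
  move=> Xx; have [i iN Bix] := XBx x Xx; rewrite (gE i)// distrC.
  by apply: feps => //; [exact: Xc|exact: Bc].
have iind i : L.-integrable Xi (EFin \o (fun x => f (c i) * \1_(B i) x)).
  apply: (@bounded_integrable _ _ _ _ _ _ `|f (c i)|) => //.
    apply: measurable_funM => //; exact: (@measurable_indic _ (borel V)).
  by move=> x _; rewrite normrM ler_piMr// indicE; case: (_ \in _); rewrite ?normr1 ?normr0.
have iG : L.-integrable Xi (EFin \o g).
  rewrite (_ : EFin \o _ = fun x => \sum_(i < N) (f (c i) * \1_(B i) x)%:E)%E; last first.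
    by apply/funext => x /=; rewrite sumEFin.
  apply: (@integrable_sum _ _ _ _ _ mX _ _ xpredT (fun (j : 'I_N) x => (f (c j) * \1_(B j) x)%:E)) => j _.
  exact: iind.
have igf : L.-integrable Xi (EFin \o (fun x => f x - g x)).
  apply: (@bounded_integrable _ _ _ _ _ _ eps) => //.
  apply: measurable_funB => //.
  by case/integrableP : iG => /measurable_EFinP.
have ifi : L.-integrable Xi (EFin \o f).
  have -> : (EFin \o f = (EFin \o (fun x => f x - g x)%R) \+ (EFin \o g))%E.
    by apply/funext => x /=; rewrite -EFinD subrK.
  exact: integrableD.
have intg : (\int[L]_(x in Xi) g x)%R = tagsum N B c L f.
  rewrite Rintegral_sum//; apply: eq_bigr => i _.
  rewrite RintegralZl//; last first.
    apply: (@bounded_integrable _ _ _ _ _ _ 1) => //.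
    by move=> x _; rewrite indicE; case: (_ \in _); rewrite ?normr1 ?normr0.
  rewrite /Rintegral; congr (_ * fine _).
  rewrite (@integral_indic _ (borel V))//; congr (L _).
  apply/setIidPl; rewrite XB -bigcup_mkord => x Bix; exists i => //=.
rewrite -intg -RintegralB//.
apply: le_trans (le_normr_Rintegral _ _) _ => //.
rewrite -Rintegral_cst//; apply: le_Rintegral => //.
- exact: integrable_norm.
- apply: (@bounded_integrable _ _ _ _ _ _ `|eps|) => //.
Qed.

(** The order of quantifiers is what matters: one sequence of partitions serves all continuous [f],
    and for given [f] and [e] the rank is uniform in the measure [L]. Both the exchange of integrals
    and the diagonal extraction of a weakly convergent sequence use this. *)
Lemma tagsum_cvg : exists s : nat -> nat * (nat -> set V) * (nat -> V),
  (forall m, tagged_partition m.+1%:R^-1 (s m).1.1 (s m).1.2 (s m).2) /\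
  forall (f : V -> R) (e : R), {within Xi, continuous f} -> 0 < e ->
  \forall m \near \oo, forall L : {measure set (borel V) -> \bar R},
    (L setT < +oo)%E ->
    `|(\int[L]_(x in Xi) f x)%R - tagsum (s m).1.1 (s m).1.2 (s m).2 L f| <= e * fine (L Xi).
Proof.
have m0 m : 0 < (m.+1%:R : R)^-1 by rewrite invr_gt0.
have /choice[s sP] m := tagged_partition_exists (m0 m).
exists s; split => // f e cf e0.
have := compact_uniform_continuous cf e0; apply: filterS => m fm L LT.
exact: tagsum_approx (sP m) LT cf fm.
Qed.

End compact_parameter.

(** * The decision process and its stationary measures *)

Section probability_of_measure.
Context d (T : measurableType d) (R : realType).
Variables (mu : {measure set T -> \bar R}) (mu1 : mu setT = 1%E).

(** The proof of total mass is an argument so that the probability structure can be attached to this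
    head symbol. *)
Definition probability_of_measure of mu setT = 1%E : set T -> \bar R := mu.

Local Notation P := (probability_of_measure mu1).

HB.instance Definition _ := Measure.on P.
HB.instance Definition _ := Measure_isProbability.Build _ _ _ P mu1.

End probability_of_measure.

Lemma integral_kernel_mixture d1 d2 (T1 : measurableType d1)
    (T2 : measurableType d2) (R : realType) (mu : probability T1 R)
    (k : T1 -> probability T2 R) (nu : {measure set T2 -> \bar R})
    (f : T2 -> \bar R) :
  (forall B, measurable B -> measurable_fun setT (fun x => k x B)) ->
  (forall B, measurable B -> nu B = \int[mu]_x k x B)%E ->
  measurable_fun setT f -> (forall x, 0 <= f x)%E ->
  measurable_fun setT (fun x => \int[k x]_s f s)%E /\
  (\int[nu]_s f s = \int[mu]_x \int[k x]_s f s)%E.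
Proof.
move=> mk nuE mf f0.
pose k' x : giry T2 R := k x.
have mk' : measurable_fun setT k'.
  by apply: measurable_giry_codensity => // B mB; exact: mk.
split.
  by apply: (measurableT_comp (measurable_giry_int mf f0) mk').
have := @giry_int_bind _ _ _ _ R (mu : subprobability T1 R) k' mk' f mf f0.
rewrite /giry_int => <-; apply: eq_measure_integral => B mB _.
rewrite nuE//.
have mI : measurable_fun setT (EFin \o \1_B : T2 -> \bar R).
  by apply/measurable_EFinP; exact: measurable_indic.
have I0 x : (0 <= (EFin \o \1_B : T2 -> \bar R) x)%E by rewrite lee_fin.
have := @giry_int_bind _ _ _ _ R (mu : subprobability T1 R) k' mk' _ mI I0.
rewrite /giry_int integral_indic// setIT => ->.
by apply: eq_integral => x _; rewrite integral_indic// setIT.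
Qed.

(** Where the weight is [+oo] the norm gives no information, so the right-hand side has to be [+oo]
    there. Replacing [M] by [Num.max 1 M] ensures this, since [0 * +oo] would be [0]. *)
Lemma weighted_norm_bound d (T : measurableType d) (R : realType) (D : set T)
    (w f : T -> \bar R) (M : R) :
  (forall x, D x -> 1 <= w x)%E -> (weighted_norm D w f <= M%:E)%E ->
  forall x, D x -> (`|f x| <= (Num.max 1 M)%:E * w x)%E.
Proof.
move=> w1 fM x Dx.
have M1 : 1 <= Num.max 1 M by rewrite le_max lexx.
have := w1 x Dx; case wx : (w x) => [v| |//] v1; last first.
  by rewrite gt0_muley ?leey// lte_fin; exact: lt_le_trans M1.
have v0 : 0 < v by rewrite lee_fin in v1; exact: lt_le_trans v1.
have : (`|f x| / w x <= (Num.max 1 M)%:E)%E.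
  apply: (@le_trans _ _ M%:E); last by rewrite lee_fin le_max lexx orbT.
  by apply: le_trans fM; apply: ereal_sup_ubound; exists x.
rewrite wx inver gt_eqF//.
case: (f x) => [a| |] /=.
- by rewrite -!EFinM !lee_fin ler_pdivrMr.
- by rewrite gt0_mulye ?lte_fin ?invr_gt0// leye_eq.
- by rewrite gt0_mulye ?lte_fin ?invr_gt0// leye_eq.
Qed.

Lemma le_weighted_norm d (T : measurableType d) (R : realType) (D : set T)
    (w : T -> \bar R) (f : T -> R) (M : R) :
  0 <= M ->
  (forall x, D x -> 1 <= w x)%E ->
  (forall x, D x -> w x \is a fin_num -> `|(f x)%:E| <= M%:E * w x)%E ->
  (weighted_norm D w (fun x => (f x)%:E) <= M%:E)%E.
Proof.
move=> M0 w1 fM; apply: ge_ereal_sup => _ [x Dx <-].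
have := w1 x Dx; have := fM x Dx; case: (w x) => [v| |//] fv v1; last first.
  by rewrite invey mule0 lee_fin.
have v0 : 0 < v by rewrite lee_fin in v1; exact: lt_le_trans v1.
have := fv isT; rewrite inver gt_eqF// abse_EFin -!EFinM !lee_fin.
by rewrite ler_pdivrMr.
Qed.

Lemma measurable_borel_continuous (T U : ptopologicalType) (f : T -> U) :
  continuous f -> measurable_fun setT (f : borel T -> borel U).
Proof.
move=> /continuousP cf.
apply: (@measurability _ _ (borel T) (borel U) _ _ (@open U)) => // _ [W oW <-].
by rewrite setTI; apply: sub_sigma_algebra; exact: cf.
Qed.

Section decision_process.
Context (R : realType) (ES EA : completeMetricType R).
Variables (S : set ES) (Act : ES -> set EA).
Variable Q : ES * EA -> probability (borel ES) R.
Variable r : ES * EA -> R.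
Local Notation K := (graph_of S Act).
Local Notation KK := (K : set (borel (ES * EA)%type)).
Local Notation SS := (S : set (borel ES)).
Local Notation sw := (state_weight Act r).

Record regular_process : Prop := {
  reg_mS : measurable SS;
  reg_kQ : stochastic_kernel_on S Act Q;
  reg_r0 : forall k, K k -> r k <= 0;
  reg_rcompact : forall eps : R, 0 <= eps -> compact (K `&` [set k | - eps <= r k]);
  reg_Qcont : weakly_continuous_on S Act Q;
  reg_Qw : weighted_functions KK (weight r)
    (fun k => \int[Q k]_(s in S) sw s)%E }.

Hypothesis reg : regular_process.

Lemma pair_hausdorff : hausdorff_space (ES * EA)%type.
Proof. by apply: prod_hausdorff; exact: metric_hausdorff. Qed.

Lemma superlevel_compact (c : R) : compact (K `&` [set k | c <= r k]).
Proof.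
have [c0|c0] := leP c 0.
  by rewrite -(opprK c); apply: (reg_rcompact reg); rewrite oppr_ge0.
rewrite (_ : _ `&` _ = set0); first exact: compact0.
apply/seteqP; split => // k [/(reg_r0 reg) rk /= ck].
by have := lt_le_trans c0 (le_trans ck rk); rewrite ltxx.
Qed.

(** This writes [K] as a countable union of compact sets, whence its Borel measurability in the
    ambient product. *)
Lemma graph_sigma_compact : K = \bigcup_n (K `&` [set k | - n%:R <= r k]).
Proof.
apply/seteqP; split => [k Kk|k [n _ []//]].
exists (Num.truncn `|r k|).+1 => //; split => //=.
rewrite lerNl (le_trans (ler_norm _))// normrN ltW//.
by have /andP[] := truncn_itv (normr_ge0 (r k)).
Qed.

Lemma superlevel_closed (c : R) : closed (K `&` [set k | c <= r k]).
Proof. by apply: compact_closed; [exact: pair_hausdorff|exact: superlevel_compact]. Qed.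

Lemma measurable_graph : measurable KK.
Proof.
rewrite graph_sigma_compact; apply: bigcupT_measurable => n.
by apply: closed_borel; exact: superlevel_closed.
Qed.

Lemma reward_usc : lsc_on K (fun k => - r k).
Proof.
move=> c; exists (~` (K `&` [set k | - c <= r k])).
  by apply: closed_openC; exact: superlevel_closed.
apply/seteqP; split => k [Kk] /=.
  by move=> ck; split => // -[_]; rewrite leNgt ltrNr ck.
by move=> nk; split => //; rewrite ltrNr ltNge; apply/negP => ck; apply: nk.
Qed.

Lemma measurable_reward : measurable_fun KK r.
Proof.
have mN := measurable_lsc_on measurable_graph reward_usc.
apply: (eq_measurable_fun (fun k : borel (ES * EA)%type => - (- r k))); first by move=> k _; rewrite opprK.
exact: measurable_funN.
Qed.

Lemma weightE k : weight r k = (1 - r k)%:E.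
Proof. by rewrite /weight EFinB. Qed.

Lemma weight_ge1 k : K k -> (1 <= weight r k)%E.
Proof. by move=> /(reg_r0 reg) rk; rewrite weightE lee_fin; lra. Qed.

Lemma state_weight_ge1 s : S s -> (1 <= sw s)%E.
Proof.
move=> Ss; rewrite /state_weight -[leLHS]sube0 leeB//.
apply: ge_ereal_sup => _ [a Aa <-]; rewrite lee_fin.
exact: (reg_r0 reg).
Qed.

Lemma state_weight_le k : K k -> (sw k.1 <= weight r k)%E.
Proof.
move=> Kk; rewrite /state_weight /weight leeB//; apply: ereal_sup_ubound.
by exists k.2 => /=; [case: Kk|case: k Kk].
Qed.

Lemma state_weight_fin k : K k -> sw k.1 \is a fin_num.
Proof.
move=> Kk; rewrite ge0_fin_numE.
  by apply: le_lt_trans (state_weight_le Kk) _; rewrite weightE ltry.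
by apply: le_trans (state_weight_ge1 _); [|case: Kk].
Qed.

(** The supremum runs over a possibly uncountable set of actions. But [sw s < c] means that some
    action has [r > 1 - c], so the sublevel set is a countable union of projections of compact
    superlevel sets of [r], and these projections are compact. *)
Lemma measurable_state_weight : measurable_fun SS sw.
Proof.
apply: (@measurability _ _ _ _ _ _ (@ErealGenInftyO.G R)).
  exact: ErealGenInftyO.measurableE.
move=> _ [_ [c ->] <-].
rewrite (_ : _ `&` _ =
    \bigcup_n fst @` (K `&` [set k | 1 - c + n.+1%:R^-1 <= r k])).
  apply: bigcupT_measurable => n; apply: closed_borel.
  apply: compact_closed; first exact: metric_hausdorff.
  apply: continuous_compact; last exact: superlevel_compact.
  by apply: continuous_subspaceT => k; exact: cvg_fst.
apply/seteqP; split => [s [Ss]|_ [n _ [k [Kk /= rk] <-]]].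
  rewrite /= in_itv/= => swc.
  have : (((1 - c)%:E) < ereal_sup [set (r (s, a))%:E | a in Act s])%E.
    by move: swc; rewrite /state_weight; case: ereal_sup => [x| |]//;
      rewrite ?ltry// -?EFinB !lte_fin; lra.
  move=> /ereal_sup_gt[_ [a Aa <-]]; rewrite lte_fin => ca.
  have ca0 : 0 < r (s, a) - (1 - c) by rewrite subr_gt0.
  have [n _ /(_ n (leqnn _)) /= nP] := near_infty_natSinv_lt (PosNum ca0).
  exists n => //; exists (s, a) => //=; split => //=.
  by rewrite -lerBrDl ltW.
split; first by case: Kk.
rewrite /= in_itv/=; apply: le_lt_trans (state_weight_le Kk) _.
have : 1 - c < r k by apply: lt_le_trans rk; rewrite ltrDl invr_gt0.
by rewrite weightE lte_fin; lra.
Qed.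

Lemma kernel_full k : K k -> Q k (~` S) = 0%E.
Proof.
move=> Kk; rewrite probability_setC; last exact: (reg_mS reg).
by case: (reg_kQ reg) => /(_ k Kk) -> _; rewrite subee.
Qed.

(** Assumption (6) bounds the integral of the weight by a constant times [weight r k], which is
    finite on [K]. *)
Lemma state_weight_integrable k : K k -> (Q k).-integrable SS sw.
Proof.
move=> Kk; have [_ Qw] := reg_Qw reg.
have [N QN] : exists N : R, (weighted_norm KK (weight r)
    (fun k => \int[Q k]_(s in S) sw s)%E <= N%:E)%E.
  case: weighted_norm Qw => [N| |]// _; first by exists N.
  by exists 0; rewrite leNye.
have Qb := @weighted_norm_bound _ (borel (ES * EA)%type) R KK (weight r) _ N weight_ge1 QN k Kk.
have sw0 s : S s -> (0 <= sw s)%E by move=> /state_weight_ge1; apply: le_trans.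
apply/integrableP; split; first exact: measurable_state_weight.
rewrite (eq_integral (sw : borel ES -> \bar R)); last by move=> s /set_mem Ss; rewrite gee0_abs// sw0.
rewrite gee0_abs in Qb; last exact: integral_ge0.
by apply: le_lt_trans Qb _; rewrite weightE -EFinM ltry.
Qed.

Lemma weighted_integrable (h : ES -> R) k :
  weighted_functions SS sw (fun s => (h s)%:E) -> K k ->
  (Q k).-integrable SS (EFin \o h).
Proof.
move=> [mh hw] Kk; have mS := reg_mS reg.
have [M hM] : exists M : R, (weighted_norm SS sw (fun s => (h s)%:E) <= M%:E)%E.
  case: weighted_norm hw => [M| |]// _; first by exists M.
  by exists 0; rewrite leNye.
have hb := @weighted_norm_bound _ (borel ES) R SS sw _ M state_weight_ge1 hM.
have isw := state_weight_integrable Kk.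
have sw0 s : S s -> (0 <= sw s)%E by move=> /state_weight_ge1; apply: le_trans.
apply: (@le_integrable _ _ _ _ _ mS _ (fun s => (Num.max 1 M)%:E * sw s)%E) => //.
- move=> s Ss; rewrite [leRHS]gee0_abs ?hb// mule_ge0 ?sw0//.
  by rewrite lee_fin le_max ler01.
- exact: integrableZl.
Qed.

Lemma bounded_weighted (h : ES -> R) : {within S, continuous h} ->
  bounded_on S h -> weighted_functions SS sw (fun s => (h s)%:E).
Proof.
move=> ch [M hM]; split.
  apply/measurable_EFinP; apply: measurable_lsc_on; first exact: reg_mS reg.
  exact: continuous_lsc_on.
have M0 : 0 <= Num.max 0 M by rewrite le_max lexx.
apply: le_lt_trans (ltry (Num.max 0 M)).
apply: le_weighted_norm => //; first exact: state_weight_ge1.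
move=> s Ss swf; rewrite abse_EFin.
apply: (@le_trans _ _ (Num.max 0 M)%:E).
  by rewrite lee_fin (le_trans (hM s Ss))// le_max lexx orbT.
by apply: lee_pemulr; rewrite ?lee_fin//; exact: state_weight_ge1.
Qed.

Section stationary.
Variable mu : probability (borel (ES * EA)%type) R.
Hypothesis muK : mu K = 1%E.

Definition stationary := forall B, measurable (B : set (borel ES)) -> B `<=` S ->
  (mu (fst @^-1` B) = \int[mu]_(k in K) Q k B)%E.

Hypothesis st : stationary.

Lemma graph_conull : mu (~` K) = 0%E.
Proof.
rewrite probability_setC; last exact: measurable_graph.
by rewrite muK subee.
Qed.

Lemma graph_measureI (A : set (borel (ES * EA)%type)) : measurable A ->
  mu A = mu (A `&` K).
Proof.
move=> mA; have mK := measurable_graph.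
have A0 : mu (A `&` ~` K) = 0%E.
  apply: subset_measure0 graph_conull => //.
  - by apply: measurableI => //; exact: measurableC.
  - exact: measurableC.
rewrite -[RHS]adde0 -A0 -measureU//; last 3 first.
- exact: measurableI.
- by apply: measurableI => //; exact: measurableC.
- by rewrite setIACA setICr setI0.
by rewrite -setIUr setUv setIT.
Qed.

Lemma integral_graph (f : ES * EA -> \bar R) :
  measurable_fun setT (f : borel (ES * EA)%type -> \bar R) -> (forall k, 0 <= f k)%E ->
  (\int[mu]_k f k = \int[mu]_(k in K) f k)%E.
Proof.
move=> mf f0; have mK := measurable_graph.
rewrite (@ge0_negligible_integral _ _ _ mu setT (~` K : set (borel (ES * EA)%type)))//.
- by rewrite setTD setCK.
- exact: measurableC.
- exact: graph_conull.
Qed.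

(** The kernel is measurable only on [K], whereas mixtures are formed over the whole product.
    Freezing it at [Q k0] outside [K] restores measurability and changes no integral, the complement
    of [K] being null. *)
Definition extended_kernel (k0 k : ES * EA) : probability (borel ES) R :=
  Q (if `[< K k >] then k else k0).

Lemma extended_kernelE (k0 k : ES * EA) : K k -> extended_kernel k0 k = Q k.
Proof. by move=> Kk; rewrite /extended_kernel asboolT. Qed.

Lemma measurable_extended_kernel (k0 : ES * EA) (B : set (borel ES)) : measurable B ->
  measurable_fun setT (fun k : borel (ES * EA)%type => extended_kernel k0 k B).
Proof.
move=> mB; have mK := measurable_graph.
rewrite -(setUv K); apply/measurable_funU => //; first exact: measurableC.
split.
  apply: (eq_measurable_fun (fun k : borel (ES * EA)%type => Q k B)); last by case: (reg_kQ reg) => _; exact.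
  by move=> k; rewrite inE => /extended_kernelE ->.
apply: (eq_measurable_fun (fun _ : borel (ES * EA)%type => Q k0 B)); last exact: measurable_cst.
by move=> k; rewrite inE => nKk; rewrite /extended_kernel asboolF.
Qed.

Lemma graph_nonempty : K !=set0.
Proof.
apply/set0P/negP => /eqP K0; move: muK; rewrite K0 measure0 => /eqP.
by rewrite lt_eqF.
Qed.

(** Stationarity says that the state marginal is the mixture of the kernels; integrating [g] against
    either side gives the claim. The definition tests only subsets of [S], but neither side charges
    the complement of [S], so [g] may be extended there by [0]. *)
Lemma stationary_ge0_integral (g : ES -> \bar R) :
  measurable_fun SS g -> (forall s, S s -> 0 <= g s)%E ->
  measurable_fun KK (fun k => \int[Q k]_(s in S) g s)%E /\
  (\int[mu]_(k in K) g k.1 = \int[mu]_(k in K) \int[Q k]_(s in S) g s)%E.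
Proof.
move=> mg g0; have mK := measurable_graph; have mS := reg_mS reg.
have [k0 _] := graph_nonempty.
pose Q' := extended_kernel k0.
have Q'K k : K k -> Q' k = Q k := @extended_kernelE k0 k.
have mQ' := measurable_extended_kernel k0.
pose nu := pushforward mu (fst : borel (ES * EA)%type -> borel ES).
have cfst : continuous (fst : ES * EA -> ES) by move=> k; exact: cvg_fst.
have mfst := measurable_borel_continuous cfst.
pose g' := g \_ S.
have mg' : measurable_fun setT (g' : borel ES -> \bar R).
  by apply/(measurable_restrictT _ _).1.
have g'0 s : (0 <= g' s)%E.
  by rewrite /g' patchE; case: ifPn => // /set_mem; exact: g0.
have nuE (B : set (borel ES)) : measurable B -> (nu B = \int[mu]_k Q' k B)%E.
  move=> mB.
  have mBS : measurable (B `&` S : set (borel ES)) by exact: measurableI.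
  have mf1 (C : set (borel ES)) : measurable C ->
      measurable (fst @^-1` C : set (borel (ES * EA)%type)).
    by move=> mC; rewrite -[X in measurable X]setTI; exact: mfst.
  have -> : nu B = mu (fst @^-1` (B `&` S)).
    rewrite [LHS]graph_measureI; last exact: mf1.
    rewrite [RHS]graph_measureI; last exact: mf1.
    by congr (mu _); apply/seteqP; split => [k [Bk [Sk Ak]]|k [[Bk _] Kk]].
  rewrite st//.
  rewrite integral_graph//; last exact: mQ'.
  apply: eq_integral => k; rewrite inE => Kk; rewrite Q'K//.
  rewrite -[LHS]adde0 -(_ : Q k (B `&` ~` S) = 0%E); last first.
    apply: subset_measure0 (kernel_full Kk) => //.
    - by apply: measurableI => //; exact: measurableC.
    - exact: measurableC.
  rewrite -measureU//; last 2 first.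
  - by apply: measurableI => //; exact: measurableC.
  - by rewrite setIACA setICr setI0.
  by rewrite -setIUr setUv setIT.
have [mint nuint] := integral_kernel_mixture mQ' nuE mg' g'0.
have QS k : K k -> (\int[Q' k]_s g' s = \int[Q k]_(s in S) g s)%E.
  by move=> Kk; rewrite Q'K// /g' -integral_mkcond.
split.
  apply: (eq_measurable_fun (fun k : borel (ES * EA)%type => \int[Q' k]_s g' s)%E).
    by move=> k; rewrite inE; exact: QS.
  exact: measurable_funS mint.
transitivity (\int[mu]_(k in K) g' k.1)%E.
  apply: eq_integral => k; rewrite inE => -[Sk _].
  by rewrite /g' patchE mem_set.
rewrite -(integral_graph (f := fun k => g' k.1))//; last exact: measurableT_comp mg' mfst.
transitivity (\int[nu]_s g' s)%E.
  by rewrite ge0_integral_pushforward.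
rewrite nuint integral_graph//; last by move=> k; exact: integral_ge0.
by apply: eq_integral => k; rewrite inE; exact: QS.
Qed.

(* Both sides are finite as soon as [h] is integrable against the kernel and
   against the marginal. *)
Lemma stationary_integral (h : ES -> R) :
  measurable_fun SS h ->
  mu.-integrable KK (fun k => (h k.1)%:E) ->
  (forall k, K k -> (Q k).-integrable SS (EFin \o h)) ->
  mu.-integrable KK (EFin \o (fun k => (\int[Q k]_(s in S) h s)%R)) /\
  (\int[mu]_(k in K) h k.1 = \int[mu]_(k in K) (\int[Q k]_(s in S) h s))%R.
Proof.
move=> mh ih iQh; have mK := measurable_graph; have mS := reg_mS reg.
have mH : measurable_fun SS (EFin \o h) by exact/measurable_EFinP.
pose hp := (EFin \o h)^\+%E; pose hn := (EFin \o h)^\-%E.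
have [mp Ep] := @stationary_ge0_integral hp (measurable_funepos mH) (fun s _ => funepos_ge0 _ s).
have [mn En] := @stationary_ge0_integral hn (measurable_funeneg mH) (fun s _ => funeneg_ge0 _ s).
have fp k : K k -> (\int[Q k]_(s in S) hp s)%E \is a fin_num.
  by move=> /iQh; exact: integrable_pos_fin_num.
have fn k : K k -> (\int[Q k]_(s in S) hn s)%E \is a fin_num.
  by move=> /iQh; exact: integrable_neg_fin_num.
pose kp (k : borel (ES * EA)%type) : \bar R := (\int[Q k]_(s in S) hp s)%E.
pose kn (k : borel (ES * EA)%type) : \bar R := (\int[Q k]_(s in S) hn s)%E.
have ip : mu.-integrable KK kp.
  apply/integrableP; split => //.
  rewrite (eq_integral kp); last first.
    by move=> k _; rewrite gee0_abs//; apply: integral_ge0 => s _; exact: funepos_ge0.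
  apply: le_lt_trans (integral_funepos_lt_pinfty mK ih).
  rewrite -Ep le_eqVlt; apply/orP; left; apply/eqP/eq_integral => k _.
  by rewrite /hp !funeposE.
have i_n : mu.-integrable KK kn.
  apply/integrableP; split => //.
  rewrite (eq_integral kn); last first.
    by move=> k _; rewrite gee0_abs//; apply: integral_ge0 => s _; exact: funeneg_ge0.
  apply: le_lt_trans (integral_funeneg_lt_pinfty mK ih).
  rewrite -En le_eqVlt; apply/orP; left; apply/eqP/eq_integral => k _.
  by rewrite /hn !funenegE.
have Qh k : K k -> ((\int[Q k]_(s in S) h s)%R%:E = kp k - kn k)%E.
  by move=> Kk; rewrite /Rintegral integralE fineK// fin_numB fp//= fn.
have ipn : mu.-integrable KK (fun k => kp k - kn k)%E by exact: integrableB.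
split.
  by apply: eq_integrable ipn => // k; rewrite inE => Kk; rewrite /= Qh.
rewrite /Rintegral; congr fine.
rewrite [RHS](eq_integral (fun k => kp k - kn k)%E); last first.
  by move=> k; rewrite inE => Kk; rewrite -Qh.
rewrite integralB// integralE -Ep -En; congr (_ - _)%E.
  by apply: eq_integral => k _; rewrite /hp !funeposE.
by apply: eq_integral => k _; rewrite /hn !funenegE.
Qed.

End stationary.
End decision_process.

Lemma within_continuous_bounded (R : realType) (T : topologicalType)
    (D : set T) (f : T -> R) : compact D -> {within D, continuous f} ->
  exists C, forall x, D x -> `|f x| <= C.
Proof.
move=> cD cf; have /compact_bounded [M [_ MP]] := continuous_compact cf cD.
exists (M + 1) => x Dx; apply: (MP (M + 1)); first by rewrite ltrDl.
by exists x.
Qed.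

(** Concavity at [x], seen as the combination of [x + e] and [x - 1] (along the all-ones vector)
    with weights [1/(1+e)] and [e/(1+e)]: the growth ahead is controlled by the slope behind. *)
Lemma concave_shift (R : realType) n (f : 'rV[R]_n -> R) (x : 'rV[R]_n) (e : R) :
  concave_rV f -> 0 < e ->
  f (x + const_mx e) <= f x + e * (f x - f (x - const_mx 1)).
Proof.
move=> cf e0; have e10 : 0 < 1 + e by lra.
have t0 : 0 <= (1 + e)^-1 by rewrite invr_ge0 ltW.
have t1 : (1 + e)^-1 <= 1 by rewrite invf_le1//; lra.
have := cf (Itv01 t0 t1) (x + const_mx e) (x - const_mx 1) (in_setT _) (in_setT _).
rewrite convRE.
have -> : conv (Itv01 t0 t1) (x + const_mx e : convex_lmodType 'rV[R]_n) (x - const_mx 1) = x.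
  rewrite /conv/=; apply/rowP => i; rewrite !mxE/=.
  by rewrite /unstable.onem; field; rewrite gt_eqF.
rewrite /= /unstable.onem => h.
have : (1 + e) * - f x <= (1 + e) * ((1 + e)^-1 * - f (x + const_mx e) +
    (1 - (1 + e)^-1) * - f (x - const_mx 1)) by rewrite ler_pM2l.
rewrite [leRHS](_ : _ = - f (x + const_mx e) - e * f (x - const_mx 1)).
  by lra.
by field; rewrite gt_eqF.
Qed.

(** * Integrals over [Xi] as functions of a parameter *)

Section parametric_integral.
Context (R : realType) (p : nat) (Xi : set 'rV[R]_p) (cXi : compact Xi).
Local Notation V := ('rV[R]_p).
Context d (T : measurableType d) (D : set T) (mD : measurable D).
Variables (g : T -> V -> R) (C : R).
Hypothesis mg : forall xi, Xi xi -> measurable_fun D (g ^~ xi).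
Hypothesis gC : forall k xi, D k -> Xi xi -> `|g k xi| <= C.
Hypothesis gc : forall k, D k -> {within Xi, continuous (g k)}.
Variable L : {measure set (borel V) -> \bar R}.
Hypothesis LT : (L setT < +oo)%E.

Let G k := (\int[L]_(xi in Xi) g k xi)%R.

(** For the constant function [1] the oscillation is [0], so the approximation bound becomes an
    equality. *)
Lemma tagsum_mass e (s : nat * (nat -> set V) * (nat -> V)) :
  tagged_partition Xi e s.1.1 s.1.2 s.2 ->
  \sum_(i < s.1.1) fine (L (s.1.2 i)) = fine (L Xi).
Proof.
move=> sP.
have := @tagsum_approx R p Xi cXi _ _ _ e 0 L (cst 1) sP LT.
have cc : {within Xi, continuous (cst 1 : V -> R)} by move=> ?; exact: cvg_cst.
have c0 (x y : V) : Xi x -> Xi y -> ball x e y -> `|(1 : R) - 1| <= 0.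
  by rewrite subrr normr0.
move=> /(_ cc c0); rewrite mul0r normr_le0 Rintegral_cst ?mul1r; last exact: compact_borel.
rewrite subr_eq0 => /eqP ->.
by apply: eq_bigr => i _; rewrite mul1r.
Qed.

Variable s : nat -> nat * (nat -> set V) * (nat -> V).
Hypothesis sP : forall m, tagged_partition Xi m.+1%:R^-1 (s m).1.1 (s m).1.2 (s m).2.
Hypothesis sC : forall (f : V -> R) (e : R), {within Xi, continuous f} -> 0 < e ->
  \forall m \near \oo, forall L : {measure set (borel V) -> \bar R},
    (L setT < +oo)%E ->
    `|(\int[L]_(x in Xi) f x)%R - tagsum (s m).1.1 (s m).1.2 (s m).2 L f| <= e * fine (L Xi).

Local Notation ts m f := (tagsum (s m).1.1 (s m).1.2 (s m).2 L f).

Lemma tagsum_cvg_integral (f : V -> R) : {within Xi, continuous f} ->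
  ts m f @[m --> \oo] --> (\int[L]_(x in Xi) f x)%R.
Proof.
move=> cf; apply/cvgrPdist_le => e e0.
have L0 : 0 <= fine (L Xi) by exact: fine_ge0.
have e0' : 0 < e / (fine (L Xi) + 1) by rewrite divr_gt0//; lra.
have := sC cf e0'; apply: filterS => m /(_ L LT) /le_trans; apply.
rewrite -mulrA ger_pMr// mulrC ler_pdivrMr; lra.
Qed.

Let ts_mass m k : D k -> `|ts m (g k)| <= C * fine (L Xi).
Proof.
move=> Dk; rewrite -(tagsum_mass (sP m)) mulr_sumr.
apply: le_trans (ler_norm_sum _ _ _) _; apply: ler_sum => i _.
rewrite normrM (ger0_norm (fine_ge0 _))// ler_wpM2r ?fine_ge0// gC//.
by have [_ _ _ + _] := sP m; apply.
Qed.

Let ts_meas m : measurable_fun D (fun k => ts m (g k)).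
Proof.
apply: measurable_sum => i; apply: measurable_funM => //; apply: mg.
by have [_ _ _ + _] := sP m; apply.
Qed.

Lemma measurable_parametric_integral : measurable_fun D G.
Proof.
by apply: (measurable_fun_cvg ts_meas) => k Dk; exact: tagsum_cvg_integral (gc Dk).
Qed.

Lemma parametric_integral_bound k : D k -> `|G k| <= C * fine (L Xi).
Proof.
move=> Dk; have cn : `|ts m (g k)| @[m --> \oo] --> `|G k|.
  by apply: cvg_norm; exact: tagsum_cvg_integral (gc Dk).
have cc : (fun=> C * fine (L Xi)) n @[n --> \oo] --> C * fine (L Xi) by exact: cvg_cst.
by apply: (le_filter_lim _ cn cc); apply: nearW => m; exact: ts_mass.
Qed.

(* Fubini's theorem is replaced by the convergence of Riemann sums. *)
Lemma parametric_integral_ge (mu : {measure set T -> \bar R}) (y : V -> R) :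
  (mu setT < +oo)%E -> {within Xi, continuous y} ->
  (forall xi, Xi xi -> y xi <= (\int[mu]_(k in D) g k xi)%R) ->
  (\int[L]_(xi in Xi) y xi <= \int[mu]_(k in D) G k)%R.
Proof.
move=> muT cy yg.
have cG : (\int[mu]_(k in D) ts m (g k))%R @[m --> \oo] --> (\int[mu]_(k in D) G k)%R.
  apply: (@Rintegral_bounded_cvg _ _ _ _ _ _ _ (C * fine (L Xi))) => //.
  by move=> k Dk; exact: tagsum_cvg_integral (gc Dk).
apply: (le_filter_lim _ (tagsum_cvg_integral cy) cG); apply: nearW => m.
have Xc i : (i < (s m).1.1)%N -> Xi ((s m).2 i).
  by have [_ _ _ + _] := sP m; apply.
have ig (i : 'I_(s m).1.1) : mu.-integrable D (EFin \o g^~ ((s m).2 i)).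
  apply: (@bounded_integrable _ _ _ _ _ _ C) => //; first by apply: mg; exact: Xc.
  by move=> k Dk; apply: gC => //; exact: Xc.
have C0 k : D k -> Xi !=set0 -> 0 <= C.
  by move=> Dk [xi Xxi]; apply: le_trans (gC Dk Xxi).
rewrite /tagsum Rintegral_sum//; last first.
  move=> i; rewrite (_ : EFin \o _ =
      fun k => (fine (L ((s m).1.2 i)))%:E * (g k ((s m).2 i))%:E)%E; last first.
    by apply/funext => k /=; rewrite mulrC EFinM.
  by apply: (@integrableZl _ _ _ _ _ mD _ (EFin \o g^~ ((s m).2 i))); exact: (ig i).
apply: ler_sum => i _.
under eq_Rintegral do rewrite mulrC.
rewrite RintegralZl//.
by rewrite mulrC ler_wpM2l ?fine_ge0// yg//; exact: Xc.
Qed.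

End parametric_integral.

(** * Utilities *)

Section utilities.
Context (R : realType) (ES EA : completeMetricType R).
Variables (K : set (ES * EA)).
Local Notation KK := (K : set (borel (ES * EA)%type)).
Variables (n : nat) (z : ES * EA -> 'rV[R]_n).
Variables (p : nat) (Xi : set 'rV[R]_p) (u : 'rV[R]_n -> 'rV[R]_p -> R).
Variable y : 'rV[R]_p -> R.

Record regular_utility : Prop := {
  util_cXi : compact Xi;
  util_incr : forall xi, Xi xi -> nondecreasing_rV (u ^~ xi);
  util_conc : forall xi, Xi xi -> concave_rV (u ^~ xi);
  util_cont : forall x, {within Xi, continuous (u x)};
  util_zb : forall i, bounded_on K (fun k => z k ord0 i);
  util_zusc : forall i, upper_semicontinuous_on K (fun k => z k ord0 i);
  util_y : {within Xi, continuous y} }.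

Hypothesis utl : regular_utility.

(** By monotonicity [u (z k) xi] lies between the utilities of the constant vectors [- B] and [B],
    each of which is bounded in [xi] by continuity on the compact set [Xi]. *)
Lemma utility_bounded : exists C, forall k xi, K k -> Xi xi -> `|u (z k) xi| <= C.
Proof.
have /choice[M MP] := util_zb utl.
pose B := \sum_i `|M i|.
have MB i : M i <= B.
  rewrite (le_trans (ler_norm _))// /B (bigD1 i)//= lerDl.
  exact: sumr_ge0.
have [C1 C1P] := within_continuous_bounded (util_cXi utl) (util_cont utl (x := const_mx (- B))).
have [C2 C2P] := within_continuous_bounded (util_cXi utl) (util_cont utl (x := const_mx B)).
exists (C1 + C2) => k xi Kk Xxi.
have lo : u (const_mx (- B)) xi <= u (z k) xi.
  apply: (util_incr utl Xxi) => i; rewrite mxE lerNl.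
  by rewrite (le_trans _ (MB i))// (le_trans _ (MP i k Kk))// -normrN ler_norm.
have hi : u (z k) xi <= u (const_mx B) xi.
  apply: (util_incr utl Xxi) => i; rewrite mxE.
  by rewrite (le_trans _ (MB i))// (le_trans _ (MP i k Kk))// ler_norm.
have := C1P xi Xxi; have := C2P xi Xxi.
by rewrite !ler_norml => /andP[a b] /andP[c e]; apply/andP; split; lra.
Qed.

(** Near [k] each component of [z] exceeds its value at [k] by less than [e]. Monotonicity replaces
    [z k'] by [z k + e], and [concave_shift] bounds the resulting increase by [e * D]. *)
Lemma utility_usc xi : Xi xi -> lsc_on K (fun k => - u (z k) xi).
Proof.
move=> Xxi; apply: lsc_onP => c k Kk cu.
pose D := u (z k) xi - u (z k - const_mx 1) xi.
have D0 : 0 <= D.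
  rewrite subr_ge0; apply: (util_incr utl Xxi) => i.
  by rewrite !mxE gerBl.
pose gap := - c - u (z k) xi.
have gap0 : 0 < gap by rewrite /gap; lra.
(* This choice gives [e * D < gap], including when [D = 0]. *)
pose e := gap / (2 * (D + 1)).
have e0 : 0 < e by rewrite divr_gt0// mulr_gt0//; lra.
have eD : e * D < gap.
  rewrite /e mulrAC ltr_pdivrMr; last by rewrite mulr_gt0//; lra.
  by rewrite ltr_pM2l//; lra.
have sh := concave_shift (z k) (util_conc utl Xxi) e0.
have nz i : \forall k' \near within K (nbhs k), z k' ord0 i < z k ord0 i + e.
  have := util_zusc utl (i := i) (x := k) (a := - (z k ord0 i + e)).
  rewrite lte_fin ltrN2 ltrDl => /(_ e0)[W Wk WP].
  rewrite nbhs_subspace_in//; apply: filterS Wk => k' /WP.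
  by rewrite lte_fin ltrN2.
apply: (filterS _ (filter_forall _ nz)) => k' zk'.
rewrite ltrNr; apply: (@le_lt_trans _ _ (u (z k + const_mx e) xi)).
  by apply: (util_incr utl Xxi) => i; rewrite !mxE ltW.
apply: le_lt_trans sh _; rewrite -/D; move: eD; rewrite /gap; lra.
Qed.

End utilities.

(** The approximants are the minimum of [1] and [j] times the distance to the complement of [U]. The
    case of an empty complement is separate because that distance is then an infimum over the empty
    set. *)
Lemma open_indicator_approx (R : realType) (M : metricType R) (U : set M) :
  open U -> exists h : nat -> M -> R,
    [/\ forall j, continuous (h j), forall j s, 0 <= h j s <= 1 &
        forall s, h j s @[j --> \oo] --> (\1_U s : R)].
Proof.
move=> oU; have [[x0 Ux0]|nU] := pselect (~` U !=set0); last first.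
  exists (fun=> cst 1); split => [j s|j s|s].
  - exact: cvg_cst.
  - by rewrite ler01 lexx.
  - rewrite indicE mem_set; first exact: cvg_cst.
    by apply: contrapT => Us; apply: nU; exists s.
pose rho s := inf [set mdist s x | x in ~` U].
have lb s : has_lbound [set mdist s x | x in ~` U].
  by exists 0 => _ [x _ <-]; exact: mdist_ge0.
have ne s : [set mdist s x | x in ~` U] !=set0 by exists (mdist s x0); exists x0.
have rho0 s : 0 <= rho s.
  by apply: lb_le_inf => // _ [x _ <-]; exact: mdist_ge0.
have lip s t : rho s <= mdist s t + rho t.
  rewrite -lerBlDl; apply: lb_le_inf => // _ [x Ux <-].
  rewrite lerBlDl; apply: le_trans (metric_triangle s t x).
  by apply: ge_inf => //; exists x.
have rhoN s : ~ U s -> rho s = 0.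
  move=> nUs; apply/eqP; rewrite eq_le rho0 andbT.
  by apply: ge_inf => //; exists s => //; exact: mdistxx.
have rhoP s : U s -> 0 < rho s.
  move=> Us; have /nbhs_ballP[e /= e0 eU] : nbhs s U by exact: open_nbhs_nbhs.
  apply: lt_le_trans e0 _; apply: lb_le_inf => // _ [x nUx <-].
  by rewrite leNgt; apply/negP => sx; apply: nUx; apply: eU; rewrite ballEmdist.
have crho : continuous rho.
  move=> s; apply/cvgrPdist_lt => e e0; near=> t.
  have st : mdist s t < e.
    have : ball s e t by near: t; exact: nbhsx_ballx.
    by rewrite ballEmdist.
  rewrite ltr_norml; have := lip s t; have := lip t s.
  by rewrite (metric_sym t s); move=> h1 h2; apply/andP; split; lra.
exists (fun j s => Num.min 1 (j%:R * rho s)); split => [j s|j s|s].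
- apply: (@continuous_min R M (cst 1) (fun t => j%:R * rho t)); first exact: cvg_cst.
  by apply: cvgMl_tmp; exact: crho.
- by rewrite ge_min lexx /= le_min ler01 mulr_ge0.
- rewrite indicE; have [Us|nUs] := pselect (U s); last first.
    rewrite memNset// rhoN//; under eq_fun do rewrite mulr0 min_r//.
    exact: cvg_cst.
  rewrite mem_set//; apply: cvg_near_cst; near=> j.
  apply: min_l; rewrite -ler_pdivrMr ?rhoP//.
  by near: j; exact: nbhs_infty_ger.
Unshelve. all: by end_near. Qed.

Lemma kernel_mixture_exists d1 d2 (T1 : measurableType d1)
    (T2 : measurableType d2) (R : realType) (mu : probability T1 R)
    (k : T1 -> probability T2 R) :
  (forall B, measurable B -> measurable_fun setT (fun x => k x B)) ->
  exists nu : {measure set T2 -> \bar R},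
    forall B, measurable B -> (nu B = \int[mu]_x k x B)%E.
Proof.
move=> mk; pose k' x : giry T2 R := k x.
have mk' : measurable_fun setT k'.
  by apply: measurable_giry_codensity => // B mB; exact: mk.
exists (giry_bind (mu : subprobability T1 R) mk') => B mB.
have mI : measurable_fun setT (EFin \o \1_B : T2 -> \bar R).
  by apply/measurable_EFinP; exact: measurable_indic.
have I0 x : (0 <= (EFin \o \1_B : T2 -> \bar R) x)%E by rewrite lee_fin.
have := @giry_int_bind _ _ _ _ R (mu : subprobability T1 R) k' mk' _ mI I0.
rewrite /giry_int integral_indic// setIT => ->.
by apply: eq_integral => x _; rewrite integral_indic// setIT.
Qed.

Lemma probability_lty d (T : measurableType d) (R : realType)
  (P : probability T R) : (P setT < +oo)%E.
Proof. by rewrite probability_setT ltry. Qed.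

(** * Weak duality *)

Section duality.
Context (R : realType) (ES EA : completeMetricType R).
Variables (S : set ES) (Act : ES -> set EA).
Variable Q : ES * EA -> probability (borel ES) R.
Variable r : ES * EA -> R.
Variables (n : nat) (z : ES * EA -> 'rV[R]_n).
Variables (p : nat) (Xi : set 'rV[R]_p) (u : 'rV[R]_n -> 'rV[R]_p -> R).
Variable y : 'rV[R]_p -> R.
Local Notation K := (graph_of S Act).
Local Notation KT := (borel (ES * EA)%type).
Local Notation KK := (K : set KT).
Local Notation SS := (S : set (borel ES)).
Local Notation sw := (state_weight Act r).
Local Notation V := ('rV[R]_p).
Hypothesis reg : regular_process S Act Q r.
Hypothesis utl : regular_utility K z Xi u y.

(** The primal constraints restated for probabilities and real-valued integrals; the passage from
    and to charges is made at the end. *)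
Definition feasible_probability (mu : probability KT R) :=
  [/\ mu K = 1%E, mu.-integrable KK (EFin \o r), stationary S Act Q mu &
      forall xi, Xi xi -> y xi <= (\int[mu]_(k in K) u (z k) xi)%R].

(** The expected one-step increase of [h]. It integrates to [0] under a stationary measure, and the
    dual constraint becomes [r + drift + gain <= beta]. *)
Definition drift (h : ES -> R) (k : ES * EA) : R :=
  (\int[Q k]_(s in S) h s)%R - h k.1.

Definition gain (L : {measure set (borel V) -> \bar R}) (k : ES * EA) : R :=
  (\int[L]_(xi in Xi) u (z k) xi)%R.

Let mK : measurable KK := measurable_graph reg.

Let mX : measurable (Xi : set (borel V)) := compact_borel (util_cXi utl).

Lemma measurable_utility xi : Xi xi -> measurable_fun KK (fun k => u (z k) xi).
Proof.
move=> Xxi; apply: (eq_measurable_fun (fun k : KT => - - u (z k) xi)).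
  by move=> k _; rewrite opprK.
apply: measurable_funN; apply: measurable_lsc_on => //.
exact: (utility_usc utl).
Qed.

Lemma gain_facts (L : {measure set (borel V) -> \bar R}) : (L setT < +oo)%E ->
  [/\ measurable_fun KK (gain L), exists C, forall k, K k -> `|gain L k| <= C &
   forall mu, feasible_probability mu ->
     (\int[L]_(xi in Xi) y xi <= \int[mu]_(k in K) gain L k)%R].
Proof.
move=> LT; have [C uC] := utility_bounded utl.
have [s [sP sC]] := tagsum_cvg (util_cXi utl).
have uC' (k : KT) xi : KK k -> Xi xi -> `|u (z k) xi| <= C by exact: uC.
have cu (k : KT) : KK k -> {within Xi, continuous (u (z k))} by move=> _; exact: util_cont utl _.
have mu_ xi : Xi xi -> measurable_fun KK (fun k => u (z k) xi) by exact: measurable_utility.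
split.
- exact: (measurable_parametric_integral mu_ cu LT sP sC).
- exists (C * fine (L Xi)) => k Kk.
  exact: (parametric_integral_bound (util_cXi utl) uC' cu LT sP sC Kk).
- move=> mu [_ _ _ mu_y].
  apply: (parametric_integral_ge (util_cXi utl) mK mu_ uC' cu LT sP sC) => //.
  + exact: probability_lty.
  + exact: util_y utl.
Qed.

(** The function is dominated by a multiple of the state weight, which on [K] is at most [1 - r];
    integrability of [r] concludes. *)
Lemma integrable_weighted_state (mu : probability KT R) (h : ES -> R) :
  mu K = 1%E -> mu.-integrable KK (EFin \o r) ->
  weighted_functions SS sw (fun s => (h s)%:E) ->
  mu.-integrable KK (fun k => (h k.1)%:E).
Proof.
move=> muK ir [mh hw].
have [M hM] : exists M : R, (weighted_norm SS sw (fun s => (h s)%:E) <= M%:E)%E.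
  case: weighted_norm hw => [M| |]// _; first by exists M.
  by exists 0; rewrite leNye.
have hb := @weighted_norm_bound _ (borel ES) R SS sw _ M (state_weight_ge1 reg) hM.
pose N := Num.max 1 M; have N0 : 0 <= N by rewrite le_max ler01.
have cfst : continuous (fst : ES * EA -> ES) by move=> k; exact: cvg_fst.
apply: (@le_integrable _ _ _ _ _ mK _ (EFin \o (fun k => N * (1 - r k)))) => //.
- apply: (@measurable_comp _ _ _ _ _ _ SS (fun s : borel ES => (h s)%:E)) => //.
  + exact: reg_mS reg.
  + by move=> _ [k [Sk _] <-].
  + exact: measurable_funTS (measurable_borel_continuous cfst).
- move=> k Kk /=; have Sk : S k.1 by case: Kk.
  apply: le_trans (hb _ Sk) _.
  apply: (@le_trans _ _ (N%:E * weight r k)%E).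
    by apply: lee_wpmul2l; rewrite ?lee_fin//; exact: state_weight_le Kk.
  by rewrite weightE -EFinM lee_fin ler_norm.
- rewrite (_ : EFin \o _ = fun k => N%:E * ((cst 1%:E \- (EFin \o r)) k))%E; last first.
    by apply/funext => k /=; rewrite EFinM EFinB.
  apply: integrableZl => //; apply: integrableB => //.
  apply: (@bounded_integrable _ _ _ _ _ (cst 1) 1) => //; first exact: probability_lty.
  by move=> k _ /=; rewrite normr1.
Qed.

Lemma drift_integral (mu : probability KT R) (h : ES -> R) :
  mu K = 1%E -> mu.-integrable KK (EFin \o r) -> stationary S Act Q mu ->
  weighted_functions SS sw (fun s => (h s)%:E) ->
  mu.-integrable KK (EFin \o drift h) /\ (\int[mu]_(k in K) drift h k = 0)%R.
Proof.
move=> muK ir st wh; have ih := integrable_weighted_state muK ir wh.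
have mh : measurable_fun SS h by case: wh => /measurable_EFinP.
have [iQ EQ] := stationary_integral reg muK st mh ih
  (fun k Kk => weighted_integrable reg wh Kk).
split.
  rewrite (_ : EFin \o _ =
      (EFin \o (fun k => (\int[Q k]_(s in S) h s)%R)) \- (fun k => (h k.1)%:E))%E.
    exact: integrableB.
  by apply/funext => k /=; rewrite -EFinB.
by rewrite /drift RintegralB// EQ subrr.
Qed.

Lemma weak_duality (mu : probability KT R) (h : ES -> R) (beta : R)
    (L : {measure set (borel V) -> \bar R}) :
  feasible_probability mu -> weighted_functions SS sw (fun s => (h s)%:E) ->
  (L setT < +oo)%E -> (forall k, K k -> r k + drift h k + gain L k <= beta) ->
  (\int[mu]_(k in K) r k <= beta - \int[L]_(xi in Xi) y xi)%R.
Proof.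
move=> fmu wh LT dual; have [muK ir st _] := fmu.
have [idr dr0] := drift_integral muK ir st wh.
have [mg [C gC] gy] := gain_facts LT.
have ig : mu.-integrable KK (EFin \o gain L).
  exact: bounded_integrable mK (probability_lty mu) mg gC.
have i1 : mu.-integrable KK (EFin \o (fun k => r k + drift h k)).
  rewrite (_ : EFin \o _ = (EFin \o r) \+ (EFin \o drift h))%E//.
  exact: integrableD.
have i2 : mu.-integrable KK (EFin \o (fun k => r k + drift h k + gain L k)).
  rewrite (_ : EFin \o _ = (EFin \o (fun k => r k + drift h k)%R) \+ (EFin \o gain L))%E//.
  exact: integrableD.
have : (\int[mu]_(k in K) (r k + drift h k + gain L k) <= \int[mu]_(k in K) beta)%R.
  apply: le_Rintegral => //.
  apply: (@bounded_integrable _ _ _ _ _ (cst beta) `|beta|) => //; exact: probability_lty.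
have mK1 : fine (mu K) = 1 by rewrite muK.
rewrite Rintegral_cst// [fine _]mK1 mulr1 RintegralD// RintegralD// dr0 addr0.
by have := gy mu fmu; lra.
Qed.

Lemma continuous_drift (h : ES -> R) : {within S, continuous h} -> bounded_on S h ->
  {within K, continuous (drift h)} /\ exists C, forall k, K k -> `|drift h k| <= C.
Proof.
move=> ch bh; have [cQ [C QC]] := reg_Qcont reg ch bh; have [M hM] := bh.
split; last first.
  exists (C + M) => k Kk; apply: le_trans (ler_normB _ _) _.
  by apply: lerD; [exact: QC|apply: hM; case: Kk].
move: cQ => /subspace_continuousP cQ; apply/subspace_continuousP => k Kk.
apply: cvgB; first exact: cQ.
move: ch => /subspace_continuousP ch.
have Sk : S k.1 by case: Kk.
apply: cvg_comp (ch _ Sk) => A.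
rewrite /within/= /nbhs/= => Aw.
have : nbhs k (fst @^-1` [set s | S s -> A s]) by exact: (@cvg_fst _ _ (nbhs k.1) (nbhs k.2)).
by apply: filterS => k' /= Ak' [Sk' _]; exact: Ak'.
Qed.

Lemma driftN (h : ES -> R) k : K k ->
  weighted_functions SS sw (fun s => (h s)%:E) -> drift (fun s => - h s) k = - drift h k.
Proof.
move=> Kk wh; rewrite /drift opprB opprK addrC; congr (_ + _).
rewrite (eq_Rintegral _ (g := fun s : borel ES => (-1) * h s)); last by move=> s _; rewrite mulN1r.
have ih := weighted_integrable reg wh Kk.
by rewrite RintegralZl ?mulN1r//; exact: reg_mS reg.
Qed.

End duality.

(** * Compactness of occupation measures *)

Section compactness.
Context (R : realType) (ES EA : completeMetricType R).
Variables (S : set ES) (Act : ES -> set EA).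
Variable Q : ES * EA -> probability (borel ES) R.
Variable r : ES * EA -> R.
Variables (n : nat) (z : ES * EA -> 'rV[R]_n).
Variables (p : nat) (Xi : set 'rV[R]_p) (u : 'rV[R]_n -> 'rV[R]_p -> R).
Variable y : 'rV[R]_p -> R.
Local Notation K := (graph_of S Act).
Local Notation KT := (borel (ES * EA)%type).
Local Notation KK := (K : set KT).
Local Notation SS := (S : set (borel ES)).
Local Notation sw := (state_weight Act r).
Local Notation V := ('rV[R]_p).
Hypothesis reg : regular_process S Act Q r.
Hypothesis utl : regular_utility K z Xi u y.

Let mK : measurable KK := measurable_graph reg.

Lemma bounded_process_integrable (mu : probability KT R) (f : ES * EA -> R) (C : R) :
  measurable_fun KK f -> (forall k, K k -> `|f k| <= C) ->
  mu.-integrable KK (EFin \o f).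
Proof.
by move=> mf fC; exact: bounded_integrable mK (probability_lty mu) mf fC.
Qed.

(** Bounded continuous approximations of the indicator of an open set and dominated convergence give
    the identity on open sets. These are stable under intersection and generate the Borel sets, so
    the marginal and the kernel mixture, both finite, coincide. *)
Lemma stationary_of_continuous (mu : probability KT R) : mu K = 1%E ->
  (forall h : ES -> R, {within S, continuous h} -> bounded_on S h ->
    \int[mu]_(k in K) drift S Q h k = 0)%R ->
  stationary S Act Q mu.
Proof.
move=> muK dr0; have [k0 _] := graph_nonempty muK.
pose Q' := extended_kernel S Act Q k0.
have mQ' := measurable_extended_kernel reg k0.
have [nu nuE] := kernel_mixture_exists mu mQ'.
have cfst : continuous (fst : ES * EA -> ES) by move=> k; exact: cvg_fst.
have mfst := measurable_borel_continuous cfst.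
have mf1 (C : set (borel ES)) : measurable C -> measurable (fst @^-1` C : set KT).
  by move=> mC; rewrite -[X in measurable X]setTI; exact: mfst.
have nuEK (B : set (borel ES)) : measurable B -> (nu B = \int[mu]_(k in K) Q k B)%E.
  move=> mB; rewrite nuE// (integral_graph reg muK)//; last exact: mQ'.
  by apply: eq_integral => k; rewrite inE => Kk; rewrite extended_kernelE.
pose nu1f : {measure set (borel ES) -> \bar R} :=
  pushforward mu (fst : KT -> borel ES).
pose nu1 := nu1f mfst.
suff eq12 (B : set (borel ES)) : measurable B -> nu1 B = nu B.
  by move=> B mB _; rewrite -nuEK// -eq12.
apply: (@g_sigma_algebra_measure_unique _ R (borel ES) (@open ES) _ (fun=> setT)) => //.
- by move=> U oU; exact: sub_sigma_algebra.
- by move=> i; exact: openT.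
- by rewrite bigcup_const//; exists 0%N.
- exact: openI.
- move=> U oU.
  have mU : measurable (U : set (borel ES)) by exact: sub_sigma_algebra.
  rewrite [RHS]nuEK//.
  have [h [ch h01 hU]] := @open_indicator_approx R ES U oU.
  have wch j : {within S, continuous (h j)} by exact: continuous_subspaceT.
  have bh j : bounded_on S (h j).
    by exists 1 => s _; have /andP[a b] := h01 j s; rewrite ger0_norm.
  have mh j : measurable_fun SS (h j).
    by apply: measurable_lsc_on; [exact: reg_mS reg|exact: continuous_lsc_on].
  have Qk1 k (W : set (borel ES)) : measurable W -> fine (Q k W) <= 1.
    move=> mW; rewrite -lee_fin fineK ?probability_le1//.
    by rewrite ge0_fin_numE// (le_lt_trans (probability_le1 _ _))// ltry.
  have mhQ j : measurable_fun KK (fun k => (\int[Q k]_(s in S) h j s)%R).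
    by apply: measurable_lsc_on => //; apply: continuous_lsc_on; case: (reg_Qcont reg (wch j) (bh j)).
  have hQ1 j k : K k -> `|(\int[Q k]_(s in S) h j s)%R| <= 1.
    move=> Kk; have iH := weighted_integrable reg (bounded_weighted reg (wch j) (bh j)) Kk.
    rewrite ger0_norm; last by apply: Rintegral_ge0 => s _; case/andP: (h01 j s).
    apply: (@le_trans _ _ (\int[Q k]_(s in S) 1)%R).
      apply: le_Rintegral => //; first exact: reg_mS reg.
        apply: (@bounded_integrable _ _ _ _ _ (cst 1) 1) => //.
        - exact: reg_mS reg.
        - exact: probability_lty.
        - by move=> s _ /=; rewrite normr1.
      by move=> s _; case/andP: (h01 j s).
    rewrite Rintegral_cst ?mul1r; last exact: reg_mS reg.
    by apply: Qk1; exact: reg_mS reg.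
  have h1 j k : K k -> `|h j k.1| <= 1.
    by move=> _; have /andP[a b] := h01 j k.1; rewrite ger0_norm.
  have mh1 j : measurable_fun KK (fun k => h j k.1).
    apply: measurable_lsc_on => //; apply: continuous_lsc_on.
    by apply: continuous_subspaceT => k; apply: (continuous_comp (cfst k)); exact: ch.
  have eqj j : (\int[mu]_(k in K) h j k.1 = \int[mu]_(k in K) (\int[Q k]_(s in S) h j s))%R.
    apply/esym/eqP; rewrite -subr_eq0 -RintegralB//.
    - by apply/eqP; exact: dr0.
    - exact: bounded_process_integrable (mhQ j) (hQ1 j).
    - exact: bounded_process_integrable (mh1 j) (h1 j).
  have lim1 : (\int[mu]_(k in K) h j k.1)%R @[j --> \oo] -->
      (\int[mu]_(k in K) \1_U k.1)%R.
    apply: (@Rintegral_bounded_cvg _ _ _ _ _ _ _ 1) => //.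
    exact: probability_lty.
  have lim2 : (\int[mu]_(k in K) (\int[Q k]_(s in S) h j s))%R @[j --> \oo] -->
      (\int[mu]_(k in K) (\int[Q k]_(s in S) \1_U s))%R.
    apply: (@Rintegral_bounded_cvg _ _ _ _ _ _ _ 1) => //; first exact: probability_lty.
    move=> k Kk; apply: (@Rintegral_bounded_cvg _ _ _ _ _ _ _ 1) => //.
    + exact: reg_mS reg.
    + exact: probability_lty.
    + by move=> j s _; have /andP[a b] := h01 j s; rewrite ger0_norm.
  have E : (\int[mu]_(k in K) \1_U k.1 = \int[mu]_(k in K) (\int[Q k]_(s in S) \1_U s))%R.
    apply: (cvg_unique _ lim1); first exact: norm_hausdorff.
    by rewrite (_ : (fun j => _) = fun j => (\int[mu]_(k in K) (\int[Q k]_(s in S) h j s))%R)//; apply/funext.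
  have QU k : K k -> (\int[Q k]_(s in S) \1_U s)%R = fine (Q k U).
    move=> Kk; rewrite /Rintegral integral_indic//; last exact: reg_mS reg.
    congr fine; rewrite -[LHS]adde0 -(_ : Q k (U `&` ~` S) = 0%E); last first.
      apply: subset_measure0 (kernel_full reg Kk) => //.
      + by apply: measurableI => //; apply: measurableC; exact: reg_mS reg.
      + by apply: measurableC; exact: reg_mS reg.
    rewrite -measureU//; last 3 first.
    + by apply: measurableI => //; exact: reg_mS reg.
    + by apply: measurableI => //; apply: measurableC; exact: reg_mS reg.
    + by rewrite setIACA setICr setI0.
    by rewrite -setIUr setUv setIT.
  have fQ k (W : set (borel ES)) : measurable W -> Q k W \is a fin_num.
    by move=> mW; rewrite ge0_fin_numE// (le_lt_trans (probability_le1 _ _))// ltry.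
  have L1 : (\int[mu]_(k in K) \1_U k.1)%R = fine (nu1 U).
    rewrite /Rintegral; congr fine.
    rewrite (_ : (fun k : KT => (\1_U k.1)%:E) = (fun k : KT => (\1_(fst @^-1` U) k)%:E)); last first.
      by apply/funext => k; rewrite !indicE; congr ((nat_of_bool _)%:R)%:E; apply/idP/idP; rewrite !inE.
    rewrite integral_indic//; last exact: mf1.
    exact/esym/(graph_measureI reg muK (mf1 _ mU)).
  have fp1 : nu1 U \is a fin_num.
    rewrite ge0_fin_numE// (le_lt_trans (probability_le1 _ _)) ?ltry//.
    exact: mf1.
  rewrite -(fineK fp1) -L1 E.
  have ifQ : mu.-integrable KK (EFin \o (fun k => fine (Q k U))).
    apply: (@bounded_process_integrable _ _ 1).
      apply: (eq_measurable_fun (fun k : KT => (\int[Q k]_(s in S) \1_U s)%R)).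
        by move=> k; rewrite inE; exact: QU.
      apply: (measurable_fun_cvg mhQ) => k Kk.
      apply: (@Rintegral_bounded_cvg _ _ _ _ _ _ _ 1) => //.
      + exact: reg_mS reg.
      + exact: probability_lty.
      + by move=> j s _; have /andP[a b] := h01 j s; rewrite ger0_norm.
    by move=> k Kk; rewrite ger0_norm ?fine_ge0//; exact: Qk1.
  rewrite (eq_Rintegral _ (g := fun k : KT => fine (Q k U))); last first.
    by move=> k; rewrite inE; exact: QU.
  rewrite /Rintegral fineK; last exact: integrable_fin_num ifQ.
  by apply: eq_integral => k _; rewrite fineK ?fQ.
- by move=> i; apply: probability_lty.
Qed.

Section limit.
Context (I : Type) (F : set_system I) {FF : ProperFilter F}.
Variable m : I -> probability KT R.
Variable c : R.
Hypothesis mK1 : forall i, m i K = 1%E.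
Hypothesis mr : forall i, (m i).-integrable KK (EFin \o r).
Hypothesis mc : forall i, c <= (\int[m i]_(k in K) r k)%R.
(** A one-sided asymptotic bound suffices, because [- h] is a test function as well. *)
Hypothesis mdrift : forall h : ES -> R, {within S, continuous h} -> bounded_on S h ->
  forall e : R, 0 < e -> \forall i \near F, - e <= (\int[m i]_(k in K) drift S Q h k)%R.
Hypothesis mutil : forall xi, Xi xi ->
  forall e : R, 0 < e -> \forall i \near F, y xi - e <= (\int[m i]_(k in K) u (z k) xi)%R.

Let r0 k : K k -> 0 <= - r k.
Proof. by move=> /(reg_r0 reg); rewrite oppr_ge0. Qed.

Let integral_opp_reward (mu : probability KT R) : mu.-integrable KK (EFin \o r) ->
  (\int[mu]_(k in K) (- r k)%:E = (- \int[mu]_(k in K) r k)%R%:E)%E.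
Proof.
move=> ir; rewrite EFinN /Rintegral fineK; last exact: integrable_fin_num.
rewrite -integralN; last exact: integrable_add_def.
by apply: eq_integral => k _; rewrite EFinN.
Qed.

(** Markov's inequality for [- r], whose integral is at most [- c]. The superlevel sets of [r] being
    compact, this is a tightness estimate uniform in [i]. *)
Lemma reward_markov (i : I) (N : R) : 0 < N ->
  (m i (~` (K `&` [set k | (- N <= r k)%R])) <= (- c / N)%:E)%E.
Proof.
move=> N0; pose C : set KT := K `&` [set k | - N <= r k].
have mC : measurable C by apply: closed_borel; exact: (superlevel_closed reg).
have mA := measurableC mC.
have mR : measurable_fun KK r by exact: (measurable_reward reg).
have : (\int[m i]_(k in K) (N%:E * (\1_(~` C) k)%:E) <= \int[m i]_(k in K) (- r k)%:E)%E.
  apply: ge0_le_integral => //.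
  - by move=> k _; rewrite mule_ge0// lee_fin ?ltW.
  - by apply: measurable_funeM; apply/measurable_EFinP; exact: measurable_indic.
  - by apply/measurable_EFinP; exact: measurable_funN.
  - move=> k Kk; rewrite -EFinM lee_fin indicE.
    have [kC|kC] := boolP (k \in ~` C); last by rewrite mulr0 r0.
    rewrite mulr1 lerNr ltW// ltNge; apply/negP => Nr.
    by move: kC; rewrite inE; apply.
rewrite ge0_integralZl//; last 2 first.
- by apply/measurable_EFinP; exact: measurable_indic.
- by rewrite lee_fin ltW.
rewrite integral_indic// integral_opp_reward//.
move=> h0; have h : (N%:E * m i (~` C) <= (- \int[m i]_(k in K) r k)%R%:E)%E.
  by rewrite (graph_measureI reg (mK1 i) mA); exact: h0.
rewrite -/C -(@lee_pmul2l _ N%:E)// -EFinM mulrC divfK ?gt_eqF//.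
by apply: le_trans h _; rewrite lee_fin lerN2 mc.
Qed.

Lemma feasible_limit : exists2 mu : probability KT R,
  feasible_probability S Act Q r z Xi u y mu &
  forall v, (\forall i \near F, v <= (\int[m i]_(k in K) r k)%R) ->
    v <= (\int[mu]_(k in K) r k)%R.
Proof.
have [G [GU FG]] := ultraFilterLemma FF.
pose m' i : {measure set KT -> \bar R} := m i.
have m'T i : m' i setT = 1%E by exact: (probability_setT (m i)).
have mM i : (m' i setT <= 1%:E)%E by rewrite m'T.
have m'1 i (B : set KT) : measurable B -> (m' i B <= 1)%E by exact: (@probability_le1 _ _ _ (m i)).
have hT := @pair_hausdorff R ES EA.
have regT : regular_space (ES * EA)%type by exact: uniform_regular.
have mi0 i : m' i (~` K) = 0%E by exact: (graph_conull reg (mK1 i)).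
have [i0 _] : exists i : I, True.
  by have [i _] := filter_ex (@filterT _ F _); exists i.
have c0 : 0 <= - c.
  rewrite -lee_fin; apply: (@le_trans _ _ (\int[m i0]_(k in K) (- r k)%:E)%E).
    by apply: integral_ge0 => k /r0; rewrite lee_fin.
  by rewrite integral_opp_reward// lee_fin lerN2 mc.
(* The [+ 1] keeps [N] positive when [c = 0]. *)
have tight e : 0 < e -> exists2 N : R, 0 < N & - c / N <= e.
  move=> e0; exists ((- c + 1) / e); first by rewrite divr_gt0//; lra.
  by rewrite ler_pdivrMr ?divr_gt0//; [rewrite mulrC divfK ?gt_eqF//; lra|lra].
have tightC e : 0 < e -> exists2 C : set (ES * EA), compact C &
    forall i, (m' i (~` C) <= e%:E)%E.
  move=> /tight[N N0 Ne]; exists (K `&` [set k | - N <= r k]).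
    exact: (superlevel_compact reg).
  by move=> i; apply: le_trans (reward_markov i N0) _; rewrite lee_fin.
have [mu0 [mu0T mu0O]] := @ultralim_measure_exists R _ I G GU m' 1 mM hT regT tightC.
have mu01 : mu0 setT = 1%E.
  rewrite mu0T; congr EFin; apply/cvg_lim => //.
  rewrite (_ : (fun i => _) = fun=> 1); first exact: cvg_cst.
  by apply/funext => i; rewrite m'T.
pose mu : probability KT R := probability_of_measure mu01.
have mufin : (mu0 setT < +oo)%E by rewrite mu01 ltry.
(* [K] need not be closed in the ambient product, so its complement is enclosed in the open
   complements of the compact superlevel sets, whose masses are bounded by [- c / N]. *)
have mu0K0 : mu0 (~` K) = 0%E.
  apply/eqP; rewrite eq_le measure_ge0 andbT; apply/lee_addgt0Pr => e e0.
  rewrite add0e; have [N N0 Ne] := tight e e0.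
  have oC : open (~` (K `&` [set k | - N <= r k])).
    by apply: closed_openC; exact: (superlevel_closed reg).
  have mC : measurable (~` (K `&` [set k | - N <= r k]) : set KT).
    exact: sub_sigma_algebra.
  apply: (@le_trans _ _ (mu0 (~` (K `&` [set k | - N <= r k])))).
    by apply: le_measure; rewrite ?inE//; [exact: measurableC|move=> k nK [/nK]].
  have fC : mu0 (~` (K `&` [set k | - N <= r k])) \is a fin_num.
    rewrite ge0_fin_numE// (le_lt_trans _ mufin)//.
    by apply: le_measure; rewrite ?inE.
  rewrite -(fineK fC) lee_fin; apply: le_trans (mu0O _ oC) _.
  have cl := @ultralim_cvg R _ I G GU m' 1 mM _ mC.
  have cc : (fun=> e) i @[i --> G] --> e by exact: cvg_cst.
  apply: (le_filter_lim _ cl cc); apply: nearW => i.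
  have fC' : m' i (~` (K `&` [set k | - N <= r k])) \is a fin_num.
    by rewrite ge0_fin_numE// (le_lt_trans (m'1 _ _ mC))// ltry.
  by rewrite -lee_fin (fineK fC') (le_trans (reward_markov i N0))// lee_fin.
have muK : mu K = 1%E.
  rewrite -(setCK K) probability_setC; last exact: measurableC.
  by rewrite [X in (1 - X)%E]mu0K0 sube0.
have port := @portmanteau_lsc R _ I G GU m' 1 mM mu0 mufin mu0O KK mK mu0K0 mi0.
(* Adding [C] makes [f] nonnegative; since all the measures give [K] mass [1], the constant
   cancels. *)
have port_bounded (f : ES * EA -> R) (C a : R) : lsc_on K f ->
    (forall k, K k -> `|f k| <= C) ->
    (\forall i \near G, (\int[m i]_(k in K) f k)%R <= a) ->
    (\int[mu]_(k in K) f k)%R <= a.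
  move=> lf fC fa.
  have mf : measurable_fun KK f by exact: measurable_lsc_on.
  have lfC : lsc_on K (fun k => f k + C).
    move=> b; have [W oW E] := lf (b - C); exists W => //; rewrite -E.
    by apply/seteqP; split => k [Kk /=]; rewrite ltrBlDr.
  have fC0 k : K k -> 0 <= f k + C.
    by move=> /fC; rewrite ler_norml => /andP[h _]; rewrite -lerBlDr sub0r.
  have ifm (P : probability KT R) : P K = 1%E ->
      (\int[P]_(k in K) (f k + C)%:E = ((\int[P]_(k in K) f k)%R + C)%:E)%E.
    move=> P1; have if_ : P.-integrable KK (EFin \o f) by exact: bounded_process_integrable fC.
    have icst : P.-integrable KK (EFin \o cst C).
      by apply: (@bounded_process_integrable _ _ `|C|).
    have P1' : fine (P K) = 1 by rewrite P1.
    transitivity (\int[P]_(k in K) (f k + C))%R%:E.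
      rewrite /Rintegral fineK//; apply: integrable_fin_num => //.
      rewrite (_ : (fun k => _) = (EFin \o f) \+ (EFin \o cst C))%E//.
      exact: integrableD.
    by rewrite RintegralD// Rintegral_cst// [fine _]P1' mulr1.
  have := port _ (a + C) lfC fC0.
  rewrite (ifm mu muK) lee_fin lerD2r; apply.
  by apply: filterS fa => i ia; rewrite /m' ifm// lee_fin lerD2r.
have mR : measurable_fun KK r by exact: (measurable_reward reg).
have port_r v : (\forall i \near G, v <= (\int[m i]_(k in K) r k)%R) ->
    (\int[mu]_(k in K) (- r k)%:E <= (- v)%:E)%E.
  move=> rv; apply: port; [exact: (reward_usc reg)|exact: r0|].
  by apply: filterS rv => i iv; rewrite /m' integral_opp_reward// lee_fin lerN2.
have ir : mu.-integrable KK (EFin \o r).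
  apply/integrableP; split; first exact/measurable_EFinP.
  apply: (@le_lt_trans _ _ (\int[mu]_(k in K) (- r k)%:E)%E).
    rewrite le_eqVlt; apply/orP; left; apply/eqP/eq_integral => k.
    rewrite inE => /(reg_r0 reg) rk.
    by rewrite /= ler0_norm.
  by apply: le_lt_trans (port_r c _) (ltry _); apply: nearW => i.
exists mu; last first.
  move=> v rv; have := port_r v (FG _ rv).
  by rewrite integral_opp_reward// lee_fin lerN2.
have FGn (P : set I) : (\forall i \near F, P i) -> \forall i \near G, P i by exact: FG.
split => //.
- apply: stationary_of_continuous => // h ch bh.
  have wh := bounded_weighted reg ch bh.
  have half (g : ES -> R) : {within S, continuous g} -> bounded_on S g ->
      (forall k, K k -> drift S Q g k = - drift S Q (fun s => - g s) k) ->
      0 <= (\int[mu]_(k in K) drift S Q g k)%R.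
    move=> cg bg gN; have [cd [C dC]] := continuous_drift reg cg bg.
    rewrite -oppr_le0; apply/ler_addgt0Pr => e e0; rewrite add0r.
    have md : measurable_fun KK (drift S Q g).
      by apply: measurable_lsc_on => //; exact: continuous_lsc_on.
    have NE (P : probability KT R) :
        (- (\int[P]_(k in K) drift S Q g k) = \int[P]_(k in K) (- drift S Q g k))%R.
      rewrite [RHS](eq_Rintegral _ (g := fun k : KT => (-1) * drift S Q g k)).
        rewrite RintegralZl ?mulN1r//; exact: bounded_process_integrable dC.
      by move=> k _; rewrite mulN1r.
    rewrite NE; apply: (port_bounded _ C).
    + apply: continuous_lsc_on; move: cd => /subspace_continuousP cd.
      by apply/subspace_continuousP => k Kk; apply: cvgN; exact: cd.
    + by move=> k Kk; rewrite normrN; exact: dC.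
    + apply: FGn; apply: filterS (mdrift cg bg e0) => i ie.
      by rewrite -NE lerNl.
  have cNh : {within S, continuous (fun s => - h s)}.
    move: ch => /subspace_continuousP ch; apply/subspace_continuousP => s Ss.
    by apply: cvgN; exact: ch.
  have bNh : bounded_on S (fun s => - h s).
    by have [M hM] := bh; exists M => s Ss; rewrite normrN; exact: hM.
  have dN k : K k -> drift S Q (fun s => - h s) k = - drift S Q h k.
    by move=> Kk; exact: (driftN reg).
  have hh : (fun s => - - h s) = h by apply/funext => s; rewrite opprK.
  apply/eqP; rewrite eq_le; apply/andP; split.
    have := half _ cNh bNh; rewrite hh => /(_ dN).
    have [cd [C dC]] := continuous_drift reg ch bh.
    have md : measurable_fun KK (drift S Q h).
      by apply: measurable_lsc_on => //; exact: continuous_lsc_on.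
    rewrite (eq_Rintegral _ (g := fun k : KT => (-1) * drift S Q h k)).
      rewrite RintegralZl ?mulN1r ?oppr_ge0//; exact: bounded_process_integrable dC.
    by move=> k; rewrite inE => Kk; rewrite mulN1r dN.
  by apply: half => // k Kk; rewrite dN// opprK.
- move=> xi Xxi; have [C uC] := utility_bounded utl.
  have mu_ : measurable_fun KK (fun k => u (z k) xi) by exact: (measurable_utility reg utl).
  have NE (P : probability KT R) :
      (- (\int[P]_(k in K) u (z k) xi) = \int[P]_(k in K) (- u (z k) xi))%R.
    rewrite [RHS](eq_Rintegral _ (g := fun k : KT => (-1) * u (z k) xi)).
      rewrite RintegralZl ?mulN1r//.
      by apply: (bounded_process_integrable _ mu_ (C := C)) => k Kk; exact: uC.
    by move=> k _; rewrite mulN1r.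
  rewrite -lerN2; apply/ler_addgt0Pr => e e0; rewrite NE.
  apply: (port_bounded _ C).
  + exact: (utility_usc utl).
  + by move=> k Kk; rewrite normrN; exact: uC.
  + apply: FGn; apply: filterS (mutil Xxi e0) => i ie.
    by rewrite -NE; move: ie; lra.
Qed.

End limit.
End compactness.

(** * Strong duality *)

Section measure_combination.
Context d (T : measurableType d) (R : realType).
Variables (a b : {nonneg R}) (m1 m2 : {measure set T -> \bar R}).

Definition mcomb : {measure set T -> \bar R} :=
  measure_add (mscale a m1) (mscale b m2).

Lemma mcombE B : (mcomb B = a%:num%:E * m1 B + b%:num%:E * m2 B)%E.
Proof. exact: (measure_addE (mscale a m1) (mscale b m2)). Qed.

Lemma ge0_integral_mcomb D (f : T -> \bar R) : measurable D ->
  measurable_fun D f -> (forall x, D x -> 0 <= f x)%E ->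
  (\int[mcomb]_(x in D) f x =
   a%:num%:E * \int[m1]_(x in D) f x + b%:num%:E * \int[m2]_(x in D) f x)%E.
Proof.
by move=> mD mf f0; rewrite ge0_integral_measure_add// !ge0_integral_mscale.
Qed.

Lemma integral_mcomb D (f : T -> R) : measurable D ->
  m1.-integrable D (EFin \o f) -> m2.-integrable D (EFin \o f) ->
  mcomb.-integrable D (EFin \o f) /\
  (\int[mcomb]_(x in D) f x =
   a%:num * \int[m1]_(x in D) f x + b%:num * \int[m2]_(x in D) f x)%R.
Proof.
move=> mD i1 i2; have [mf f1] := integrableP _ _ _ i1.
have [_ f2] := integrableP _ _ _ i2.
have ic : mcomb.-integrable D (EFin \o f).
  apply/integrableP; split => //.
  rewrite ge0_integral_mcomb//; last exact: measurableT_comp.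
  by rewrite lte_add_pinfty// lte_mul_pinfty// ?lee_fin.
split => //; rewrite /Rintegral (integralE mcomb) (integralE m1) (integralE m2).
have p1 := integrable_pos_fin_num mD i1; have n1 := integrable_neg_fin_num mD i1.
have p2 := integrable_pos_fin_num mD i2; have n2 := integrable_neg_fin_num mD i2.
rewrite !ge0_integral_mcomb//; last 2 first.
- exact: measurable_funeneg.
- exact: measurable_funepos.
rewrite -(fineK p1) -(fineK n1) -(fineK p2) -(fineK n2) -!EFinM -!EFinD /=.
by ring.
Qed.

End measure_combination.

Lemma Rintegral_dirac d (T : measurableType d) (R : realType) (D : set T) (x : T)
    (f : T -> R) : measurable D -> D x -> measurable_fun D f ->
  (\d_x : {measure set T -> \bar R}).-integrable D (EFin \o f) /\
  (\int[\d_x]_(t in D) f t = f x)%R.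
Proof.
move=> mD Dx mf; have mF : measurable_fun D (EFin \o f) by exact/measurable_EFinP.
have dD : (\d_x D = 1 :> \bar R)%E by rewrite diracE mem_set.
split.
  apply/integrableP; split => //; rewrite integral_dirac//; last exact: measurableT_comp.
  by rewrite dD mul1e ltry.
by rewrite /Rintegral integral_dirac// dD mul1e.
Qed.

Section strong_duality.
Context (R : realType) (ES EA : completeMetricType R).
Variables (S : set ES) (Act : ES -> set EA).
Variable Q : ES * EA -> probability (borel ES) R.
Variable r : ES * EA -> R.
Variables (n : nat) (z : ES * EA -> 'rV[R]_n).
Variables (p : nat) (Xi : set 'rV[R]_p) (u : 'rV[R]_n -> 'rV[R]_p -> R).
Variable y : 'rV[R]_p -> R.
Local Notation K := (graph_of S Act).
Local Notation KT := (borel (ES * EA)%type).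
Local Notation KK := (K : set KT).
Local Notation SS := (S : set (borel ES)).
Local Notation sw := (state_weight Act r).
Local Notation V := ('rV[R]_p).
Hypothesis reg : regular_process S Act Q r.
Hypothesis utl : regular_utility K z Xi u y.

Let mK : measurable KK := measurable_graph reg.
Let mX : measurable (Xi : set (borel V)) := compact_borel (util_cXi utl).

Definition multiplier : Type := (ES -> R) * {measure set (borel V) -> \bar R}.

(** These conditions make the penalty a bounded measurable function on [K], integrable for every
    probability, and are preserved by [j1 + lam * j2] with [lam >= 0]. *)
Definition admissible_multiplier (j : multiplier) :=
  [/\ {within S, continuous j.1}, bounded_on S j.1, (j.2 setT < +oo)%E &
      j.2 (~` Xi) = 0%E].

Local Notation ok := admissible_multiplier.

Definition penalty (j : multiplier) (k : ES * EA) : R :=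
  drift S Q j.1 k + gain z Xi u j.2 k - (\int[j.2]_(xi in Xi) y xi)%R.

Lemma penalty_facts j : ok j ->
  [/\ measurable_fun KK (penalty j), exists C, forall k, K k -> `|penalty j k| <= C &
    forall mu, feasible_probability S Act Q r z Xi u y mu ->
      0 <= (\int[mu]_(k in K) penalty j k)%R].
Proof.
move=> [cj bj Lj _].
have [cd [C1 d1]] := continuous_drift reg cj bj.
have md : measurable_fun KK (drift S Q j.1).
  by apply: measurable_lsc_on => //; exact: continuous_lsc_on.
have [mg [C2 g2] gy] := gain_facts reg utl Lj.
pose c := (\int[j.2]_(xi in Xi) y xi)%R.
have mp : measurable_fun KK (penalty j).
  by apply: measurable_funB => //; exact: measurable_funD.
have pb : forall k, K k -> `|penalty j k| <= C1 + C2 + `|c|.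
  move=> k Kk; apply: le_trans (ler_normB _ _) _; apply: lerD => //.
  by apply: le_trans (ler_normD _ _) _; apply: lerD; [exact: d1|exact: g2].
split => //; first by exists (C1 + C2 + `|c|).
move=> mu fmu; have [muK ir st _] := fmu.
have [idr dr0] := drift_integral reg muK ir st (bounded_weighted reg cj bj).
have ig : mu.-integrable KK (EFin \o gain z Xi u j.2) by exact: (bounded_process_integrable reg) mg g2.
have i1 : mu.-integrable KK (EFin \o (fun k => drift S Q j.1 k + gain z Xi u j.2 k)).
  rewrite (_ : EFin \o _ = (EFin \o drift S Q j.1) \+ (EFin \o gain z Xi u j.2))%E//.
  exact: integrableD.
have icst : mu.-integrable KK (EFin \o cst c) by apply: (@bounded_process_integrable _ _ _ _ _ _ _ reg mu (cst c) `|c|).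
have muK1 : fine (mu K) = 1 by rewrite muK.
rewrite /penalty RintegralB// RintegralD// dr0 add0r Rintegral_cst// [fine _]muK1 mulr1.
by rewrite subr_ge0; exact: gy.
Qed.

Lemma penalty_integrable j (mu : probability KT R) : ok j ->
  mu.-integrable KK (EFin \o penalty j).
Proof.
by move=> /penalty_facts[mp [C pC] _]; exact: (bounded_process_integrable reg) mp pC.
Qed.

Lemma penalty_comb j1 j2 (lam : R) : ok j1 -> ok j2 -> 0 <= lam ->
  exists2 j, ok j & forall k, K k -> penalty j k = penalty j1 k + lam * penalty j2 k.
Proof.
move=> ok1 ok2 lam0; have [c1 [M1 b1] L1 X1] := ok1; have [c2 [M2 b2] L2 X2] := ok2.
pose h s := j1.1 s + lam * j2.1 s.
pose L := mcomb (NngNum (@ler01 R)) (NngNum lam0) j1.2 j2.2.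
exists (h, L).
  split => /=.
  - move: c1 c2 => /subspace_continuousP c1 /subspace_continuousP c2.
    apply/subspace_continuousP => s Ss; apply: cvgD; first exact: c1.
    by apply: cvgMl_tmp; exact: c2.
  - exists (M1 + lam * M2) => s Ss; apply: le_trans (ler_normD _ _) _.
    by rewrite lerD ?b1// normrM ger0_norm// ler_wpM2l// b2.
  - by rewrite mcombE mul1e lte_add_pinfty// lte_mul_pinfty// ?lee_fin.
  - by rewrite mcombE X1 X2 !mule0 adde0.
move=> k Kk; rewrite /penalty/=.
have iL (f : V -> R) (m : {measure set (borel V) -> \bar R}) : (m setT < +oo)%E ->
    {within Xi, continuous f} -> m.-integrable Xi (EFin \o f).
  move=> mT cf; have [C fC] := within_continuous_bounded (util_cXi utl) cf.
  apply: (bounded_integrable mX mT _ fC); apply: measurable_lsc_on => //.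
  exact: continuous_lsc_on.
have cu : {within Xi, continuous (u (z k))} by exact: (util_cont utl).
have [_ Ey] := integral_mcomb (NngNum (@ler01 R)) (NngNum lam0) mX
  (iL y _ L1 (util_y utl)) (iL y _ L2 (util_y utl)).
have [_ Eu] := integral_mcomb (NngNum (@ler01 R)) (NngNum lam0) mX
  (iL _ _ L1 cu) (iL _ _ L2 cu).
have Ed : drift S Q h k = drift S Q j1.1 k + lam * drift S Q j2.1 k.
  have i1 := weighted_integrable reg (bounded_weighted reg c1 (ex_intro _ M1 b1)) Kk.
  have i2 := weighted_integrable reg (bounded_weighted reg c2 (ex_intro _ M2 b2)) Kk.
  have i2' : (Q k).-integrable SS (EFin \o (fun s => lam * j2.1 s)).
    rewrite (_ : EFin \o _ = fun s : borel ES => lam%:E * (j2.1 s)%:E)%E.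
      by apply: integrableZl => //; exact: reg_mS reg.
    by apply/funext => s /=; rewrite EFinM.
  rewrite /drift RintegralD//; last exact: reg_mS reg.
  rewrite RintegralZl//; last exact: reg_mS reg.
  by rewrite /h; ring.
rewrite Ed /gain [X in X - _ = _]addrC.
rewrite [X in X + _ - _ = _]Eu [X in _ - X = _]Ey /=.
by ring.
Qed.

Lemma zero_multiplier : exists2 L : {measure set (borel V) -> \bar R},
  (L setT < +oo)%E /\ L (~` Xi) = 0%E &
  forall f : V -> R, {within Xi, continuous f} -> (\int[L]_(xi in Xi) f xi = 0)%R.
Proof.
exists mzero; first by split => //; rewrite /mzero ltry.
by move=> f _; rewrite /Rintegral integral_measure_zero.
Qed.

Lemma continuous_multiplier (h : ES -> R) : {within S, continuous h} ->
  bounded_on S h ->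
  exists2 j, ok j & forall k, K k -> penalty j k = drift S Q h k.
Proof.
move=> ch bh; have [L [LT LX] L0] := zero_multiplier.
exists (h, L) => // k Kk; rewrite /penalty /gain /= !L0 ?addr0 ?subr0//.
  exact: util_y utl.
exact: (util_cont utl).
Qed.

Lemma dirac_multiplier xi : Xi xi ->
  exists2 j, ok j & forall k, K k -> penalty j k = u (z k) xi - y xi.
Proof.
move=> Xxi; exists (cst 0, \d_(xi : borel V) : {measure set (borel V) -> \bar R}).
  split => /=.
  - by apply: continuous_subspaceT => s; exact: cvg_cst.
  - by exists 0 => s _; rewrite normr0.
  - by rewrite diracT ltry.
  - by rewrite diracE memNset//= => /(_ Xxi).
have mc (f : V -> R) : {within Xi, continuous f} -> measurable_fun (Xi : set (borel V)) f.
  by move=> cf; apply: measurable_lsc_on => //; exact: continuous_lsc_on.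
move=> k Kk; rewrite /penalty /gain /drift /=.
have [_ ->] := Rintegral_dirac mX Xxi (mc _ (util_cont utl (x := z k))).
have [_ ->] := Rintegral_dirac mX Xxi (mc _ (util_y utl)).
rewrite Rintegral_cst; last exact: reg_mS reg.
by rewrite mul0r subrr add0r.
Qed.

(** The domain of the Lagrangian: a convex set free of stationarity and benchmark constraints, so
    that it contains the Dirac masses at points of [K], which turn an integral bound into a
    pointwise one. *)
Definition reward_probability (mu : probability KT R) :=
  mu K = 1%E /\ mu.-integrable KK (EFin \o r).

Lemma reward_probability_comb (mu1 mu2 : probability KT R) (t : R) :
  0 <= t <= 1 -> reward_probability mu1 -> reward_probability mu2 ->
  exists2 mu : probability KT R, reward_probability mu &
  forall f : ES * EA -> R, mu1.-integrable KK (EFin \o f) ->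
    mu2.-integrable KK (EFin \o f) ->
    (\int[mu]_(k in K) f k =
     t * \int[mu1]_(k in K) f k + (1 - t) * \int[mu2]_(k in K) f k)%R.
Proof.
move=> /andP[t0 t1] [mu1K ir1] [mu2K ir2].
have t1' : 0 <= 1 - t by rewrite subr_ge0.
pose m := mcomb (NngNum t0) (NngNum t1') mu1 mu2.
have mE (B : set KT) : mu1 B = 1%E -> mu2 B = 1%E -> m B = 1%E.
  move=> E1 E2; rewrite /m mcombE.
  rewrite (_ : _ B = 1%E)// (_ : _ B = 1%E)// !mule1 -EFinD/=.
  by congr EFin; ring.
have m1 : m setT = 1%E by apply: mE; exact: probability_setT.
exists (probability_of_measure m1).
  split; first exact: mE.
  by have [] := integral_mcomb (NngNum t0) (NngNum t1') mK ir1 ir2.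
move=> f if1 if2.
by have [_] := integral_mcomb (NngNum t0) (NngNum t1') mK if1 if2.
Qed.

Lemma reward_probability_dirac k : K k ->
  exists2 mu : probability KT R, reward_probability mu &
  forall f : ES * EA -> R, measurable_fun KK f -> (\int[mu]_(k in K) f k = f k)%R.
Proof.
move=> Kk; exists (\d_(k : KT)) => [|f mf]; last first.
  by have [] := Rintegral_dirac mK Kk mf.
have dK : (\d_(k : KT) KK = 1 :> \bar R)%E by rewrite diracE mem_set.
split; first exact: dK.
by have [] := Rintegral_dirac mK Kk (measurable_reward reg).
Qed.

(** * From multipliers for finitely many constraints to a single dual multiplier *)

Section multipliers.
Variable v : R.
Variable mu0 : probability KT R.
Hypothesis fmu0 : feasible_probability S Act Q r z Xi u y mu0.

Let payoff j (mu : probability KT R) : R :=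
  (\int[mu]_(k in K) r k + \int[mu]_(k in K) penalty j k)%R.

(** Each step removes one constraint from the list and absorbs it into the accumulated multiplier as
    [j0 + lam * j]. The slack [1] costs nothing: it contributes the term [lam >= 0], which is
    dropped. *)
Lemma finite_multiplier (l : seq multiplier) (j0 : multiplier) :
  (forall j, List.In j l -> ok j) -> ok j0 ->
  (forall mu, reward_probability mu ->
     (forall j, List.In j l -> -1 <= (\int[mu]_(k in K) penalty j k)%R) ->
     payoff j0 mu <= v) ->
  exists2 j, ok j & forall mu, reward_probability mu -> payoff j mu <= v.
Proof.
elim: l j0 => [|j l ih] j0 okl ok0 jv.
  by exists j0 => // mu rmu; apply: jv.
have okj : ok j by apply: okl; left.
pose X mu := reward_probability mu /\
  forall j', List.In j' l -> -1 <= (\int[mu]_(k in K) penalty j' k)%R.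
(* The second coordinate includes the slack [1], so the feasible [mu0], whose penalty integrals are
   nonnegative, is a strict Slater point. *)
pose P := [set (payoff j0 mu, (\int[mu]_(k in K) penalty j k)%R + 1) | mu in X].
have convP x x' t : P x -> P x' -> 0 <= t <= 1 ->
    P (t * x.1 + (1 - t) * x'.1, t * x.2 + (1 - t) * x'.2).
  move=> [m1 [r1 X1] <-] [m2 [r2 X2] <-] t01 /=.
  have [m rm mE] := reward_probability_comb t01 r1 r2.
  have mpE j' : ok j' -> (\int[m]_(k in K) penalty j' k = t * \int[m1]_(k in K) penalty j' k
      + (1 - t) * \int[m2]_(k in K) penalty j' k)%R.
    by move=> okj'; apply: mE; exact: penalty_integrable.
  exists m.
    split => // j' lj'; rewrite mpE; last by apply: okl; right.
    have := X1 j' lj'; have := X2 j' lj'; case/andP: t01 => t0 t1; nra.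
  rewrite /payoff !mpE// mE; [|by case: r1|by case: r2].
  by congr pair; ring.
have [||lam lam0 lamP] := @one_constraint_multiplier R P v convP.
- move=> _ [mu [rmu Xmu] <-] /= mu1; apply: jv => // j' [<-|/Xmu//].
  by rewrite -lerBlDr in mu1; rewrite -[leLHS]sub0r.
- exists (payoff j0 mu0, (\int[mu0]_(k in K) penalty j k)%R + 1).
    exists mu0 => //; split; first by case: fmu0.
    move=> j' lj'; apply: (@le_trans _ _ 0); first by rewrite lerN10.
    by have [_ _] := penalty_facts (okl j' (or_intror lj')); apply.
  by rewrite /= ltr_wpDl//; have [_ _] := penalty_facts okj; apply.
have [j1 ok1 j1E] := penalty_comb ok0 okj lam0.
apply: (ih j1) => // [j' lj'|mu rmu Xmu]; first by apply: okl; right.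
have : P (payoff j0 mu, (\int[mu]_(k in K) penalty j k)%R + 1) by exists mu.
move=> /lamP /= h; apply: le_trans h.
have E1 : (\int[mu]_(k in K) penalty j1 k =
    \int[mu]_(k in K) (penalty j0 k + lam * penalty j k))%R.
  by apply: eq_Rintegral => k; rewrite inE; exact: j1E.
rewrite /payoff E1.
have ij := penalty_integrable mu okj.
rewrite RintegralD//; last 2 first.
- exact: penalty_integrable.
- rewrite (_ : EFin \o _ = fun k : KT => lam%:E * (penalty j k)%:E)%E; last first.
    by apply/funext => k /=; rewrite EFinM.
  exact: integrableZl.
by rewrite RintegralZl//; lra.
Qed.

Hypothesis feasible_v : forall mu, feasible_probability S Act Q r z Xi u y mu ->
  (\int[mu]_(k in K) r k < v)%R.

(* Otherwise every finite family of multipliers is defeated by some occupation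
   measure of reward at least [v]; by compactness an ultralimit of these along
   the finite families would be feasible. *)
Lemma strong_multiplier : exists2 j, ok j &
  forall k, K k -> r k + penalty j k <= v.
Proof.
suff [j okj jP] : exists2 j, ok j & forall mu, reward_probability mu -> payoff j mu <= v.
  exists j => // k Kk; have [mu rmu muE] := reward_probability_dirac Kk.
  have := jP mu rmu; rewrite /payoff !muE//; first by case: (penalty_facts okj).
  exact: measurable_reward reg.
apply: contrapT => nex.
have [jz okz jzE] : exists2 j, ok j & forall k, K k -> penalty j k = drift S Q (cst 0) k.
  apply: continuous_multiplier; first by apply: continuous_subspaceT => s; exact: cvg_cst.
  by exists 0 => s _; rewrite normr0.
have jz0 (mu : probability KT R) : (\int[mu]_(k in K) penalty jz k = 0)%R.
  rewrite (eq_Rintegral _ (g := cst 0)); first by rewrite Rintegral_cst// mul0r.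
  move=> k; rewrite inE => Kk; rewrite jzE// /drift Rintegral_cst ?mul0r ?subrr//.
  exact: reg_mS reg.
pose J := {j : multiplier | `[< ok j >]}.
have okJ (j : J) : ok (sval j) by apply/asboolP; exact: (svalP j).
have /choice[m mP] (l : seq J) : exists mu, [/\ reward_probability mu,
    forall j, List.In j l -> -1 <= (\int[mu]_(k in K) penalty (sval j) k)%R &
    v <= (\int[mu]_(k in K) r k)%R].
  apply: contrapT => nmu; apply: nex.
  (* If the list [l] had no such measure, the zero-penalty multiplier [jz] would meet the hypothesis
     of [finite_multiplier], producing the multiplier assumed not to exist. *)
  apply: (@finite_multiplier (map sval l) jz) => //.
    by move=> j /List.in_map_iff[j' [<- _]].
  move=> mu rmu muP; rewrite leNgt; apply/negP => vlt; apply: nmu; exists mu.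
  split => //; last by apply: ltW; move: vlt; rewrite /payoff jz0 addr0.
  by move=> j lj; apply: muP; apply: List.in_map.
(* Along this filter every fixed multiplier eventually belongs to the list. *)
pose F := filter_from setT (fun l0 : seq J => [set l | forall j, List.In j l0 -> List.In j l]).
have FF : ProperFilter F.
  apply: filter_from_proper; last by move=> l _; exists l.
  apply: filter_from_filter; first by exists [::].
  move=> l1 l2 _ _; exists (l1 ++ l2) => // l lP.
  by split => j lj; apply: lP; apply: List.in_or_app; [left|right].
(* The rescaled [e^-1 * j] is itself a multiplier; once it is in the list, its slack [1] is slack
   [e] for [j]. *)
have nearJ (j : multiplier) (e : R) : ok j -> 0 < e ->
    \forall l \near F, - e <= (\int[m l]_(k in K) penalty j k)%R.
  move=> okj e0; have e0' : 0 <= e^-1 by rewrite invr_ge0 ltW.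
  have [j1 ok1 j1E] := penalty_comb okz okj e0'.
  have okb : `[< ok j1 >] by exact/asboolP.
  exists [:: exist _ j1 okb] => // l lP.
  have [_ /(_ (exist _ j1 okb) (lP _ (or_introl erefl))) + _] := mP l.
  rewrite /= (eq_Rintegral _ (g := fun k : KT => e^-1 * penalty j k)); last first.
    move=> k; rewrite inE => Kk; rewrite j1E// jzE// /drift Rintegral_cst; last exact: reg_mS reg.
    by rewrite mul0r subrr add0r.
  rewrite RintegralZl//; last exact: penalty_integrable.
  by rewrite mulrC ler_pdivlMr// mulN1r.
have m1 l : m l K = 1%E by case: (mP l) => -[].
have mr l : (m l).-integrable KK (EFin \o r) by case: (mP l) => -[].
have mv l : v <= (\int[m l]_(k in K) r k)%R by case: (mP l).
have [||mu fmu muv] := @feasible_limit R ES EA S Act Q r n z p Xi u y reg utl _ F FF m v m1 mr mv.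
- move=> h ch bh e e0; have [j okj jE] := continuous_multiplier ch bh.
  apply: filterS (nearJ j e okj e0) => l.
  by rewrite (eq_Rintegral _ (g := drift S Q h : KT -> R)) // => k; rewrite inE; exact: jE.
- move=> xi Xxi e e0; have [j okj jE] := dirac_multiplier Xxi.
  have [C uC] := utility_bounded utl.
  have iu (P : probability KT R) : P.-integrable KK (EFin \o (fun k => u (z k) xi)).
    apply: (@bounded_process_integrable _ _ _ _ _ _ _ reg _ _ C (measurable_utility reg utl Xxi)).
    by move=> k Kk; exact: uC.
  apply: filterS (nearJ j e okj e0) => l.
  rewrite (eq_Rintegral _ (g := fun k : KT => u (z k) xi - y xi)); last first.
    by move=> k; rewrite inE; exact: jE.
  have icst : (m l).-integrable KK (EFin \o cst (y xi)).
    by apply: (@bounded_process_integrable _ _ _ _ _ _ _ reg _ (cst (y xi)) `|y xi|).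
  have mlK : fine (m l K) = 1 by rewrite m1.
  have Ec : (\int[m l]_(k in K) y xi = y xi)%R.
    by rewrite Rintegral_cst// [fine _]mlK mulr1.
  rewrite RintegralB//; last exact: iu.
  by rewrite Ec; lra.
have h := muv v (nearW _ mv).
by have := feasible_v fmu; rewrite ltNge h.
Qed.

End multipliers.
End strong_duality.

(** * Dual attainment *)

Lemma limn_einf_frequently_le (R : realType) (u : (\bar R)^nat) (c : \bar R) :
  (forall N, exists2 j, (N <= j)%N & (u j <= c)%E) -> (limn_einf u <= c)%E.
Proof.
move=> uc; rewrite limn_einf_lim; apply: lime_le; first exact: is_cvg_einfs.
apply: nearW => n; have [j nj uj] := uc n; apply: le_trans uj.
by apply: ereal_inf_lbound; exists j.
Qed.

Lemma limn_einf_lt_frequently (R : realType) (u : (\bar R)^nat) (c : \bar R) :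
  (limn_einf u < c)%E -> forall N, exists2 j, (N <= j)%N & (u j < c)%E.
Proof.
move=> uc N; have : (einfs u N < c)%E.
  apply: le_lt_trans uc; rewrite limn_einf_lim (cvg_lim _ (@cvg_einfs_sup _ u))//.
  by apply: ereal_sup_ubound; exists N.
by move=> /ereal_inf_lt[_ [j /= Nj <-] uj]; exists j.
Qed.

Lemma limn_einf_ge (R : realType) (u : (\bar R)^nat) (c : \bar R) :
  (forall n, (c <= u n)%E) -> (c <= limn_einf u)%E.
Proof.
move=> uc; rewrite limn_einf_lim; apply: lime_ge; first exact: is_cvg_einfs.
by apply: nearW => n; apply: le_ereal_inf_tmp => _ [j _ <-].
Qed.

Lemma measurable_fun_limn_einf d (T : measurableType d) (R : realType) (D : set T)
    (f : (T -> \bar R)^nat) : (forall n, measurable_fun D (f n)) ->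
  measurable_fun D (fun x => limn_einf (f ^~ x)).
Proof.
move=> mf; apply: (emeasurable_fun_cvg (fun n x => einfs (f ^~ x) n)).
  by move=> n; exact: measurable_fun_einfs.
by move=> x _; rewrite limn_einf_lim; exact: is_cvg_einfs.
Qed.

Lemma ultra_bounded_cvg (R : realType) (I : Type) (F : set_system I)
    (FU : UltraFilter F) (a : I -> R) (B : R) :
  (forall i, `|a i| <= B) -> exists l : R, a i @[i --> F] --> l.
Proof.
move=> aB; have := @segment_compact R (- B) B; rewrite compact_ultra.
move=> /(_ (a i @[i --> F]) (fmap_ultra _ _))[].
  by apply: nearW => i /=; rewrite in_itv/= -ler_norml.
by move=> l [_ al]; exists l.
Qed.

(** * Weak limits of measures on the compact set [Xi] *)

Section weak_limit_compact.
Context (R : realType) (p : nat) (Xi : set 'rV[R]_p) (cXi : compact Xi).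
Local Notation V := ('rV[R]_p).
Variable L : nat -> {measure set (borel V) -> \bar R}.
Variable M : R.
Hypothesis LM : forall m, (L m setT <= M%:E)%E.
Hypothesis LX : forall m, L m (~` Xi) = 0%E.

Let mX : measurable (Xi : set (borel V)) := compact_borel cXi.

Let M0 : 0 <= M.
Proof. by rewrite -lee_fin; exact: le_trans (measure_ge0 _ _) (LM 0). Qed.

Let LT m : (L m setT < +oo)%E.
Proof. exact: le_lt_trans (LM m) (ltry _). Qed.

Let LXT m : L m Xi = L m setT.
Proof.
have E : (L m (Xi `|` ~` Xi) = L m Xi + L m (~` Xi))%E.
  by rewrite measureU ?setICr//; exact: measurableC.
by rewrite -(setUv Xi) E LX adde0.
Qed.

Let measurable_cont (f : V -> R) : {within Xi, continuous f} ->
  measurable_fun (Xi : set (borel V)) f.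
Proof. by move=> cf; apply: measurable_lsc_on => //; exact: continuous_lsc_on. Qed.

(** On [Xi] both [f] and [- f] are lower semicontinuous, so two applications of the portmanteau
    inequality identify the limit of the integrals, which exists by boundedness along an
    ultrafilter. *)
Lemma compact_weak_limit (G : set_system nat) : UltraFilter G ->
  exists L' : {measure set (borel V) -> \bar R},
    [/\ (L' setT < +oo)%E, L' (~` Xi) = 0%E &
    forall f : V -> R, {within Xi, continuous f} ->
      (\int[L m]_(x in Xi) f x)%R @[m --> G] --> (\int[L']_(x in Xi) f x)%R].
Proof.
move=> GU.
have regT : regular_space V by exact: uniform_regular.
have hT : hausdorff_space V by [].
have oC : open (~` Xi) by apply: closed_openC; apply: compact_closed.
have tight e : 0 < e -> exists2 C : set V, compact C &
    forall m, (L m (~` C) <= e%:E)%E.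
  by move=> e0; exists Xi => // m; rewrite LX lee_fin ltW.
have [L' [L'T L'O]] := @ultralim_measure_exists R _ nat G GU L M LM hT regT tight.
have L'fin : (L' setT < +oo)%E by rewrite L'T ltry.
have L'X : L' (~` Xi) = 0%E.
  have fX : L' (~` Xi) \is a fin_num.
    rewrite ge0_fin_numE// (le_lt_trans _ L'fin)//.
    by apply: le_measure; rewrite ?inE//; exact: measurableC.
  apply/eqP; rewrite eq_le measure_ge0 andbT -(fineK fX) lee_fin.
  apply: le_trans (L'O _ oC) _; rewrite /ultralim.
  by under eq_fun do rewrite LX; rewrite lim_cst.
have L'XT : L' Xi = L' setT.
  have E : (L' (Xi `|` ~` Xi) = L' Xi + L' (~` Xi))%E.
    by rewrite measureU ?setICr//; exact: measurableC.
  by rewrite -(setUv Xi) E L'X adde0.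
(* The masses are not normalized: the constant added to make [f] nonnegative contributes
   [C * L m Xi], whose convergence has to be known. *)
have massc : fine (L m Xi) @[m --> G] --> fine (L' Xi).
  rewrite L'XT L'T /=; under eq_fun do rewrite LXT.
  exact: (@ultralim_cvg R _ nat G GU L M LM setT measurableT).
have port := @portmanteau_lsc R _ nat G GU L M LM L' L'fin L'O Xi mX L'X LX.
have upper (f : V -> R) (l : R) : {within Xi, continuous f} ->
    (\int[L m]_(x in Xi) f x)%R @[m --> G] --> l -> (\int[L']_(x in Xi) f x)%R <= l.
  move=> cf fl; have [C fC] := within_continuous_bounded cXi cf.
  have mf := measurable_cont cf.
  have split_int (P : {measure set (borel V) -> \bar R}) : (P setT < +oo)%E ->
      (\int[P]_(x in Xi) (f x + C)%:E =
       ((\int[P]_(x in Xi) f x)%R + C * fine (P Xi))%:E)%E.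
    move=> PT; have if_ : P.-integrable Xi (EFin \o f).
      exact: bounded_integrable mX PT mf fC.
    have ic : P.-integrable Xi (EFin \o cst C).
      by apply: (@bounded_integrable _ _ _ _ _ (cst C) `|C|).
    transitivity (\int[P]_(x in Xi) (f x + C))%R%:E.
      rewrite /Rintegral fineK//; apply: integrable_fin_num => //.
      rewrite (_ : (fun x => _) = (EFin \o f) \+ (EFin \o cst C))%E//.
      exact: integrableD.
    by rewrite RintegralD// Rintegral_cst.
  apply/ler_addgt0Pr => e e0.
  have cl : (\int[L m]_(x in Xi) f x)%R + C * fine (L m Xi) @[m --> G] -->
      l + C * fine (L' Xi).
    by apply: cvgD => //; apply: cvgMl_tmp.
  have := port (fun x => f x + C) (l + e + C * fine (L' Xi)).
  rewrite split_int// lee_fin lerD2r; apply.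
  - move=> b; have [W oW E] := continuous_lsc_on cf (b - C); exists W => //.
    by rewrite -E; apply/seteqP; split => x [Xx /=]; rewrite ltrBlDr.
  - by move=> x /fC; rewrite ler_norml => /andP[h _]; rewrite -lerBlDr sub0r.
  - have lt : l + C * fine (L' Xi) < l + e + C * fine (L' Xi) by rewrite ltrD2r ltrDl.
    apply: (filterS _ (cvgr_le _ cl _ lt)) => m hm.
    by rewrite split_int// lee_fin.
exists L'; split => // f cf; have [C fC] := within_continuous_bounded cXi cf.
have mf := measurable_cont cf.
have iL (P : {measure set (borel V) -> \bar R}) : (P setT < +oo)%E -> P.-integrable Xi (EFin \o f).
  by move=> PT; exact: bounded_integrable mX PT mf fC.
have aB m : `|(\int[L m]_(x in Xi) f x)%R| <= `|C| * M.
  apply: le_trans (le_normr_Rintegral _ _) _ => //; first exact: iL.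
  apply: (@le_trans _ _ (\int[L m]_(x in Xi) `|C|)%R).
    apply: le_Rintegral => //.
    - by apply: integrable_norm; exact: iL.
    - by apply: (@bounded_integrable _ _ _ _ _ (cst `|C|) `|C|) => // x _ /=; rewrite normr_id.
    - by move=> x Xx; apply: le_trans (fC x Xx) (ler_norm _).
  rewrite Rintegral_cst// ler_wpM2l// LXT -lee_fin fineK//.
  by rewrite ge0_fin_numE.
have [l fl] := ultra_bounded_cvg GU aB.
suff -> : (\int[L']_(x in Xi) f x)%R = l by [].
have NE (P : {measure set (borel V) -> \bar R}) : (P setT < +oo)%E ->
    (- (\int[P]_(x in Xi) f x) = \int[P]_(x in Xi) (- f x))%R.
  move=> PT; rewrite [RHS](eq_Rintegral _ (g := fun x : borel V => (-1) * f x)).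
    by rewrite RintegralZl ?mulN1r//; exact: iL.
  by move=> x _; rewrite mulN1r.
apply/eqP; rewrite eq_le (upper f l)//= -lerN2 NE//; apply: upper.
  move: cf => /subspace_continuousP cf; apply/subspace_continuousP => x Xx.
  by apply: cvgN; exact: cf.
rewrite (_ : (fun m => _) = fun m => - (\int[L m]_(x in Xi) f x)%R).
  exact: cvgN.
by apply/funext => m; rewrite NE.
Qed.

(* The masses of the cells of countably many partitions determine the weak
   limit, so that a diagonal extraction yields a sequence. *)
Lemma compact_weak_subsequence (b : nat -> R) (B : R) : (forall m, `|b m| <= B) ->
  exists (nn : nat -> nat) (L' : {measure set (borel V) -> \bar R}) (b' : R),
    [/\ (L' setT < +oo)%E, L' (~` Xi) = 0%E, b (nn j) @[j --> \oo] --> b',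
    forall f : V -> R, {within Xi, continuous f} ->
      (\int[L (nn j)]_(x in Xi) f x)%R @[j --> \oo] --> (\int[L']_(x in Xi) f x)%R &
    forall (f : V -> R) (c : \bar R), {within Xi, continuous f} ->
      ((b m)%:E - (\int[L m]_(x in Xi) f x)%R%:E)%E @[m --> \oo] --> c ->
      (b' - \int[L']_(x in Xi) f x)%R%:E = c].
Proof.
move=> bB; have [G [GU FG]] := @ultraFilterLemma nat \oo _.
have [b' bb'] := ultra_bounded_cvg GU bB.
have [L' [L'T L'X L'c]] := compact_weak_limit GU.
have [s [sP sC]] := tagsum_cvg cXi.
have mB q i : measurable ((s q).1.2 i : set (borel V)) by have [+ _ _ _ _] := sP q; apply.
pose nuB q i := ultralim G L ((s q).1.2 i).
have nuc q i : fine (L m ((s q).1.2 i)) @[m --> G] --> nuB q i.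
  exact: (@ultralim_cvg R _ nat G GU L M LM).
(* The index [nn j] brings [b] and the cell masses of the first [j + 1] partitions within [1/(j+1)]
   of their limits along [G]; these are finitely many conditions, so some [m] meets them all. *)
have /choice[nn nnP] j : exists m, `|b m - b'| < j.+1%:R^-1 /\
    forall (q : 'I_j.+1) (i : 'I_(s q).1.1), `|fine (L m ((s q).1.2 i)) - nuB q i| < j.+1%:R^-1.
  have j0 : 0 < (j.+1%:R : R)^-1 by rewrite invr_gt0.
  have n1 : \forall m \near G, `|b m - b'| < j.+1%:R^-1.
    by apply: (filterS _ (@cvgr_dist_lt _ _ _ _ _ _ _ bb' _ j0)) => m; rewrite distrC.
  have n2 : \forall m \near G, forall (q : 'I_j.+1) (i : 'I_(s q).1.1),
      `|fine (L m ((s q).1.2 i)) - nuB q i| < j.+1%:R^-1.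
    apply: filter_forall => q; apply: filter_forall => i.
    by apply: (filterS _ (@cvgr_dist_lt _ _ _ _ _ _ _ (nuc q i) _ j0)) => m; rewrite distrC.
  by have [m []] := filter_ex (filterI n1 n2); exists m.
exists nn, L', b'; split => //.
- apply/cvgrPdist_lt => e e0; near=> j.
  have [h _] := nnP j; rewrite distrC; apply: lt_trans h _.
  by near: j; exact: (near_infty_natSinv_lt (PosNum e0)).
- move=> f cf; apply/cvgrPdist_le => e e0.
  (* The error of a tag sum is relative to the mass, which is at most [M]; the [+ 1] covers
     [M = 0]. *)
  pose e1 := e / 3 / (M + 1).
  have e10 : 0 < e1 by rewrite !divr_gt0//; have := M0; lra.
  have e1M : e1 * M <= e / 3.
    rewrite /e1 mulrAC ler_pdivrMr; last by have := M0; lra.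
    by rewrite ler_pM2l ?divr_gt0//; lra.
  have [q /(_ _) sq] : exists q, forall m,
      `|(\int[L m]_(x in Xi) f x)%R - tagsum (s q).1.1 (s q).1.2 (s q).2 (L m) f| <= e / 3.
    have [q _ /(_ q (leqnn q)) sq] := sC f e1 cf e10; exists q => m.
    apply: le_trans (sq (L m) (LT m)) _; apply: le_trans e1M.
    apply: ler_wpM2l; first exact: ltW.
    by rewrite LXT -lee_fin fineK// ge0_fin_numE.
  pose Tq := \sum_(i < (s q).1.1) f ((s q).2 i) * nuB q i.
  have h1 : `|(\int[L']_(x in Xi) f x)%R - Tq| <= e / 3.
    have c1 : `|(\int[L m]_(x in Xi) f x)%R - tagsum (s q).1.1 (s q).1.2 (s q).2 (L m) f|
        @[m --> G] --> `|(\int[L']_(x in Xi) f x)%R - Tq|.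
      apply: cvg_norm; apply: cvgB; first exact: L'c.
      apply: cvg_big => [|i _]; first exact: add_continuous.
      by apply: cvgMl_tmp; exact: nuc.
    have cc : (fun=> e / 3) m @[m --> G] --> e / 3 by exact: cvg_cst.
    by apply: (le_filter_lim _ c1 cc); apply: nearW.
  have c2 : tagsum (s q).1.1 (s q).1.2 (s q).2 (L (nn j)) f @[j --> \oo] --> Tq.
    apply: cvg_big => [|i _]; first exact: add_continuous.
    apply: cvgMl_tmp; apply/cvgrPdist_lt => d d0; near=> j.
    have qj : (q < j.+1)%N by rewrite ltnS; near: j; exact: nbhs_infty_ge.
    have [_ /(_ (Ordinal qj) i) h] := nnP j; rewrite distrC; apply: lt_trans h _.
    by near: j; exact: (near_infty_natSinv_lt (PosNum d0)).
  have e30 : 0 < e / 3 by rewrite divr_gt0.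
  apply: (filterS _ (@cvgr_dist_le _ _ _ _ _ _ _ c2 _ e30)) => j hj.
  have := sq (nn j); move: h1 hj; rewrite !ler_norml => /andP[? ?] /andP[? ?] /andP[? ?].
  by apply/andP; split; lra.
(* [nn] is not claimed to tend to infinity, so the limit of the full sequence is identified along
   [G], which refines [\oo]. *)
- move=> f c cf fc.
  have g1 : ((b m)%:E - (\int[L m]_(x in Xi) f x)%R%:E)%E @[m --> G] --> c.
    by apply: cvg_trans fc; apply: cvg_app; exact: FG.
  have g2 : ((b m)%:E - (\int[L m]_(x in Xi) f x)%R%:E)%E @[m --> G] -->
      ((b' - \int[L']_(x in Xi) f x)%R)%:E.
    rewrite (_ : (fun m => _) = fun m => ((b m - \int[L m]_(x in Xi) f x)%R)%:E)//.
    apply: cvg_EFin; first exact: nearW.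
    by apply: cvgB => //; exact: L'c.
  by apply: (cvg_unique _ g2 g1); exact: ereal_hausdorff.
Unshelve. all: by end_near. Qed.

End weak_limit_compact.

(** * Lower limits of the state functions and the limiting dual constraint *)

Section dual_attainment.
Context (R : realType) (ES EA : completeMetricType R).
Variables (S : set ES) (Act : ES -> set EA).
Variable Q : ES * EA -> probability (borel ES) R.
Variable r : ES * EA -> R.
Variables (n : nat) (z : ES * EA -> 'rV[R]_n).
Variables (p : nat) (Xi : set 'rV[R]_p) (u : 'rV[R]_n -> 'rV[R]_p -> R).
Variable y : 'rV[R]_p -> R.
Local Notation K := (graph_of S Act).
Local Notation KT := (borel (ES * EA)%type).
Local Notation KK := (K : set KT).
Local Notation SS := (S : set (borel ES)).
Local Notation sw := (state_weight Act r).
Local Notation V := ('rV[R]_p).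
Hypothesis reg : regular_process S Act Q r.
Hypothesis utl : regular_utility K z Xi u y.

Let mS : measurable SS := reg_mS reg.

Section fatou.
Variables (g : nat -> ES -> R) (N : R).
Hypothesis N0 : 0 <= N.
Hypothesis mg : forall j, measurable_fun SS (g j).
Hypothesis gN : forall j s, S s -> (`|(g j s)%:E| <= N%:E * sw s)%E.

(** Where the state weight is infinite the lower limit may be infinite and [fine] sends it to [0].
    This is harmless: for [k] in [K] such states are null for [Q k], and [k.1] is not one of
    them. *)
Definition state_liminf (s : ES) : R := fine (limn_einf (fun j => (g j s)%:E)).

Lemma state_liminfE s : S s -> sw s \is a fin_num ->
  limn_einf (fun j => (g j s)%:E) = (state_liminf s)%:E /\
  `|state_liminf s| <= N * fine (sw s).
Proof.
move=> Ss sws; have gb j : `|g j s| <= N * fine (sw s).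
  by have := gN j Ss; rewrite -{1}(fineK sws) -EFinM abse_EFin lee_fin.
have lo : ((- (N * fine (sw s)))%:E <= limn_einf (fun j => (g j s)%:E))%E.
  apply: limn_einf_ge => j; rewrite lee_fin.
  by have := gb j; rewrite ler_norml => /andP[].
have hi : (limn_einf (fun j => (g j s)%:E) <= (N * fine (sw s))%:E)%E.
  apply: limn_einf_le => j; rewrite lee_fin.
  by have := gb j; rewrite ler_norml => /andP[].
have f : limn_einf (fun j => (g j s)%:E) \is a fin_num.
  by rewrite fin_numElt (lt_le_trans _ lo) ?ltNyr// (le_lt_trans hi) ?ltry.
rewrite /state_liminf fineK//; split => //.
by rewrite ler_norml -!lee_fin fineK// lo hi.
Qed.

Lemma state_liminf_weighted : weighted_functions SS sw (fun s => (state_liminf s)%:E).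
Proof.
split.
  apply/measurable_EFinP.
  apply: (measurableT_comp (@fine_measurable R setT measurableT)).
  apply: (@measurable_fun_limn_einf _ (borel ES) R SS (fun j s => (g j s)%:E)) => j.
  exact/measurable_EFinP.
apply: le_lt_trans (ltry N); apply: le_weighted_norm => //.
  exact: (state_weight_ge1 reg).
move=> s Ss sws; have [_] := state_liminfE Ss sws.
by rewrite -{2}(fineK sws) -EFinM abse_EFin lee_fin.
Qed.

Lemma state_weighted j : weighted_functions SS sw (fun s => (g j s)%:E).
Proof.
split; first exact/measurable_EFinP.
by apply: le_lt_trans (ltry N); apply: le_weighted_norm => // [|s Ss _]; [exact: (state_weight_ge1 reg)|exact: gN].
Qed.

(** Fatou's lemma for [g j + N * sw], which is nonnegative where the weight is finite; the
    integrable term [N * sw] then cancels. The bound is assumed only for arbitrarily large [j],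
    because in its application the good indices depend on [k]. *)
Lemma state_fatou k (c : R) : K k ->
  (forall J, exists2 j, (J <= j)%N & (\int[Q k]_(s in S) g j s <= c)%R) ->
  (\int[Q k]_(s in S) state_liminf s <= c)%R.
Proof.
move=> Kk freq; have isw := state_weight_integrable reg Kk.
have msw := measurable_state_weight reg.
pose S' : set (borel ES) := SS `&` [set s | (sw s < +oo)%E].
have mS' : measurable S' by exact: emeasurable_fun_infty_o.
have S'fin s : S' s -> sw s \is a fin_num.
  move=> [Ss /= swy]; rewrite ge0_fin_numE//.
  by apply: le_trans (state_weight_ge1 reg Ss).
have mN : measurable (SS `\` S') by exact: measurableD.
have N1 : Q k (SS `\` S') = 0%E.
  have [A [mA A0 sA]] := integrable_ae mS isw.
  apply: (subset_measure0 mN mA _ A0) => s [Ss nS's]; apply: sA => /= h.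
  by apply: nS's; split => //=; rewrite ltey_eq h.
have S'E : SS `\` (SS `\` S') = S'.
  by apply/seteqP; split => [s [Ss nn]|s S's]; [apply: contrapT => nS's; apply: nn|split; [case: S's|case]].
have toS' (f : ES -> R) : (Q k).-integrable SS (EFin \o f) ->
    (Q k).-integrable S' (EFin \o f) /\
    (\int[Q k]_(s in S) f s = \int[Q k]_(s in S') f s)%R.
  move=> if_; split; first by apply: (integrableS mS mS') => // s [].
  rewrite /Rintegral; congr fine.
  by rewrite (negligible_integral mN mS if_ N1) S'E.
have ig j := weighted_integrable reg (state_weighted j) Kk.
have il := weighted_integrable reg state_liminf_weighted Kk.
have mw : measurable_fun S' (fun s : borel ES => N * fine (sw s)).
  apply: measurable_funM => //.
  apply: (measurableT_comp (@fine_measurable R setT measurableT)).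
  by apply: measurable_funS msw => // s [].
have iw : (Q k).-integrable S' (EFin \o (fun s => N * fine (sw s))).
  have isw' : (Q k).-integrable S' (fun s => N%:E * sw s)%E.
    by apply: integrableZl => //; apply: (integrableS mS mS') => // s [].
  apply: (le_integrable mS' _ _ isw'); first exact/measurable_EFinP.
  move=> s S's; have -> : (N%:E * sw s = (N * fine (sw s))%:E)%E.
    by rewrite EFinM fineK// S'fin.
  by [].
pose c0 := (\int[Q k]_(s in S') (N * fine (sw s)))%R.
have addw (f : ES -> R) : (Q k).-integrable SS (EFin \o f) ->
    (\int[Q k]_(s in S') (f s + N * fine (sw s))%:E =
     ((\int[Q k]_(s in S) f s)%R + c0)%:E)%E.
  move=> if_; have [if' ->] := toS' f if_.
  transitivity (\int[Q k]_(s in S') (f s + N * fine (sw s)))%R%:E.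
    rewrite /Rintegral fineK//; apply: integrable_fin_num => //.
    rewrite (_ : (fun s => _) = (EFin \o f) \+ (EFin \o (fun s => (N * fine (sw s))%R)))%E//.
    exact: integrableD.
  by rewrite RintegralD.
have F := @fatou _ _ _ (Q k) S' mS' (fun j s => (g j s + N * fine (sw s))%:E).
have gw0 j s : S' s -> 0 <= g j s + N * fine (sw s).
  move=> S's; have Ss : S s by case: S's.
  have := gN j Ss; rewrite -{1}(fineK (S'fin s S's)) -EFinM abse_EFin lee_fin ler_norml.
  by move=> /andP[h _]; rewrite -lerBlDr sub0r.
rewrite -(lerD2r c0) -lee_fin -addw//.
apply: le_trans (le_trans _ (F _ _)) _.
- rewrite le_eqVlt; apply/orP; left; apply/eqP; apply: eq_integral => s.
  rewrite inE => S's; have Ss : S s by case: S's.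
  have [E _] := state_liminfE Ss (S'fin s S's).
  rewrite [RHS](_ : _ = (N * fine (sw s))%:E + limn_einf (fun j => (g j s)%:E))%E.
    by rewrite E -EFinD addrC.
  rewrite -limn_einf_shift//; congr limn_einf; apply/funext => j.
  by rewrite -EFinD addrC.
- move=> j; apply/measurable_EFinP; apply: measurable_funD => //.
  by apply: measurable_funS (mg j) => // s [].
- by move=> j s S's; rewrite lee_fin gw0.
- apply: limn_einf_frequently_le => J; have [j Jj gc] := freq J.
  by exists j => //; rewrite addw// lee_fin lerD2r.
Qed.

End fatou.

(** The constraint bounds the integral of [h] at the next state by a quantity containing [h] at the
    current state. Along indices where the latter is near its lower limit the bound is near the
    desired one, and Fatou's lemma takes care of the integral. *)
Lemma dual_limit (h : nat -> ES -> R) (beta : nat -> R)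
    (L : nat -> {measure set (borel V) -> \bar R}) (M B MT : R) :
  (forall m, measurable_fun SS (h m)) ->
  (forall m, (weighted_norm SS sw (fun s => (h m s)%:E) <= M%:E)%E) ->
  (forall m, (L m setT <= MT%:E)%E) -> (forall m, L m (~` Xi) = 0%E) ->
  (forall m, `|beta m| <= B) ->
  (forall m k, K k -> r k + drift S Q (h m) k + gain z Xi u (L m) k <= beta m) ->
  exists (h' : ES -> R) (b' : R) (L' : {measure set (borel V) -> \bar R}),
    [/\ weighted_functions SS sw (fun s => (h' s)%:E), (L' setT < +oo)%E,
    L' (~` Xi) = 0%E,
    forall k, K k -> r k + drift S Q h' k + gain z Xi u L' k <= b' &
    forall c : \bar R,
      ((beta m)%:E - (\int[L m]_(x in Xi) y x)%R%:E)%E @[m --> \oo] --> c ->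
      (b' - \int[L']_(x in Xi) y x)%R%:E = c].
Proof.
move=> mh hM LM LX bB feas.
have [nn [L' [b' [L'T L'X bb' L'c L'o]]]] :=
  compact_weak_subsequence (util_cXi utl) LM LX bB.
pose N := Num.max 1 M; have N0 : 0 <= N by rewrite le_max ler01.
have hN j s : S s -> (`|(h (nn j) s)%:E| <= N%:E * sw s)%E.
  exact: (@weighted_norm_bound _ (borel ES) R SS sw _ M (state_weight_ge1 reg) (hM (nn j))).
pose g j := h (nn j).
exists (state_liminf g), b', L'; split => //.
- exact: (state_liminf_weighted N0 (fun j => mh (nn j)) hN).
- move=> k Kk; have Sk : S k.1 by case: Kk.
  have [E _] := state_liminfE hN Sk (state_weight_fin reg Kk).
  rewrite /drift; suff : (\int[Q k]_(s in S) state_liminf g s <=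
      b' + state_liminf g k.1 - r k - gain z Xi u L' k)%R by lra.
  (* Half of [e] pays for the convergence of [beta - gain], half for [h] at the current state being
     near its lower limit. *)
  apply/ler_addgt0Pr => e e0; have e20 : 0 < e / 2 by rewrite divr_gt0.
  apply: (state_fatou N0 (fun j => mh (nn j)) hN Kk) => J.
  have cx : beta (nn j) - gain z Xi u (L (nn j)) k @[j --> \oo] --> b' - gain z Xi u L' k.
    by apply: cvgB => //; apply: L'c; exact: (util_cont utl).
  have lt : b' - gain z Xi u L' k < b' - gain z Xi u L' k + e / 2 by rewrite ltrDl.
  have [J1 _ J1P] := cvgr_le _ cx _ lt.
  have lt2 : (limn_einf (fun j => (g j k.1)%:E) < (state_liminf g k.1 + e / 2)%:E)%E.
    by rewrite E lte_fin ltrDl.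
  have [j jJ gj] := limn_einf_lt_frequently lt2 (maxn J J1).
  exists j; first by rewrite (leq_trans _ jJ)// leq_maxl.
  have /J1P /= h1 : (J1 <= j)%N by rewrite (leq_trans _ jJ)// leq_maxr.
  have := feas (nn j) k Kk; rewrite /drift; move: gj; rewrite lte_fin /g.
  by lra.
- by move=> c; apply: L'o; exact: (util_y utl).
Qed.

End dual_attainment.

(** * Charges and measures *)

Section nonnegative_charge.
Context d (T : measurableType d) (R : realType).
Local Open Scope ereal_scope.

(** The part of [B] in the negative set has mass both nonnegative and nonpositive, for any Hahn
    pair. *)
Lemma jordan_ge0 (nu : {charge set T -> \bar R}) (P N : set T)
    (hd : hahn_decomposition nu P N) (B : set T) : charge_ge0 nu -> measurable B ->
  jordan_pos hd B = nu B /\ jordan_neg hd B = 0.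
Proof.
move=> nu0 mB; have [[mP _] [mN negN] PN PN0] := hd.
have mBN : measurable (B `&` N) by exact: measurableI.
have BN0 : nu (B `&` N) = 0.
  apply/eqP; rewrite eq_le nu0// andbT.
  by apply: negN => //; exact: subIsetr.
have En : jordan_neg hd B = 0.
  by rewrite jordan_negE cjordan_negE /crestr0 mem_set// /crestr BN0 oppe0.
split => //; rewrite jordan_posE cjordan_posE /crestr0 mem_set// /crestr.
rewrite -[in RHS](setIT B) -PN setIUr chargeU//; last 2 first.
- exact: measurableI.
- by rewrite setIACA PN0 setI0.
by rewrite BN0 adde0.
Qed.

Lemma charge_pos_ge0E (nu : {charge set T -> \bar R}) B : charge_ge0 nu ->
  measurable B -> charge_pos nu B = nu B.
Proof. by move=> nu0 mB; exact: (jordan_ge0 (projT2 (hahn_pair nu)) nu0 mB).1. Qed.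

Lemma charge_neg_ge0E (nu : {charge set T -> \bar R}) B : charge_ge0 nu ->
  measurable B -> charge_neg nu B = 0.
Proof. by move=> nu0 mB; exact: (jordan_ge0 (projT2 (hahn_pair nu)) nu0 mB).2. Qed.

Lemma charge_pos_fin (nu : {charge set T -> \bar R}) : charge_ge0 nu ->
  charge_pos nu setT < +oo.
Proof.
by move=> nu0; rewrite charge_pos_ge0E// ltey_eq fin_num_measure.
Qed.

Lemma charge_integral_ge0 (nu : {charge set T -> \bar R}) (m : {measure set T -> \bar R})
    (D : set T) (f : T -> \bar R) : charge_ge0 nu -> measurable D ->
  (forall B, measurable B -> m B = nu B) ->
  charge_integral nu D f = \int[m]_(x in D) f x /\
  \int[charge_abs nu]_(x in D) f x = \int[m]_(x in D) f x.
Proof.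
move=> nu0 mD mE; split.
  rewrite /charge_integral (eq_measure_integral m); last first.
    by move=> B mB _; rewrite charge_pos_ge0E// mE.
  rewrite (eq_measure_integral mzero (m1 := charge_neg nu)); last first.
    by move=> B mB _; rewrite charge_neg_ge0E.
  by rewrite integral_measure_zero sube0.
apply: eq_measure_integral => B mB _; rewrite mE//.
transitivity (charge_pos nu B + charge_neg nu B) => //.
by rewrite charge_pos_ge0E// charge_neg_ge0E// adde0.
Qed.

End nonnegative_charge.

Section finite_measure_of.
Context d (T : measurableType d) (R : realType).
Variables (m : {measure set T -> \bar R}) (mfin : (m setT < +oo)%E).

Definition finite_measure_of of (m setT < +oo)%E : set T -> \bar R := m.

Local Notation fm := (finite_measure_of mfin).

HB.instance Definition _ := Measure.on fm.
HB.instance Definition _ := @Measure_isFinite.Build _ _ _ fm (lty_fin_num_fun mfin).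

Definition charge_of_measure : {charge set T -> \bar R} := charge_of_finite_measure fm.

Lemma charge_of_measureE B : charge_of_measure B = m B.
Proof. by []. Qed.

Lemma charge_of_measure_ge0 : charge_ge0 charge_of_measure.
Proof. by move=> B _; rewrite charge_of_measureE. Qed.

End finite_measure_of.

Section charges.
Context (R : realType) (ES EA : completeMetricType R).
Variables (S : set ES) (Act : ES -> set EA).
Variable Q : ES * EA -> probability (borel ES) R.
Variable r : ES * EA -> R.
Variables (n : nat) (z : ES * EA -> 'rV[R]_n).
Variables (p : nat) (Xi : set 'rV[R]_p) (u : 'rV[R]_n -> 'rV[R]_p -> R).
Variable y : 'rV[R]_p -> R.
Local Notation K := (graph_of S Act).
Local Notation KT := (borel (ES * EA)%type).
Local Notation KK := (K : set KT).
Local Notation SS := (S : set (borel ES)).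
Local Notation sw := (state_weight Act r).
Local Notation V := ('rV[R]_p).
Hypothesis reg : regular_process S Act Q r.
Hypothesis utl : regular_utility K z Xi u y.

Let mK : measurable KK := measurable_graph reg.
Let mX : measurable (Xi : set (borel V)) := compact_borel (util_cXi utl).
Let mR : measurable_fun KK r := measurable_reward reg.

Let Rint (P : probability KT R) (f : ES * EA -> R) : P.-integrable KK (EFin \o f) ->
  (\int[P]_(k in K) (f k)%:E = (\int[P]_(k in K) f k)%R%:E)%E.
Proof. by move=> if_; rewrite /Rintegral fineK//; exact: integrable_fin_num. Qed.

Let iu (P : probability KT R) xi : Xi xi -> P.-integrable KK (EFin \o (fun k => u (z k) xi)).
Proof.
move=> Xxi; have [C uC] := utility_bounded utl.
apply: (@bounded_process_integrable _ _ _ _ _ _ _ reg _ _ C (measurable_utility reg utl Xxi)).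
by move=> k Kk; exact: uC.
Qed.

Lemma primal_feasible_probability nu : primal_feasible S Act Q r z Xi u y nu ->
  exists2 mu : probability KT R, feasible_probability S Act Q r z Xi u y mu &
    primal_objective S Act r nu = (\int[mu]_(k in K) r k)%R%:E.
Proof.
move=> [[nuK wnu] nu0 st mass dom].
pose m := charge_pos nu.
have mE (B : set KT) : measurable B -> m B = nu B by exact: charge_pos_ge0E.
have ci f := @charge_integral_ge0 _ KT R nu m KK f nu0 mK mE.
have mK1 : m K = 1%E by have := mass; rewrite (ci _).1 integral_cst// mul1e.
have mK0 : m (~` K) = 0%E.
  have mC : measurable (~` K : set KT) by exact: measurableC.
  by rewrite mE// nuK// setICl.
have mT : m setT = 1%E.
  have E : (m (K `|` ~` K) = m K + m (~` K))%E.
    by rewrite measureU ?setICr//; exact: measurableC.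
  by rewrite -(setUv K) E mK1 mK0 adde0.
pose mu : probability KT R := probability_of_measure mT.
have cimu (f : KT -> \bar R) : charge_integral nu KK f = (\int[mu]_(k in K) f k)%E by rewrite (ci f).1.
have ir : mu.-integrable KK (EFin \o r).
  apply/integrableP; split; first exact/measurable_EFinP.
  move: wnu; rewrite (ci _).2; apply: le_lt_trans.
  apply: ge0_le_integral => //.
  - by apply: measurableT_comp => //; exact/measurable_EFinP.
  - rewrite (_ : weight r = fun k => (1 - r k)%:E); last by apply/funext => k; exact: weightE.
    by apply/measurable_EFinP; exact: measurable_funB.
  - move=> k /(reg_r0 reg) rk; rewrite /= weightE lee_fin ler0_norm//; lra.
exists mu; last by rewrite /primal_objective cimu Rint.
split => //.
- move=> B mB BS; have := st B mB BS; rewrite /L0 cimu.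
  have mf1 : measurable (fst @^-1` B : set KT).
    have cfst : continuous (fst : ES * EA -> ES) by move=> k; exact: cvg_fst.
    by rewrite -[X in measurable X]setTI; exact: (measurable_borel_continuous cfst).
  have fB : m (fst @^-1` B) \is a fin_num by apply: lty_fin_num_fun => //; rewrite mT ltry.
  rewrite /pushforward -mE// => E.
  (* A difference equal to [0] whose first term is finite forces the second term to be finite. *)
  have fI : (\int[mu]_(k in K) Q k B)%E \is a fin_num.
    by move: E fB; case: (\int[mu]_(k in K) Q k B)%E => [x| |]; case: (m _) => [?| |].
  by move: E => /eqP; rewrite sube_eq ?fin_num_adde_defl// add0e => /eqP.
- move=> xi Xxi; have := dom xi Xxi; rewrite /L1 cimu Rint ?lee_fin//.
  exact: iu.
Qed.

Lemma feasible_probability_primal (mu : probability KT R) :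
  feasible_probability S Act Q r z Xi u y mu ->
  exists2 nu, primal_feasible S Act Q r z Xi u y nu &
    primal_objective S Act r nu = (\int[mu]_(k in K) r k)%R%:E.
Proof.
move=> [muK ir st dom].
pose nu := charge_of_measure (probability_lty mu).
have nu0 : charge_ge0 nu by exact: charge_of_measure_ge0.
have ci f := @charge_integral_ge0 _ KT R nu mu KK f nu0 mK (fun B _ => erefl).
exists nu; last by rewrite /primal_objective (ci _).1 Rint.
split => //.
- split.
    move=> B mB BK; rewrite /nu charge_of_measureE.
    apply: (subset_measure0 mB (measurableC mK) _ (graph_conull reg muK)).
    by apply/disjoints_subset.
  rewrite (ci _).2 (_ : weight r = (fun k => (1 - r k)%:E)); last by apply/funext => k; exact: weightE.
  have ic : mu.-integrable KK (EFin \o cst 1) by apply: (@bounded_process_integrable _ _ _ _ _ _ _ reg _ (cst 1) 1) => // k _ /=; rewrite normr1.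
  exact: (integrable_lty mK (integrableB mK ic ir)).
- move=> B mB BS; rewrite /L0 (ci _).1.
  have cfst : continuous (fst : ES * EA -> ES) by move=> k; exact: cvg_fst.
  have mf1 : measurable (fst @^-1` B : set KT).
    by rewrite -[X in measurable X]setTI; exact: (measurable_borel_continuous cfst).
  have fB : mu (fst @^-1` B) \is a fin_num.
    by rewrite ge0_fin_numE// (le_lt_trans (probability_le1 mu mf1))// ltry.
  have -> : (\int[mu]_(k in K) Q k B = mu (fst @^-1` B))%E by rewrite st.
  exact: (subee fB).
- by rewrite (ci _).1 integral_cst// mul1e.
- move=> xi Xxi; rewrite /L1 (ci _).1 Rint ?lee_fin ?dom//.
  exact: iu.
Qed.

Let cint (m : {measure set (borel V) -> \bar R}) (f : V -> R) : (m setT < +oo)%E ->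
  {within Xi, continuous f} ->
  (\int[m]_(x in Xi) (f x)%:E = (\int[m]_(x in Xi) f x)%R%:E)%E.
Proof.
move=> mT cf; have [C fC] := within_continuous_bounded (util_cXi utl) cf.
rewrite /Rintegral fineK//; apply: integrable_fin_num => //.
apply: (bounded_integrable mX mT _ fC); apply: measurable_lsc_on => //.
exact: continuous_lsc_on.
Qed.

Let dual_constraint (h : ES -> R) (beta : R) (m : {measure set (borel V) -> \bar R}) k :
  (m setT < +oo)%E -> weighted_functions SS sw (fun s => (h s)%:E) -> K k ->
  ((r k)%:E + \int[m]_(xi in Xi) (u (z k) xi)%:E
    <= beta%:E + (h k.1)%:E - \int[Q k]_(s in S) (h s)%:E)%E =
  (r k + drift S Q h k + gain z Xi u m k <= beta).
Proof.
move=> mT wh Kk; rewrite cint//; last exact: (util_cont utl).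
have ih := weighted_integrable reg wh Kk.
have -> : (\int[Q k]_(s in S) (h s)%:E = (\int[Q k]_(s in S) h s)%R%:E)%E.
  by rewrite /Rintegral fineK//; apply: integrable_fin_num => //; exact: reg_mS reg.
by rewrite -!EFinD lee_fin /drift /gain; apply/idP/idP; lra.
Qed.

Lemma dual_feasible_measure h beta Lam : dual_feasible S Act Q r z Xi u (h, beta, Lam) ->
  let m := charge_pos Lam in
  [/\ (m setT < +oo)%E, m (~` Xi) = 0%E, weighted_functions SS sw (fun s => (h s)%:E),
    forall k, K k -> r k + drift S Q h k + gain z Xi u m k <= beta &
    dual_objective Xi y (h, beta, Lam) = (beta%:E - (\int[m]_(x in Xi) y x)%R%:E)%E].
Proof.
move=> [wh LX L0 feas] m.
have mT : (m setT < +oo)%E by exact: charge_pos_fin.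
have mE (B : set (borel V)) : measurable B -> m B = Lam B by exact: charge_pos_ge0E.
have ci f := (@charge_integral_ge0 _ (borel V) R Lam m Xi f L0 mX mE).1.
split => //.
- have mC : measurable (~` Xi : set (borel V)) by exact: measurableC.
  by rewrite mE// LX// setICl.
- by move=> k Kk; rewrite -dual_constraint// -ci; exact: feas.
- by rewrite /dual_objective/= ci cint//; exact: (util_y utl).
Qed.

Lemma measure_dual_feasible (h : ES -> R) (beta : R)
    (m : {measure set (borel V) -> \bar R}) :
  (m setT < +oo)%E -> m (~` Xi) = 0%E -> weighted_functions SS sw (fun s => (h s)%:E) ->
  (forall k, K k -> r k + drift S Q h k + gain z Xi u m k <= beta) ->
  exists2 x, dual_feasible S Act Q r z Xi u x &
    dual_objective Xi y x = (beta - \int[m]_(x in Xi) y x)%R%:E.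
Proof.
move=> mT mX0 wh feas; pose Lam := charge_of_measure mT.
have L0 : charge_ge0 Lam by exact: charge_of_measure_ge0.
have ci f := (@charge_integral_ge0 _ (borel V) R Lam m Xi f L0 mX (fun B _ => erefl)).1.
exists (h, beta, Lam); last first.
  by rewrite /dual_objective/= ci cint ?EFinB//; exact: (util_y utl).
split => //.
- move=> B mB BX; rewrite /Lam charge_of_measureE.
  apply: (subset_measure0 mB (measurableC mX) _ mX0).
  by apply/disjoints_subset.
- by move=> k Kk; rewrite ci dual_constraint//; exact: feas.
Qed.

End charges.

Theorem theorem5p3 (R : realType)
  (* Borel state and action spaces, admissible state-action pairs *)
  (ES EA : completeMetricType R) (sepES : separable ES) (sepEA : separable EA)
  (S : set ES) (mS : measurable (S : set (borel ES)))
  (A : set EA) (mA : measurable (A : set (borel EA)))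
  (Act : ES -> set EA)
  (ActA : forall s, S s -> Act s `<=` A)
  (mAct : forall s, S s -> measurable (Act s : set (borel EA)))
  (clK : closed_in (graph_of S Act) (S `*` A))
  (* transition law, reward, vector of outcomes *)
  (Q : ES * EA -> probability (borel ES) R)
  (kQ : stochastic_kernel_on S Act Q)
  (r : ES * EA -> R)
  (mr : measurable_fun (graph_of S Act : set (borel (ES * EA)%type)) r)
  (n : nat) (z : ES * EA -> 'rV[R]_n)
  (mz : measurable_fun (graph_of S Act : set (borel (ES * EA)%type))
          (z : borel (ES * EA)%type -> borel 'rV[R]_n))
  (* utilities and benchmark *)
  (p : nat) (Xi : set 'rV[R]_p) (cXi : compact Xi)
  (u : 'rV[R]_n -> 'rV[R]_p -> R)
  (incru : forall xi, Xi xi -> nondecreasing_rV (u ^~ xi))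
  (concu : forall xi, Xi xi -> concave_rV (u ^~ xi))
  (contu : forall x, {within Xi, continuous (u x)})
  (d : measure_display) (Omega : measurableType d) (P : probability Omega R)
  (Y : {RV P >-> borel 'rV[R]_n})
  (intY : forall xi, Xi xi ->
     P.-integrable [set: Omega] (fun omega => (u (Y omega) xi)%:E))
  (conty : {within Xi, continuous (benchmark P u Y)})
  (* feasibility, compactness, continuity and boundedness assumptions *)
  (H1 : primal_feasible S Act Q r z Xi u (benchmark P u Y) !=set0)
  (H2 : forall k, graph_of S Act k -> r k <= 0)
  (H2' : forall eps : R, 0 <= eps ->
     compact (graph_of S Act `&` [set k | - eps <= r k]))
  (H3 : forall i, bounded_on (graph_of S Act) (fun k => z k ord0 i))
  (H3' : forall i,
     upper_semicontinuous_on (graph_of S Act) (fun k => z k ord0 i))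
  (H4 : weakly_continuous_on S Act Q)
  (H5 : forall xi, Xi xi ->
     weighted_functions (graph_of S Act : set (borel (ES * EA)%type))
       (weight r) (fun k => (u (z k) xi)%:E))
  (H6 : weighted_functions (graph_of S Act : set (borel (ES * EA)%type))
     (weight r) (fun k => \int[Q k]_(s in S) state_weight Act r s)%E)
  (H7 : exists (h : nat -> ES -> R) (beta : nat -> R)
     (Lambda : nat -> {charge set (borel 'rV[R]_p) -> \bar R}),
     [/\ forall m, dual_feasible S Act Q r z Xi u (h m, beta m, Lambda m),
         dual_objective Xi (benchmark P u Y) (h m, beta m, Lambda m)
           @[m --> \oo] --> dual_value S Act Q r z Xi u (benchmark P u Y),
         exists M : R, forall m, `|beta m| <= M,
         exists M : R, forall m,
           (weighted_norm (S : set (borel ES)) (state_weight Act r)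
              (fun s => (h m s)%:E) <= M%:E)%E &
         weak_star_bounded Xi Lambda]) :
  [/\ primal_value S Act Q r z Xi u (benchmark P u Y)
        = dual_value S Act Q r z Xi u (benchmark P u Y),
      exists2 x, dual_feasible S Act Q r z Xi u x &
        dual_objective Xi (benchmark P u Y) x
        = dual_value S Act Q r z Xi u (benchmark P u Y) &
      exists2 mu, primal_feasible S Act Q r z Xi u (benchmark P u Y) mu &
        primal_objective S Act r mu
        = primal_value S Act Q r z Xi u (benchmark P u Y)].
Proof.
set y := benchmark P u Y.
pose K := graph_of S Act.
have reg : regular_process S Act Q r by split.
have utl : regular_utility K z Xi u y by split.
have [nu0 fnu0] := H1; have [mu0 fmu0 _] := primal_feasible_probability reg utl fnu0.
set PV := primal_value _ _ _ _ _ _ _ _; set DV := dual_value _ _ _ _ _ _ _ _.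
have PV_ub mu : feasible_probability S Act Q r z Xi u y mu ->
    ((\int[mu]_(k in K) r k)%R%:E <= PV)%E.
  move=> fmu; have [nu fnu <-] := feasible_probability_primal reg utl fmu.
  by apply: ereal_sup_ubound; exists nu.
have PV_le0 : (PV <= 0)%E.
  apply: ge_ereal_sup => _ [nu fnu <-].
  have [mu [_ ir _ _] ->] := primal_feasible_probability reg utl fnu.
  rewrite lee_fin -oppr_ge0 -[leRHS]mulN1r -RintegralZl//; last exact: measurable_graph reg.
  by apply: Rintegral_ge0 => k Kk; rewrite mulN1r oppr_ge0 H2.
have [v PVE] : exists v : R, PV = v%:E.
  exists (fine PV); rewrite fineK// fin_numElt (lt_le_trans (ltNyr _) (PV_ub mu0 fmu0)).
  by rewrite (le_lt_trans PV_le0) ?ltry.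
have weak x : dual_feasible S Act Q r z Xi u x -> (PV <= dual_objective Xi y x)%E.
  move: x => [[h beta] Lam] fx; apply: ge_ereal_sup => _ [nu fnu <-].
  have [mu fmu ->] := primal_feasible_probability reg utl fnu.
  have [LT LX wh feas ->] := dual_feasible_measure reg utl fx.
  by rewrite -EFinB lee_fin; exact: (weak_duality reg utl fmu wh LT feas).
have PD : (PV <= DV)%E by apply: le_ereal_inf_tmp => _ [x fx <-]; exact: weak.
have DP : (DV <= PV)%E.
  apply/lee_addgt0Pr => e e0; rewrite PVE -EFinD.
  (* [strong_multiplier] needs a level strictly above all feasible rewards, hence [v + e]. *)
  have below mu : feasible_probability S Act Q r z Xi u y mu ->
      (\int[mu]_(k in K) r k < v + e)%R.
    move=> /PV_ub; rewrite PVE lee_fin => /le_lt_trans; apply.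
    by rewrite ltrDl.
  have [[h L] [ch bh LT LX] hL] := strong_multiplier reg utl fmu0 below.
  (* This value of [beta] makes the dual objective, which subtracts the integral of [y], equal to
     [v + e]. *)
  have feas k : K k -> r k + drift S Q h k + gain z Xi u L k <=
      v + e + (\int[L]_(x in Xi) y x)%R.
    by move=> /hL; rewrite /penalty/=; lra.
  have [x fx xE] := measure_dual_feasible reg utl LT LX (bounded_weighted reg ch bh) feas.
  apply: (@le_trans _ _ (dual_objective Xi y x)); first by apply: ereal_inf_lbound; exists x.
  by rewrite xE addrK.
have PVDV : PV = DV by apply/eqP; rewrite eq_le PD DP.
split => //.
- have [h [beta [Lam [feas cobj [B bB] [M hM] wb]]]] := H7.
  pose L m := charge_pos (Lam m).
  have dm m := dual_feasible_measure reg utl (feas m).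
  have mX := compact_borel cXi.
  (* Weak* boundedness tested on the constant [1] bounds the total masses, the measures being
     nonnegative. *)
  have [MT massT] := wb (cst 1) (continuous_subspaceT (fun _ => cvg_cst _)).
  have LM m : (L m setT <= MT%:E)%E.
    have [wh LX L0 _] := feas m.
    have mE (C : set (borel 'rV[R]_p)) : measurable C -> L m C = Lam m C by exact: charge_pos_ge0E.
    have [LT LXC _ _ _] := dm m.
    have E : (L m (Xi `|` ~` Xi) = L m Xi + L m (~` Xi))%E.
      by rewrite measureU ?setICr//; exact: measurableC.
    rewrite -(setUv Xi) E LXC adde0.
    have ci : charge_integral (Lam m) Xi (fun xi => (cst 1 xi)%:E) = L m Xi.
      rewrite (charge_integral_ge0 _ L0 mX mE).1.
      by rewrite (integral_cst (L m) mX 1) mul1e.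
    by have := massT m; rewrite ci gee0_abs.
  have [h' [b' [L' [wh' L'T L'X feas' obj']]]] :=
    @dual_limit R ES EA S Act Q r n z p Xi u y reg utl h beta L M B MT
    (fun m => let: And5 _ _ wh _ _ := dm m in (measurable_EFinP _ _).1 wh.1)
    hM LM (fun m => let: And5 _ LX _ _ _ := dm m in LX) bB
    (fun m => let: And5 _ _ _ f _ := dm m in f).
  have [x fx xE] := measure_dual_feasible reg utl L'T L'X wh' feas'.
  exists x => //; rewrite xE; apply: obj'.
  rewrite (_ : (fun m => _) = fun m => dual_objective Xi y (h m, beta m, Lam m))//.
  by apply/funext => m; have [_ _ _ _ ->] := dm m.
- have adh i : exists mu, feasible_probability S Act Q r z Xi u y mu /\
      v - i.+1%:R^-1 <= (\int[mu]_(k in K) r k)%R.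
    have i0 : 0 < (i.+1%:R : R)^-1 by rewrite invr_gt0.
    have fPV : PV \is a fin_num by rewrite PVE.
    have [_ [nu fnu <-]] := ub_ereal_sup_adherent i0 fPV.
    have [mu fmu ->] := primal_feasible_probability reg utl fnu => h.
    have : (PV - (i.+1%:R^-1)%:E < (\int[mu]_(k in K) r k)%R%:E)%E := h.
    by rewrite PVE -EFinB lte_fin => /ltW ?; exists mu.
  have [m mP] := choice adh.
  have m1 i : m i K = 1%E by case: (mP i) => -[].
  have mr_ i : (m i).-integrable (K : set (borel (ES * EA)%type)) (EFin \o r).
    by case: (mP i) => -[].
  (* A uniform lower bound on the rewards is what makes the maximizing sequence tight. *)
  have mv i : v - 1 <= (\int[m i]_(k in K) r k)%R.
    have [_] := mP i; apply: le_trans; rewrite lerD2l lerN2.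
    by rewrite invf_le1 ?ltr0n// ler1n.
  have [||mu fmu muv] := @feasible_limit R ES EA S Act Q r n z p Xi u y reg utl nat \oo _ m (v - 1) m1 mr_ mv.
  + move=> h ch bh e e0; apply: nearW => i; have [[muK ir st _] _] := mP i.
    have [_ ->] := drift_integral reg muK ir st (bounded_weighted reg ch bh).
    by rewrite oppr_le0 ltW.
  + move=> xi Xxi e e0; apply: nearW => i; have [[_ _ _ /(_ xi Xxi) yu] _] := mP i.
    by apply: le_trans yu; rewrite lerBlDr lerDl ltW.
  have [nu fnu nuE] := feasible_probability_primal reg utl fmu.
  exists nu => //; apply/eqP; rewrite eq_le; apply/andP; split.
    by rewrite nuE; exact: PV_ub.
  rewrite nuE -/PV PVE lee_fin; apply/ler_addgt0Pr => e e0.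
  rewrite -lerBlDr; apply: muv; near=> i.
  have [_] := mP i; apply: le_trans; rewrite lerD2l lerN2 ltW//.
  by near: i; exact: (near_infty_natSinv_lt (PosNum e0)).
Unshelve. all: by end_near. Qed.
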